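(* Let $[a,b]$ be a compact interval such that the function $(c,\vec x)\mapsto\det(\mathcal H_{\Phi_c(\vec x)})$ from $[a,b]\times\mathcal S$ to $\mathbb R$ does not vanish, and let $\vec\varphi_{c,1},\dots,\vec\varphi_{c,s}$ denote the solutions $\vec\varphi$ of $\nabla_{\Phi_c(\vec\varphi)}=0$ that correspond to local minimums of $\Phi_c$. Then, when $c=\frac mn$ is in $[a,b]$, the asymptotics of the number of $(n,m)$-$(R,\vec r)$-graphs is $$G_{R,\vec r}(n,m)\sim\frac{n^{2m}}{2^m m!}\sum_{\vec\varphi\in\{\vec\varphi_{c,1},\dots,\vec\varphi_{c,s}\}}\left(\frac{\vec r^{\;\vec\varphi}}{\vec\varphi^{\;\vec\varphi}}\right)^n\frac{(\vec\varphi^{T}R\vec\varphi)^m}{\sqrt{\det(\mathcal H_{\Phi_c(\vec\varphi)})\prod_{i=1}^q\varphi_i}} .$$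
   Context: Fix a positive integer $q$, an irreducible symmetric $q\times q$ matrix $R$ and a vector $\vec r=(r_1,\dots,r_q)^T$, both with non-negative coefficients. Vectors are column vectors; $\vec u^{\,\vec v}=\prod_i u_i^{v_i}$; $\log$ acts coordinate-wise; $\mathrm{diag}(\vec x)$ is the diagonal matrix with diagonal $\vec x$. Asymptotics are for $n\to\infty$ with $R,\vec r$ fixed. Graphs are labelled, with vertex set $\{1,\dots,n\}$; loops and multiple edges are allowed. For a graph $G$ with $n$ vertices and $m$ edges, $\mathrm{seqv}(G)$ is the number of sequences $(v_1,w_1,\dots,v_m,w_m)\in\{1,\dots,n\}^{2m}$ such that the multiset of unordered pairs $\overline{v_iw_i}$ is the edge multiset of $G$, and $\kappa(G)=\mathrm{seqv}(G)/(2^m m!)$. An $(R,\vec r)$-graph is a labelled graph in which each vertex $v$ is given a type $t(v)\in\{1,\dots,q\}$; its weight is $\omega(G)=\kappa(G)\prod_{u}r_{t(u)}\prod_{\overline{vw}}R_{t(v),t(w)}$ (products over vertices and edges, with multiplicity). The ''number'' of $(R,\vec r)$-graphs in a family is the sum of their weights; $G_{R,\vec r}(n,m)$ is the number of $(n,m)$-$(R,\vec r)$-graphs, i.e. those with $n$ vertices and $m$ edges. Let $\mathcal S=\{\vec x\in\mathbb R_{\ge0}^q : x_1+\dots+x_q=1\}$ and, on $\mathcal S$ (with the convention $0\log 0=0$), $$\Phi_c(\vec x)=\sum_i x_i(\log x_i-\log r_i)-c\log(\vec x^TR\vec x).$$ Let $E$ denote a $q\times(q-1)$ matrix with left-kernel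 of dimension $1$ containing the all-ones row vector (for example, the matrix whose first $q-1$ rows form the identity matrix and whose last row is $(-1,\dots,-1)$). The gradient and Hessian (the coefficients in the Taylor expansion of $\vec\epsilon\mapsto\Phi_c(\vec x+E\vec\epsilon)$ near any point $\vec x$ of the interior of $\mathcal S$) are $$\nabla_{\Phi_c(\vec x)}=\Big(\log(\vec x)^T-\log(\vec r)^T-\tfrac{2c}{\vec x^TR\vec x}\vec x^TR\Big)E,$$ $$\mathcal H_{\Phi_c(\vec x)}=E^T\Big(\mathrm{diag}(\vec x)^{-1}+\tfrac{2c}{\vec x^TR\vec x}\big(\tfrac{2}{\vec x^TR\vec x}R\vec x\,\vec x^TR-R\big)\Big)E .$$
   Formalization: The coefficients of r are taken strictly positive (log r must be defined), and E is normalised so that its first q−1 rows have determinant ±1, as in the example; for any other E the determinant of the Hessian is rescaled and the formula is false. *)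

(* Defs.v *)
From HB Require Import structures.
From mathcomp Require Import all_boot all_order all_algebra.
From mathcomp Require Import all_classical all_reals all_analysis.
Import Order.TTheory GRing.Theory Num.Theory.
Import numFieldNormedType.Exports.

Set Implicit Arguments.
Unset Strict Implicit.
Unset Printing Implicit Defensive.

Local Open Scope classical_set_scope.
Local Open Scope ring_scope.

(* An unordered pair of vertices, loops included, is encoded by its unique
   representative (v, w) with v <= w. *)
Definition edge (n : nat) : finType := {e : 'I_n * 'I_n | (e.1 <= e.2)%N}.

Fact mk_edge_subproof (n : nat) (v w : 'I_n) :
  let e := if (v <= w)%N then (v, w) else (w, v) in (e.1 <= e.2)%N.
Proof. by case: ifPn => //=; rewrite -ltnNge => /ltnW. Qed.

Definition mk_edge (n : nat) (v w : 'I_n) : edge n :=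
  exist (fun e : 'I_n * 'I_n => (e.1 <= e.2)%N) _ (mk_edge_subproof v w).

(* A multigraph is its edge multiset, given by multiplicities; bounding each
   multiplicity by m loses nothing and makes the type finite. *)
Definition mgraph (n m : nat) : finType :=
  {G : {ffun edge n -> 'I_m.+1} | (\sum_(e : edge n) G e == m)%N}.

Definition mult (n m : nat) (G : mgraph n m) (e : edge n) : nat := val G e.

Definition seqv (n m : nat) (G : mgraph n m) : nat :=
  #|[set s : m.-tuple ('I_n * 'I_n) |
      [forall e : edge n,
         count_mem e [seq mk_edge p.1 p.2 | p <- s] == mult G e]]%SET|.

Definition kappa (K : realType) (n m : nat) (G : mgraph n m) : K :=
  (seqv G)%:R / (2 ^ m * m`!)%:R.

(* A graph together with the types of its vertices. *)
Definition typed_graph (q n m : nat) : finType :=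
  (mgraph n m * {ffun 'I_n -> 'I_q})%type.

(* For an edge the choice of representative does not matter as soon as R is
   symmetric. *)
Definition weight (K : realType) (q : nat) (R : 'M[K]_q) (r : 'cV[K]_q)
    (n m : nat) (G : typed_graph q n m) : K :=
  kappa K G.1 * (\prod_(u < n) r (G.2 u) 0) *
  \prod_(e : edge n) R (G.2 (val e).1) (G.2 (val e).2) ^+ mult G.1 e.

Definition graph_number (K : realType) (q : nat) (R : 'M[K]_q) (r : 'cV[K]_q)
    (n m : nat) : K :=
  \sum_(G : typed_graph q n m) weight R r G.

(* No simultaneous permutation of rows and columns makes R block triangular. *)
Definition irreducible_mx (K : realType) (q : nat) (R : 'M[K]_q) : Prop :=
  forall A : {set 'I_q}, A != finset.set0 -> A != finset.setT ->
    exists i j, [/\ i \in A, j \notin A & R i j != 0].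

Definition simplex (K : realType) (q : nat) : set 'cV[K]_q :=
  [set x | (forall i, 0 <= x i 0) /\ \sum_i x i 0 = 1].

(* Interior relative to the hyperplane of vectors with coordinate sum 1. *)
Definition simplex_int (K : realType) (q : nat) : set 'cV[K]_q :=
  [set x | (forall i, 0 < x i 0) /\ \sum_i x i 0 = 1].

Definition quad (K : realType) (q : nat) (R : 'M[K]_q) (x : 'cV[K]_q) : K :=
  (x^T *m R *m x) 0 0.

(* As ln 0 = 0, the summand vanishes when x i 0 = 0. *)
Definition Phi (K : realType) (q : nat) (R : 'M[K]_q) (r : 'cV[K]_q)
    (c : K) (x : 'cV[K]_q) : K :=
  \sum_i x i 0 * (ln (x i 0) - ln (r i 0)) - c * ln (quad R x).

(* The columns of E span the vectors with coordinate sum 0. The formula for the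
   number of graphs contains the determinant of the Hessian in the coordinates
   given by E, which is multiplied by (\det A) ^+ 2 when E is replaced by
   E *m A; the last condition fixes this factor. It holds for the matrix whose
   first q - 1 rows form the identity and whose last row is (-1, ..., -1). *)
Definition param_mx (K : realType) (q : nat) (E : 'M[K]_(q, q.-1)) : Prop :=
  [/\ \rank (kermx E) = 1%N,
      ((const_mx 1 : 'rV[K]_q) <= kermx E)%MS
    & `|\det (rowsub (widen_ord (leq_pred q)) E)| = 1].

Definition grad_Phi (K : realType) (q : nat) (R : 'M[K]_q) (r : 'cV[K]_q)
    (E : 'M[K]_(q, q.-1)) (c : K) (x : 'cV[K]_q) : 'rV[K]_(q.-1) :=
  ((map_mx (@ln K) x)^T - (map_mx (@ln K) r)^T
     - (2 * c / quad R x) *: (x^T *m R)) *m E.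

Definition hess_Phi (K : realType) (q : nat) (R : 'M[K]_q)
    (E : 'M[K]_(q, q.-1)) (c : K) (x : 'cV[K]_q) : 'M[K]_(q.-1) :=
  E^T *m (invmx (diag_mx x^T)
    + (2 * c / quad R x) *:
        ((2 / quad R x) *: (R *m x *m (x^T *m R)) - R)) *m E.

Definition local_minima (K : realType) (q : nat) (R : 'M[K]_q) (r : 'cV[K]_q)
    (E : 'M[K]_(q, q.-1)) (c : K) : set 'cV[K]_q :=
  [set phi | [/\ simplex_int phi, grad_Phi R r E c phi = 0
    & \forall x \near phi, simplex x -> Phi R r c phi <= Phi R r c x]].

Definition vpow (K : realType) (q : nat) (u v : 'cV[K]_q) : K :=
  \prod_i (u i 0 `^ v i 0).

(* Main.v *)
Require Import Defs.
From HB Require Import structures.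
From mathcomp Require Import all_boot all_order all_algebra.
From mathcomp Require Import all_classical all_reals all_analysis.
From mathcomp Require Import ring lra.
Import Order.TTheory GRing.Theory Num.Theory.
Import numFieldNormedType.Exports.

Set Implicit Arguments.
Unset Strict Implicit.
Unset Printing Implicit Defensive.

Local Open Scope classical_set_scope.
Local Open Scope ring_scope.

(** Counting the [m]-tuples of ordered pairs of vertices and grouping the typings by the
    numbers [k i] of vertices of each type gives the exact formula
      [n ^ (2 m) / (2 ^ m m!) * \sum_k (n! / \prod_i (k i)!) r ^ k (x^T R x) ^ m],
    where [x = k / n].  By Stirling's formula the term of [k] is close to
    [(2 pi n) ^ (- (q - 1) / 2) (\prod_i x i) ^ (- 1 / 2) exp (- n Phi_c x)], and it is always
    at most [exp (- n Phi_c x)].  Near a local minimum [phi] of [Phi_c] two Taylor bounds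
    squeeze the terms between Gaussians, whose sum over the lattice produces the square
    root of the Hessian determinant.  As the determinant does not vanish, local minima are
    nondegenerate, persist when [c] moves and are locally unique; critical points stay
    away from the boundary, so by compactness the whole simplex is covered by boxes
    around finitely many local minima and a set where [exp (- Phi_c)] stays below its
    maximum, which contributes exponentially little.  Compactness of [a, b] makes this
    uniform in [c]. *)

(** * Counting by types *)

(** The value [c = m / n] changes with [n], so no estimate may concern one [c] only: each holds on a
    neighbourhood of a given [c0], and Gaussian sums are bounded uniformly in their centre, because
    the local minimum for [m / n] moves and need not be a lattice point. One fixed quadratic form,
    the Hessian at [c0], serves all nearby [c], and errors are kept multiplicative ([factor_close]),
    since the terms are exponentially large or small. The Hessian hypothesis speaks of interior
    points. At the boundary the infinite slope of [t * ln t] does the work, and [Phi] is replaced by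
    [Psi], because [ln 0 = 0] gives [Phi] a misleading finite value where the quadratic form
    vanishes. Jointly in [c] and [x], [Psi] is in general only upper semicontinuous, which suffices
    for maxima. The Gaussian and the Stirling constants enter as a power of [g / C]; neither is
    evaluated, one explicit instance shows that they agree. A single type is treated apart, because
    there [R] may be 0. *)

Definition type_count q n (t : {ffun 'I_n -> 'I_q}) : {ffun 'I_q -> 'I_n.+1} :=
  [ffun i => inord #|[set u | t u == i]%SET|].

Lemma type_countE q n (t : {ffun 'I_n -> 'I_q}) i :
  type_count t i = (\sum_(u < n) (t u == i))%N :> nat.
Proof.
rewrite ffunE inordK; last by rewrite ltnS (leq_trans (max_card _)) ?card_ord.
rewrite -sum1_card big_mkcond /=; apply: eq_bigr => u _.
by rewrite inE; case: (_ == _).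
Qed.

Definition nb_types q n (k : {ffun 'I_q -> nat}) : nat :=
  (\sum_(t : {ffun 'I_n -> 'I_q}) [forall i, \sum_(u < n) (t u == i) == k i])%N.

Lemma sum_ffunS (T : finType) (n : nat) (V : nmodType) (F : {ffun 'I_n.+1 -> T} -> V) :
  \sum_(t : {ffun 'I_n.+1 -> T}) F t =
  \sum_(a : T) \sum_(t : {ffun 'I_n -> T})
     F [ffun i => oapp t a (unlift ord0 i)].
Proof.
rewrite pair_big /=.
rewrite (reindex (fun p : T * {ffun 'I_n -> T} =>
  [ffun i => oapp p.2 p.1 (unlift ord0 i)] : {ffun 'I_n.+1 -> T})) //=.
exists (fun t => (t ord0, [ffun i => t (lift ord0 i)])) => [[a t] _|t _] /=.
  rewrite ffunE unlift_none /=; congr (_, _).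
  by apply/ffunP => i; rewrite !ffunE liftK.
apply/ffunP => i; rewrite !ffunE.
by case: unliftP => [j ->|->] /=; rewrite ?ffunE.
Qed.

(** Induction on [n]: giving vertex 0 the type [a] leaves the counts lowered by one at [a], so this
    choice contributes [k a * n!], and these contributions add up to [n.+1 * n!]. *)
Lemma nb_typesE q n (k : {ffun 'I_q -> nat}) : (\sum_i k i = n)%N ->
  (nb_types n k * \prod_i (k i)`! = n`!)%N.
Proof.
elim: n k => [|n IH] k hk.
  have k0 i : k i = 0%N.
    by apply/eqP; rewrite -leqn0 -hk (bigD1 i) //= leq_addr.
  rewrite /nb_types [X in (_ * X)%N]big1 ?muln1; last by move=> i _; rewrite k0.
  rewrite (eq_bigr (fun=> 1%N)); last first.
    move=> t _; have -> // : [forall i, (\sum_(u < 0) (t u == i))%N == k i].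
    by apply/forallP => i; rewrite big_ord0 k0.
  by rewrite sum1_card card_ffun !card_ord expn0.
rewrite /nb_types sum_ffunS big_distrl /=.
transitivity (\sum_(a < q) k a * n`!)%N; last by rewrite -big_distrl /= hk factS.
apply: eq_bigr => a _.
case hka : (k a) => [|ka].
  rewrite mul0n; apply/eqP; rewrite muln_eq0; apply/orP; left.
  apply/eqP/big1 => t _; apply/eqP; rewrite eqb0; apply/forallP => /(_ a).
  by rewrite big_ord_recl ffunE unlift_none /= eqxx hka.
pose k' : {ffun 'I_q -> nat} := [ffun i => (k i - (i == a))%N].
have hk' : (\sum_i k' i = n)%N.
  have : (\sum_i (k' i + (i == a)) = n.+1)%N.
    rewrite -hk; apply: eq_bigr => i _; rewrite ffunE subnK //.
    by case: eqP => [->|//]; rewrite hka.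
  have e1 : (\sum_(i < q) (i == a) = 1)%N.
    by rewrite (bigD1 a) //= eqxx big1 // => i /negPf ->.
  by rewrite big_split /= e1 addn1 => -[].
rewrite -(IH _ hk') mulnCA; congr (_ * _)%N; last first.
  rewrite (bigD1 a) //= hka factS -mulnA; congr (_ * _)%N.
  rewrite [in RHS](bigD1 a) //= ffunE eqxx hka subn1; congr (_ * _)%N.
  by apply: eq_bigr => i /negPf ia; rewrite ffunE ia subn0.
rewrite /nb_types; apply: eq_bigr => t _; congr nat_of_bool.
apply: eq_forallb => i; rewrite big_ord_recl !ffunE unlift_none /=.
under eq_bigr do rewrite ffunE liftK /=.
rewrite [a == i]eq_sym; case: (eqVneq i a) => [->|_]; last by rewrite add0n subn0.
by rewrite hka subn1 add1n eqSS.
Qed.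

Section Combi.
Variables (K : realType) (q : nat) (R : 'M[K]_q) (r : 'cV[K]_q).
Hypothesis hRsym : R^T = R.

Lemma Rsym i j : R i j = R j i.
Proof. by rewrite -[in LHS]hRsym mxE. Qed.

Lemma count_edge_sum n m (s : m.-tuple ('I_n * 'I_n)) :
  (\sum_(e : edge n) count_mem e [seq mk_edge p.1 p.2 | p <- s] = m)%N.
Proof.
rewrite -[RHS](size_tuple s) -(size_map (fun p => mk_edge p.1 p.2) s).
elim: [seq _ | p <- s] => [|e l IH] /=; first by rewrite big1.
rewrite big_split /= IH (bigD1 e) //= eqxx big1 ?addn0 // => e'.
by rewrite eq_sym => /negPf ->.
Qed.

Definition edge_counts n m (s : m.-tuple ('I_n * 'I_n)) : {ffun edge n -> 'I_m.+1} :=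
  [ffun e => inord (count_mem e [seq mk_edge p.1 p.2 | p <- s])].

Lemma edge_countsE n m (s : m.-tuple ('I_n * 'I_n)) e :
  edge_counts s e = count_mem e [seq mk_edge p.1 p.2 | p <- s] :> nat.
Proof.
rewrite ffunE inordK // ltnS (leq_trans (count_size _ _)) //.
by rewrite size_map size_tuple.
Qed.

Lemma edge_counts_subproof n m (s : m.-tuple ('I_n * 'I_n)) :
  (\sum_(e : edge n) edge_counts s e == m)%N.
Proof.
by apply/eqP; under eq_bigr do rewrite edge_countsE; exact: count_edge_sum.
Qed.

Definition graph_of n m (s : m.-tuple ('I_n * 'I_n)) : mgraph n m :=
  exist (fun G : {ffun edge n -> 'I_m.+1} => \sum_(e : edge n) G e == m)%N
    _ (edge_counts_subproof s).

Lemma graph_ofP n m (s : m.-tuple ('I_n * 'I_n)) (G : mgraph n m) :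
  [forall e : edge n,
         count_mem e [seq mk_edge p.1 p.2 | p <- s] == mult G e] =
  (graph_of s == G).
Proof.
apply/forallP/eqP => [h|<- e]; last by rewrite /mult /= edge_countsE.
apply/val_inj/ffunP => e; apply/val_inj => /=.
by rewrite edge_countsE; apply/eqP/h.
Qed.

(** Sorting a pair by [mk_edge] may exchange its ends; symmetry of [R] keeps the factor. *)
Lemma prod_edges n m (s : m.-tuple ('I_n * 'I_n)) (t : {ffun 'I_n -> 'I_q}) :
  \prod_(e : edge n) R (t (val e).1) (t (val e).2) ^+ mult (graph_of s) e =
  \prod_(p <- s) R (t p.1) (t p.2).
Proof.
under eq_bigr do rewrite /mult /= edge_countsE.
elim: (tval s) => [|p l IH] /=; first by rewrite big_nil big1.
under eq_bigr do rewrite exprD.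
rewrite big_split /= IH big_cons; congr (_ * _).
rewrite (bigD1 (mk_edge p.1 p.2)) //= eqxx expr1 big1 ?mulr1; last first.
  by move=> e; rewrite eq_sym => /negPf ->.
by rewrite /mk_edge /=; case: ifP => //= _; rewrite Rsym.
Qed.

(** The factor [seqv G] turns the sum over graphs into a sum over [m]-tuples of ordered pairs, since
    every tuple determines one graph. The tuples are unconstrained, so their products sum to an
    [m]-th power. *)
Lemma graph_number_types n m :
  graph_number R r n m = (2 ^ m * m`!)%:R^-1 *
    \sum_(t : {ffun 'I_n -> 'I_q}) (\prod_(u < n) r (t u) 0) *
      (\sum_(v < n) \sum_(w < n) R (t v) (t w)) ^+ m.
Proof.
rewrite /graph_number /typed_graph.
rewrite -(pair_big xpredT xpredT (fun G t => weight R r (G, t))) /=.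
rewrite exchange_big mulr_sumr; apply: eq_bigr => t _.
rewrite /weight /=.
transitivity (\sum_(G : mgraph n m) (2 ^ m * m`!)%:R^-1 *
  ((\prod_(u < n) r (t u) 0) * ((seqv G)%:R *
   \prod_(e : edge n) R (t (val e).1) (t (val e).2) ^+ mult G e))).
  by apply: eq_bigr => G _; rewrite /kappa; ring.
rewrite -mulr_sumr; congr (_ * _).
rewrite -mulr_sumr; congr (_ * _).
transitivity (\sum_(s : m.-tuple ('I_n * 'I_n)) \sum_(G : mgraph n m)
  ((graph_of s == G)%:R *
   \prod_(e : edge n) R (t (val e).1) (t (val e).2) ^+ mult G e)).
  rewrite exchange_big; apply: eq_bigr => G _ /=.
  rewrite -mulr_suml -natr_sum; congr (_%:R * _).
  rewrite /seqv -sum1_card big_mkcond /=; apply: eq_bigr => s _.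
  by rewrite inE graph_ofP; case: (_ == _).
transitivity (\sum_(s : m.-tuple ('I_n * 'I_n))
    \prod_(i < m) R (t (tnth s i).1) (t (tnth s i).2)).
  apply: eq_bigr => s _.
  rewrite (bigD1 (graph_of s)) // eqxx mul1r prod_edges big_tuple.
  rewrite -[RHS]addr0; congr (_ + _).
  by apply: big1 => G /andP[_ /negPf hG]; rewrite eq_sym hG mul0r.
rewrite pair_big /= -[in RHS](card_ord m) -prodr_const.
rewrite [RHS](bigA_distr_bigA (fun (_ : 'I_m) (p : 'I_n * 'I_n) => R (t p.1) (t p.2))) /=.
rewrite (reindex (fun f : {ffun 'I_m -> 'I_n * 'I_n} => [tuple f i | i < m])) /=.
  apply: eq_bigr => f _; apply: eq_bigr => i _.
  by rewrite tnth_mktuple.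
exists (fun s => [ffun i => tnth s i]) => [f _|s _].
  by apply/ffunP => i; rewrite ffunE tnth_mktuple.
by apply: eq_from_tnth => i; rewrite tnth_mktuple ffunE.
Qed.

Definition cvec n (k : {ffun 'I_q -> 'I_n.+1}) : 'cV[K]_q :=
  \col_i ((k i)%:R / n%:R).

Definition lattice_term n m (k : {ffun 'I_q -> 'I_n.+1}) : K :=
  n`!%:R / (\prod_i (k i)`!)%:R * (\prod_i r i 0 ^+ k i) * quad R (cvec k) ^+ m.

Lemma quadE (x : 'cV[K]_q) : quad R x = \sum_i \sum_j x i 0 * R i j * x j 0.
Proof.
rewrite /quad mxE exchange_big; apply: eq_bigr => j _ /=.
rewrite mxE big_distrl /=; apply: eq_bigr => i _.
by rewrite !mxE.
Qed.

Lemma sum_by_types n (t : {ffun 'I_n -> 'I_q}) (F : 'I_q -> K) :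
  \sum_(u < n) F (t u) = \sum_i (type_count t i)%:R * F i.
Proof.
transitivity (\sum_(u < n) \sum_i (t u == i)%:R * F i).
  apply: eq_bigr => u _; rewrite (bigD1 (t u)) //= eqxx mul1r big1 ?addr0 //.
  by move=> i; rewrite eq_sym => /negPf ->; rewrite mul0r.
rewrite exchange_big; apply: eq_bigr => i _ /=.
by rewrite -mulr_suml -natr_sum type_countE.
Qed.

Lemma prod_by_types n (t : {ffun 'I_n -> 'I_q}) (F : 'I_q -> K) :
  \prod_(u < n) F (t u) = \prod_i F i ^+ type_count t i.
Proof.
transitivity (\prod_(u < n) \prod_i F i ^+ (t u == i)).
  apply: eq_bigr => u _; rewrite (bigD1 (t u)) //= eqxx expr1 big1 ?mulr1 //.
  by move=> i; rewrite eq_sym => /negPf ->.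
rewrite exchange_big; apply: eq_bigr => i _ /=.
by rewrite type_countE -expr_sum.
Qed.

Lemma quad_type_count n (t : {ffun 'I_n -> 'I_q}) :
  \sum_(v < n) \sum_(w < n) R (t v) (t w) = n%:R ^+ 2 * quad R (cvec (type_count t)).
Proof.
case: n t => [|n] t; first by rewrite big_ord0 expr0n mul0r.
transitivity (\sum_i \sum_j (type_count t i)%:R * R i j * (type_count t j)%:R).
  under eq_bigr do rewrite (sum_by_types t).
  rewrite (sum_by_types t (fun i => \sum_j (type_count t j)%:R * R i j)).
  apply: eq_bigr => i _; rewrite mulr_sumr; apply: eq_bigr => j _; ring.
rewrite quadE mulr_sumr; apply: eq_bigr => i _; rewrite [RHS]mulr_sumr.
have : n.+1%:R != 0 :> K by rewrite pnatr_eq0.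
by move=> hz; apply: eq_bigr => j _; rewrite !mxE; move: n.+1%:R hz => z hz; field.
Qed.

Lemma graph_number_lattice n m :
  graph_number R r n m = n%:R ^+ (2 * m) / (2 ^ m * m`!)%:R *
    \sum_(k : {ffun 'I_q -> 'I_n.+1} | (\sum_i k i)%N == n) lattice_term m k.
Proof.
rewrite graph_number_types [_ / _]mulrC -mulrA; congr (_ * _).
rewrite (partition_big (@type_count q n) (fun k => (\sum_i k i)%N == n)) /=; last first.
  move=> t _; under eq_bigr do rewrite type_countE.
  rewrite exchange_big /=; apply/eqP; rewrite -[RHS]card_ord -sum1_card.
  apply: eq_bigr => u _; rewrite (bigD1 (t u)) //= eqxx big1 ?addn0 //.
  by move=> i; rewrite eq_sym => /negPf ->.
rewrite mulr_sumr; apply: eq_bigr => k /eqP hk.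
transitivity (\sum_(t | type_count t == k) (\prod_i r i 0 ^+ k i) *
   (n%:R ^+ 2 * quad R (cvec k)) ^+ m).
  by apply: eq_bigr => t /eqP <-; rewrite quad_type_count (prod_by_types t (fun i => r i 0)).
rewrite sumr_const -[LHS]mulr_natl /lattice_term.
pose k' : {ffun 'I_q -> nat} := [ffun i => k i : nat].
have <- : nb_types n k' = #|[pred t | type_count t == k]|.
  rewrite /nb_types -[RHS]sum1_card [RHS]big_mkcond /=; apply: eq_bigr => t _.
  rewrite inE; have -> : (type_count t == k) =
    [forall i, (\sum_(u < n) (t u == i))%N == k' i]; last by case: [forall _, _].
  apply/idP/idP => [/eqP e|/forallP h].
    by apply/forallP => i; rewrite ffunE -e type_countE.
  apply/eqP.
  by apply/ffunP => i; apply/val_inj; rewrite /= type_countE (eqP (h i)) ffunE.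
have hk' : (\sum_i k' i = n)%N by rewrite -[RHS]hk; apply: eq_bigr => i _; rewrite ffunE.
rewrite -(nb_typesE hk') [in RHS]natrM.
have -> : (\prod_i (k' i)`! = \prod_i (k i)`!)%N by apply: eq_bigr => i _; rewrite ffunE.
rewrite exprMn -exprM mulrK; first by ring.
rewrite unitfE pnatr_eq0 -lt0n; apply: prodn_gt0 => i; exact: fact_gt0.
Qed.

Lemma sum_types_pow n (x : 'I_q -> K) :
  \sum_(t : {ffun 'I_n -> 'I_q}) \prod_(u < n) x (t u) = (\sum_i x i) ^+ n.
Proof.
rewrite -[in RHS](card_ord n) -prodr_const.
by rewrite [RHS](bigA_distr_bigA (fun=> x)).
Qed.

(** The multinomial theorem, obtained by comparing the two formulas for [graph_number] at [m = 0].
    It supplies the exact value that fixes the constant at the end. *)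
Lemma lattice_sum0 n :
  \sum_(k : {ffun 'I_q -> 'I_n.+1} | (\sum_i k i)%N == n) lattice_term 0 k =
  (\sum_i r i 0) ^+ n.
Proof.
have := graph_number_lattice n 0; rewrite graph_number_types !expr0 !mul1r => e.
have h : (2 ^ 0 * 0`!)%:R^-1 != 0 :> K by rewrite expn0 mul1n fact0 invr1 oner_neq0.
rewrite -(mulfI h e) -sum_types_pow.
by apply: eq_bigr => t _; rewrite expr0 mulr1.
Qed.

(** The left side is the probability that [n] independent draws from [x] have the counts [k]. The
    bound needs no Stirling estimate and so holds up to the boundary of the simplex. *)
Lemma multinomial_le1 n (k : {ffun 'I_q -> 'I_n.+1}) (x : 'I_q -> K) :
  (\sum_i k i = n)%N -> (forall i, 0 <= x i) -> \sum_i x i = 1 ->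
  n`!%:R / (\prod_i (k i)`!)%:R * \prod_i x i ^+ k i <= 1.
Proof.
move=> hk x0 x1.
pose k' : {ffun 'I_q -> nat} := [ffun i => k i : nat].
have hk' : (\sum_i k' i = n)%N by rewrite -[RHS]hk; apply: eq_bigr => i _; rewrite ffunE.
have -> : (\prod_i (k i)`! = \prod_i (k' i)`!)%N by apply: eq_bigr => i _; rewrite ffunE.
rewrite -(nb_typesE hk') natrM mulfK; last first.
  by rewrite pnatr_eq0 -lt0n; apply: prodn_gt0 => i; exact: fact_gt0.
apply: (@le_trans _ _ ((\sum_i x i) ^+ n)); last by rewrite x1 expr1n.
rewrite -sum_types_pow /nb_types raddf_sum mulr_suml.
apply: ler_sum => t _; case: forallP => [h|_]; last first.
  by rewrite mul0r; apply: prodr_ge0.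
rewrite mul1r (prod_by_types t x) le_eqVlt; apply/orP; left; apply/eqP.
apply: eq_bigr => i _; congr (_ ^+ _).
by rewrite type_countE (eqP (h i)) ffunE.
Qed.
End Combi.

(** * Gaussian lattice sums *)

Section Calculus.
Variable K : realType.

Section DerivRules.
Variables (x : K) (f g : K -> K) (a b : K).
Hypotheses (hf : is_derive x 1 f a) (hg : is_derive x 1 g b).

Lemma is_derive_funD : is_derive x 1 (fun y => f y + g y) (a + b).
Proof. exact: is_deriveD. Qed.

Lemma is_derive_funB : is_derive x 1 (fun y => f y - g y) (a - b).
Proof. exact: is_deriveB. Qed.

Lemma is_derive_funM : is_derive x 1 (fun y => f y * g y) (f x * b + g x * a).
Proof. exact: is_deriveM. Qed.

Lemma is_derive_funZ (c : K) : is_derive x 1 (fun y => c * f y) (c * a).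
Proof. exact: (@is_deriveZ _ _ _ f c). Qed.

Lemma is_derive_funV : f x != 0 -> is_derive x 1 (fun y => (f y)^-1) (- (f x) ^- 2 * a).
Proof. by move=> h; exact: is_deriveV. Qed.

Lemma is_derive_ln_fun : 0 < f x -> is_derive x 1 (fun y => ln (f y)) (a / f x).
Proof.
move=> h; rewrite mulrC.
exact: (@is_derive1_comp _ (@ln K) f x _ _ (is_derive1_ln h) hf).
Qed.

Lemma is_derive_eqr (c : K) : a = c -> is_derive x 1 f c.
Proof. by move=> <-. Qed.
End DerivRules.

Lemma is_derive_fun_id (x : K) : is_derive x 1 (fun y : K => y) 1.
Proof. exact: is_derive_id. Qed.

Lemma is_derive_fun_cst (x c : K) : is_derive x 1 (fun=> c) 0.
Proof. exact: is_derive_cst. Qed.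

Lemma is_derive_fun_sum (n : nat) (x : K) (f : 'I_n -> K -> K) (a : 'I_n -> K) :
  (forall i, is_derive x 1 (f i) (a i)) ->
  is_derive x 1 (fun y => \sum_i f i y) (\sum_i a i).
Proof.
move=> h; have := @is_derive_sum _ _ _ n f x 1 a (fun i => h i).
by rewrite (_ : \sum_(i < n) f i = fun y => \sum_i f i y) //;
  apply/funext => y; rewrite fct_sumE.
Qed.

Lemma nondecreasing_of_deriv (f df : K -> K) (a b : K) : a <= b ->
  (forall x : K, a <= x <= b -> is_derive x 1 f (df x)) ->
  (forall x : K, a <= x <= b -> 0 <= df x) -> f a <= f b.
Proof.
move=> ab hf hdf.
have cf : {within `[a, b], continuous f}.
  apply: derivable_within_continuous => x; rewrite in_itv /= => /hf h.
  exact: ex_derive.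
have [|c hc e] := @MVT_segment K f df a b ab _ cf.
  move=> x; rewrite in_itv /= => /andP[h1 h2]; apply: hf.
  by rewrite !ltW.
rewrite -subr_ge0 e mulr_ge0 ?subr_ge0 //; apply: hdf.
by move: hc; rewrite in_itv.
Qed.

(** Monotonicity is used twice, for [df x - m * x] and then for
    [f x - (df 0 * x + m / 2 * x ^+ 2)]. *)
Lemma taylor2_le (f df ddf : K -> K) (m : K) :
  (forall x : K, 0 <= x <= 1 -> is_derive x 1 f (df x)) ->
  (forall x : K, 0 <= x <= 1 -> is_derive x 1 df (ddf x)) ->
  (forall x : K, 0 <= x <= 1 -> m <= ddf x) -> df 0 + m / 2 <= f 1 - f 0.
Proof.
move=> hf hdf hm.
have h1 t : 0 <= t <= 1 -> df 0 + m * t <= df t.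
  move=> /andP[t0 t1].
  have hid (x : K) : 0 <= x <= t -> is_derive x 1 (fun x => df x - m * x) (ddf x - m).
    move=> /andP[x0 xt]; have := hdf x; rewrite x0 (le_trans xt t1) => /(_ isT) ?.
    by apply: is_derive_funB => //; have := is_derive_funZ (is_derive_fun_id x) m; rewrite mulr1.
  have := nondecreasing_of_deriv t0 hid.
  have hm' (x : K) : 0 <= x <= t -> 0 <= ddf x - m.
    by move=> /andP[x0 xt]; rewrite subr_ge0 hm // x0 (le_trans xt t1).
  by move=> /(_ hm'); rewrite mulr0 subr0; lra.
have hid (x : K) : 0 <= x <= 1 -> is_derive x 1 (fun x => f x - (df 0 * x + m / 2 * (x * x)))
   (df x - (df 0 + m * x)).
  move=> hx; apply: is_derive_funB; first exact: hf.
  by apply: is_derive_eqr; rewrite /GRing.scale /=; field.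
have := nondecreasing_of_deriv ler01 hid.
have hm' (x : K) : 0 <= x <= 1 -> 0 <= df x - (df 0 + m * x).
  by move=> hx; rewrite subr_ge0 h1.
by move=> /(_ hm'); rewrite !mulr0 !mulr1; lra.
Qed.

(** The increments are compared with lower and upper rectangles, as the integrand decreases. The
    limit [c] stays anonymous because its value cancels in the end. *)
Lemma gauss_primitive : exists (I : K -> K) (c : K),
  [/\ 0 < c, I 0 = 0,
     (forall x y : K, 0 <= x -> x <= y ->
        (y - x) * expR (- y ^+ 2) <= I y - I x <= (y - x) * expR (- x ^+ 2)),
     (forall x : K, 0 <= x -> I x <= c) & I x @[x --> +oo] --> c].
Proof.
pose I := @gauss_integral_proof.integral0_gauss K.
have I0 : I 0 = 0.
  by rewrite /I /gauss_integral_proof.integral0_gauss set_itv1 Rintegral_set1.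
have ci (a b : K) : (@lebesgue_measure K).-integrable `[a, b] (EFin \o @gauss_fun K).
  apply: continuous_compact_integrable; first exact: segment_compact.
  apply: continuous_subspaceT.
  exact: continuous_gauss_fun.
have dI (x : K) : 0 < x -> is_derive x 1 I (expR (- x ^+ 2)).
  move=> x0.
  have [h1 h2] : derivable I x 1 /\ derive1 I x = gauss_fun x.
    apply: (@continuous_FTC1 K (@gauss_fun K) (BLeft 0) _ (x + 1)).
    - by rewrite ltrDl.
    - exact: ci.
    - by rewrite /= lte_fin.
    - by move=> ?; exact: continuous_gauss_fun.
  by apply: DeriveDef; [exact: h1|rewrite -derive1E h2].
have cI b : 0 <= b -> {within `[0, b], continuous I}.
  move=> b0; apply: parameterized_integral_continuous => //=.
have hI (x y : K) : 0 <= x -> x <= y ->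
    (y - x) * expR (- y ^+ 2) <= I y - I x <= (y - x) * expR (- x ^+ 2).
  move=> x0 xy.
  have [||z] := @MVT_segment K I (fun x => expR (- x ^+ 2)) x y xy.
  - move=> z; rewrite in_itv /= => /andP[xz _]; apply: dI.
    exact: le_lt_trans xz.
  - apply: continuous_subspaceW (cI y (le_trans x0 xy)).
    by move=> z /=; rewrite !in_itv /= => /andP[xz ->]; rewrite (le_trans x0 xz).
  rewrite in_itv /= => /andP[xz zy] ->.
  rewrite ![_ * (y - x)]mulrC.
  by rewrite !ler_wpM2l ?subr_ge0 // ler_expR lerN2 ler_sqr ?nnegrE //;
    rewrite ?(le_trans x0) // (le_trans xz).
(* The square of the integral is what is known to converge, to [pi / 4]; as [I] is nonnegative, it
   tends to the square root. *)
have cvgI : I x @[x --> +oo] --> Num.sqrt (pi / 4).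
  have : Num.sqrt (I x ^+ 2) @[x --> +oo] --> Num.sqrt (pi / 4 : K).
    apply: continuous_cvg; first exact: sqrt_continuous.
    exact: gauss_integral_proof.cvg_integral0_gauss_sqr.
  rewrite (_ : (fun x => Num.sqrt (I x ^+ 2)) = I) //.
  apply/funext => r; rewrite sqrtr_sqr ger0_norm //.
  exact: gauss_integral_proof.integral0_gauss_ge0.
exists I, (Num.sqrt (pi / 4)); split => //.
  by rewrite sqrtr_gt0 divr_gt0 // pi_gt0.
move=> x x0; apply: (cvgr_to_ge cvgI).
near=> y.
have xy : x <= y by near: y; apply: nbhs_pinfty_ge; rewrite num_real.
have /andP[h _] := hI x y x0 xy; rewrite -subr_ge0; apply: le_trans h.
by rewrite mulr_ge0 ?expR_ge0 // subr_ge0.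
Unshelve. all: by end_near.
Qed.

(** Each term after the first lies below the integral over the cell to its left; the first has no
    such cell and is bounded by [h]. *)
Lemma half_sum_le (I : K -> K) (e : K -> K) (h t : K) (n : nat) :
  0 <= h -> 0 <= t -> e t <= 1 ->
  (forall x y : K, 0 <= x -> x <= y -> (y - x) * e y <= I y - I x) ->
  \sum_(i < n.+1) h * e (t + i%:R * h) <= h + (I (t + n%:R * h) - I t).
Proof.
move=> h0 t0 et hI; elim: n => [|n IH].
  by rewrite big_ord1 mul0r addr0 subrr addr0 -[leRHS]mulr1 ler_wpM2l.
rewrite big_ord_recr /=.
have p0 : 0 <= t + n%:R * h by rewrite addr_ge0 // mulr_ge0.
have := hI (t + n%:R * h) (t + n.+1%:R * h) p0.
rewrite lerD2l ler_wpM2r ?ler_nat // => /(_ isT).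
rewrite (_ : t + n.+1%:R * h - (t + n%:R * h) = h); last by rewrite -natr1; ring.
by move: IH; lra.
Qed.

(** Each term lies above the integral over the cell to its right. The minimum with [L] accounts for
    the last cell, which the truncation of the sum at [L] may cut. *)
Lemma half_sum_ge (I : K -> K) (e : K -> K) (h t L : K) (n : nat) :
  0 <= h -> 0 <= t -> t <= L ->
  (forall x y : K, 0 <= x -> x <= y -> 0 <= I y - I x <= (y - x) * e x) ->
  I (Num.min (t + n%:R * h) L) - I t <=
  \sum_(i < n | t + i%:R * h <= L) h * e (t + i%:R * h).
Proof.
move=> h0 t0 tL hI; elim: n => [|n IH].
  by rewrite big_ord0 mul0r addr0 min_l // subrr.
rewrite big_mkcond big_ord_recr /= -big_mkcond /=.
have p0 : 0 <= t + n%:R * h by rewrite addr_ge0 // mulr_ge0.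
have hh : t + n.+1%:R * h - (t + n%:R * h) = h by rewrite -natr1; ring.
case: ifPn => [le|]; last first.
  rewrite -ltNge => lt; rewrite addr0; apply: le_trans IH.
  rewrite !min_r ?lexx ?(ltW lt) // (le_trans (ltW lt)) //.
  by rewrite -subr_ge0 hh.
have p1 : t + n%:R * h <= Num.min (t + n.+1%:R * h) L.
  by rewrite le_min le andbT -subr_ge0 hh.
have /andP[_ h1] := hI _ _ p0 p1.
have /andP[h2 _] := hI _ _ p0 p1.
have e0 : 0 <= e (t + n%:R * h).
  have : t + n%:R * h <= t + n%:R * h + 1 by rewrite lerDl.
  by move=> /(hI _ _ p0) /andP[/le_trans + a]; move=> /(_ _ a); rewrite addrAC subrr add0r mul1r.
have h3 : Num.min (t + n.+1%:R * h) L - (t + n%:R * h) <= h.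
  by rewrite -[leRHS]hh lerD2r ge_min lexx.
have h4 := ler_wpM2r e0 h3.
by move: IH; rewrite (min_l le); lra.
Qed.

Lemma nat_cut (s : K) : exists p : nat, forall j : nat, (j < p)%N = (j%:R < s).
Proof.
have ex : exists p : nat, s <= p%:R.
  by exists (Num.truncn `|s|).+1; rewrite (le_trans (ler_norm s)) // ltW // truncnS_gt.
exists (ex_minn ex) => j; case: ex_minnP => p sp hp.
apply/idP/idP => [jp|js].
  by rewrite ltNge; apply/negP => /hp; rewrite leqNgt jp.
by rewrite -(ltr_nat K) (lt_le_trans js).
Qed.

(** The half left of the cut is read backwards, so that both halves run away from the peak and the
    Gaussian decreases along them. The cut may exceed [n]; nonnegativity allows the sum to be
    extended first. *)
Lemma sum_cut_le (F : nat -> K) (n p : nat) : (forall j, 0 <= F j) ->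
  \sum_(j < n.+1) F j <= \sum_(i < p) F (p - i.+1)%N + \sum_(i < n.+1) F (p + i)%N.
Proof.
move=> F0; rewrite -(big_mkord xpredT).
apply: (@le_trans _ _ (\sum_(0 <= j < p + n.+1) F j)).
  by rewrite [leRHS](@big_cat_nat _ _ _ n.+1) ?leq_addl //= lerDl sumr_ge0.
rewrite (@big_cat_nat _ _ _ p) ?leq_addr //= big_nat_rev big_mkord lerD //.
rewrite -{1}(add0n p) big_addn addKn big_mkord.
by rewrite le_eqVlt; apply/orP; left; apply/eqP; apply: eq_bigr => i _; rewrite addnC.
Qed.

Lemma sum_cut_eq (F : nat -> K) (P : pred nat) (n p : nat) : (p <= n)%N ->
  \sum_(j < n | P j) F j = \sum_(i < p | P (p - i.+1)%N) F (p - i.+1)%N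
    + \sum_(i < n - p | P (p + i)%N) F (p + i)%N.
Proof.
move=> pn; rewrite -(big_mkord P) (@big_cat_nat _ _ _ p) //=; congr (_ + _).
  by rewrite big_nat_rev big_mkord.
rewrite -{1}(add0n p) big_addn big_mkord.
by apply: eq_big => [i|i _]; rewrite addnC.
Qed.

(** Here [g] stands for [sqrt (2 pi)]. The bounds are uniform in the centre [s], because completing
    the square in several variables shifts it by an amount depending on the other coordinates. The
    lower bound is restricted to a window, where the lattice points can later be identified with
    count vectors. *)
Definition gauss_const_spec (g : K) := 0 < g /\ forall (a kappa : K), 0 < a -> 1 < kappa ->
  (\forall n \near \oo, forall s : K,
     \sum_(j < n.+1) expR (- (a * n%:R / 2 * (j%:R / n%:R - s) ^+ 2))
       <= kappa * (g * Num.sqrt (n%:R / a))) /\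
  (forall delta : K, 0 < delta -> \forall n \near \oo, forall s : K, delta <= s <= 1 - delta ->
     g * Num.sqrt (n%:R / a) <= kappa *
     \sum_(j < n.+1 | `|j%:R / n%:R - s| <= delta)
        expR (- (a * n%:R / 2 * (j%:R / n%:R - s) ^+ 2))).

Lemma gauss_const_exists : exists g, gauss_const_spec g.
Proof.
have [I [c [c0 I0 hI Ic Icvg]]] := gauss_primitive.
pose e (x : K) := expR (- x ^+ 2).
have hI1 x y : 0 <= x -> x <= y -> (y - x) * e y <= I y - I x.
  by move=> x0 xy; have /andP[] := hI x y x0 xy.
have hI2 x y : 0 <= x -> x <= y -> 0 <= I y - I x <= (y - x) * e x.
  move=> x0 xy; have /andP[h1 ->] := hI x y x0 xy; rewrite andbT.
  by apply: le_trans h1; rewrite mulr_ge0 ?expR_ge0 // subr_ge0.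
have eN x : e (- x) = e x by rewrite /e sqrrN.
have e1 x : e x <= 1 by rewrite /e -[leRHS]expR0 ler_expR oppr_le0 sqr_ge0.
have Ige0 x : 0 <= x -> 0 <= I x.
  by move=> x0; have /andP[] := hI2 0 x (lexx 0) x0; rewrite I0 subr0.
have Idiff x y : 0 <= x -> 0 <= y -> I y - I x <= c.
  by move=> x0 y0; have := Ige0 x x0; have := Ic y y0; lra.
(* With [h = sqrt (a / (2 n))] the summand is [e (h * (j - s * n))], so [h] times the sum is a
   Riemann sum of mesh [h]. *)
pose h (a : K) (n : nat) := Num.sqrt (a / n%:R / 2).
have h_gt0 a n : 0 < a -> (0 < n)%N -> 0 < h a n.
  by move=> a0 n0; rewrite sqrtr_gt0 divr_gt0 // divr_gt0 // ltr0n.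
have hE a n s (j : nat) : 0 < a -> (0 < n)%N ->
    expR (- (a * n%:R / 2 * (j%:R / n%:R - s) ^+ 2)) = e (h a n * (j%:R - s * n%:R)).
  move=> a0 n0; rewrite /e exprMn sqr_sqrtr; last by rewrite divr_ge0 // divr_ge0 // ltW.
  by congr expR; field; rewrite pnatr_eq0 -lt0n.
have sqE a n : 0 < a -> (0 < n)%N -> Num.sqrt (n%:R / a) = Num.sqrt 2^-1 / h a n.
  move=> a0 n0; have hp := h_gt0 a n a0 n0.
  apply: (mulIf (lt0r_neq0 hp)); rewrite divfK ?lt0r_neq0 // -sqrtrM; last first.
    by rewrite divr_ge0 // ltW.
  by congr Num.sqrt; field; rewrite pnatr_eq0 -lt0n n0 gt_eqF.
(* Each of the two halves of the Riemann sum tends to [c], and [sqrt (n / a)] is [sqrt (1 / 2) / h],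
   so that [g * sqrt (n / a) = 2 * c / h]. *)
pose g := 2 * c / Num.sqrt 2^-1.
have s20 : 0 < Num.sqrt 2^-1 :> K by rewrite sqrtr_gt0 invr_gt0.
have gE a n : 0 < a -> (0 < n)%N -> g * Num.sqrt (n%:R / a) = 2 * c / h a n.
  by move=> a0 n0; rewrite sqE // /g mulrA divfK // gt_eqF.
have h_small a (eta : K) : 0 < a -> 0 < eta -> \forall n \near \oo, h a n <= eta.
  move=> a0 eta0; near=> n.
  have n0 : (0 < n)%N by near: n; exact: nbhs_infty_gt.
  rewrite -(ger0_norm (ltW eta0)) -sqrtr_sqr ler_sqrt ?exprn_ge0 ?(ltW eta0) //.
  rewrite ler_pdivrMr // ler_pdivrMr ?ltr0n // mulrC -ler_pdivrMr ?mulr_gt0 ?exprn_gt0 //.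
  by near: n; exact: nbhs_infty_ger.
exists g; split; first by rewrite /g divr_gt0 // mulr_gt0.
move=> a kappa a0 k1; split=> [|delta d0].
  near=> n => s.
  have n0 : (0 < n)%N by near: n; exact: nbhs_infty_gt.
  have hp := h_gt0 a n a0 n0.
  rewrite gE //; under eq_bigr do rewrite hE //.
  have [p hpcut] := nat_cut (s * n%:R).
  rewrite mulrA ler_pdivlMr // mulrC mulr_sumr.
  apply: (le_trans (@sum_cut_le (fun j => h a n * e (h a n * (j%:R - s * n%:R))) n p _)).
    by move=> j; rewrite mulr_ge0 ?expR_ge0 // ltW.
  have hs : 2 * h a n <= 2 * c * (kappa - 1).
    rewrite -ler_pdivlMl //; near: n; apply: h_small => //.
    by rewrite !mulr_gt0 // ?subr_gt0 // invr_gt0.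
  have t1 : 0 <= h a n * (p%:R - s * n%:R).
    by rewrite mulr_ge0 ?(ltW hp) // subr_ge0 leNgt -hpcut ltnn.
  have A : \sum_(i < n.+1) h a n * e (h a n * ((p + i)%:R - s * n%:R)) <= h a n + c.
    have := half_sum_le n (ltW hp) t1 (e1 _) hI1.
    rewrite (eq_bigr (fun i : 'I_n.+1 => h a n * e (h a n * ((p + i)%:R - s * n%:R)))); last first.
      by move=> i _; congr (_ * e _); rewrite natrD; ring.
    move=> /le_trans; apply; rewrite lerD2l.
    by apply: Idiff => //; rewrite addr_ge0 // mulr_ge0 // ltW.
  have B : \sum_(i < p) h a n * e (h a n * ((p - i.+1)%:R - s * n%:R)) <= h a n + c.
    case: p hpcut {t1 A} => [|p] hpcut; first by rewrite big_ord0 addr_ge0 // ltW.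
    have t1 : 0 <= h a n * (s * n%:R - p%:R).
      by rewrite mulr_ge0 ?(ltW hp) // subr_ge0 ltW // -hpcut.
    have := half_sum_le p (ltW hp) t1 (e1 _) hI1.
    rewrite (eq_bigr (fun i : 'I_p.+1 => h a n * e (h a n * ((p.+1 - i.+1)%:R - s * n%:R)))); last first.
      move=> i _; congr (_ * _); rewrite -eN; congr e.
      by rewrite subSS natrB -1?ltnS //; ring.
    move=> /le_trans; apply; rewrite lerD2l.
    by apply: Idiff => //; rewrite addr_ge0 // mulr_ge0 // ltW.
  by move: A B hs; lra.
(* Each half loses at most [eta] by the truncation at [L] and [eta] by its incomplete first cell;
   the total [2 * c - 4 * eta] is exactly [2 * c / kappa]. *)
pose eta := c * (1 - kappa^-1) / 2.
have ki : kappa^-1 < 1 by rewrite invf_lt1 // (lt_trans _ k1).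
have eta0 : 0 < eta by rewrite divr_gt0 // mulr_gt0 // subr_gt0.
have hL : \forall n \near \oo, c - eta <= I (h a n * (delta * n%:R)).
  have : \forall x \near +oo, c - eta <= I x.
    move/cvgrPdist_le : Icvg => /(_ eta eta0); apply: filterS => x.
    by rewrite ler_norml => /andP[_]; lra.
  move=> [M [_ hM]]; near=> n.
  have n0 : (0 < n)%N by near: n; exact: nbhs_infty_gt.
  have n0' : 0 < n%:R :> K by rewrite ltr0n.
  apply: hM; rewrite (le_lt_trans (ler_norm M)) //.
  have M0 : 0 <= `|M| + 1 by rewrite addr_ge0.
  apply: (@lt_le_trans _ _ (`|M| + 1)); first by rewrite ltrDl.
  rewrite -(@ler_pXn2r _ 2) ?nnegrE ?mulr_ge0 ?(ltW d0) ?(ltW (h_gt0 _ _ a0 n0)) //.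
  rewrite exprMn sqr_sqrtr; last by rewrite divr_ge0 // divr_ge0 // ltW.
  rewrite [leRHS](_ : _ = a * delta ^+ 2 / 2 * n%:R); last by field; rewrite gt_eqF.
  rewrite -ler_pdivrMl ?divr_gt0 ?mulr_gt0 ?exprn_gt0 //.
  by near: n; exact: nbhs_infty_ger.
near=> n => s /andP[s1 s2].
have n0 : (0 < n)%N by near: n; exact: nbhs_infty_gt.
have n0' : 0 < n%:R :> K by rewrite ltr0n.
have hp := h_gt0 a n a0 n0.
rewrite gE //; under eq_bigr do rewrite hE //.
have [p hpcut] := nat_cut (s * n%:R).
have hsm : h a n <= eta by near: n; exact: h_small.
pose L := h a n * (delta * n%:R).
have hIL : c - eta <= I L by rewrite /L; near: n.
rewrite ler_pdivrMr // -mulrA [_ * h a n]mulrC mulr_sumr.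
rewrite -ler_pdivrMl ?(lt_trans _ k1) //.
have PE (j : nat) : (`|j%:R / n%:R - s| <= delta) = (`|h a n * (j%:R - s * n%:R)| <= L).
  rewrite normrM (gtr0_norm hp) ler_pM2l //.
  rewrite (_ : j%:R - _ = (j%:R / n%:R - s) * n%:R); last by field; rewrite gt_eqF.
  by rewrite normrM (gtr0_norm n0') ler_pM2r.
under eq_bigl do rewrite PE.
have pn : (p <= n.+1)%N.
  rewrite leqNgt; apply/negP; rewrite hpcut -natr1 => H.
  have : s * n%:R <= (1 - delta) * n%:R by rewrite ler_pM2r.
  have : delta * n%:R > 0 by rewrite mulr_gt0.
  by move: H; lra.
rewrite (@sum_cut_eq (fun j => h a n * e (h a n * (j%:R - s * n%:R)))
  (fun j => `|h a n * (j%:R - s * n%:R)| <= L) _ _ pn).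
have t1 : 0 <= h a n * (p%:R - s * n%:R).
  by rewrite mulr_ge0 ?(ltW hp) // subr_ge0 leNgt -hpcut ltnn.
have hpn : p%:R - s * n%:R <= 1.
  case: p hpcut {pn t1} => [|p] hpcut.
    by rewrite sub0r (@le_trans _ _ 0) // oppr_le0 mulr_ge0 // (le_trans (ltW d0)).
  by have := hpcut p; rewrite ltnSn => /esym/ltW; rewrite -natr1; lra.
have Ih : I (h a n) <= h a n.
  have /andP[_] := hI2 0 (h a n) (lexx 0) (ltW hp).
  rewrite I0 !subr0 => /le_trans; apply.
  by rewrite -[leRHS]mulr1 ler_wpM2l ?(ltW hp).
have Imon x y : 0 <= x -> x <= y -> I x <= I y.
  by move=> x0 xy; have /andP[] := hI2 x y x0 xy; rewrite subr_ge0.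
have hL1 : h a n <= L.
  rewrite /L -[leLHS]mulr1 ler_pM2l //.
  rewrite -ler_pdivrMl // mulr1; near: n; exact: nbhs_infty_ger.
have A : I L - h a n <= \sum_(i < n.+1 - p | `|h a n * ((p + i)%:R - s * n%:R)| <= L)
     h a n * e (h a n * ((p + i)%:R - s * n%:R)).
  have tL : h a n * (p%:R - s * n%:R) <= L.
    by apply: le_trans hL1; rewrite -[leRHS]mulr1 ler_pM2l.
  have := half_sum_ge (n.+1 - p) (ltW hp) t1 tL hI2.
  rewrite min_r; last first.
    rewrite natrB // /L [X in _ <= _ + X]mulrC -mulrDr ler_pM2l // -natr1.
    have : s * n%:R <= (1 - delta) * n%:R by rewrite ler_pM2r.
    by lra.
  move=> H; apply: le_trans (le_trans _ H) _.
    rewrite lerD2l lerN2; apply: le_trans Ih; apply: Imon => //.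
    by rewrite -[leRHS]mulr1 ler_pM2l.
  have e2 (i : nat) : h a n * (p%:R - s * n%:R) + i%:R * h a n = h a n * ((p + i)%:R - s * n%:R).
    by rewrite natrD; ring.
  rewrite le_eqVlt; apply/orP; left; apply/eqP.
  apply: eq_big => [i|i _]; rewrite e2 // ger0_norm // -e2.
  by rewrite addr_ge0 // mulr_ge0 // ltW.
have B : I L - h a n <= \sum_(i < p | `|h a n * ((p - i.+1)%:R - s * n%:R)| <= L)
     h a n * e (h a n * ((p - i.+1)%:R - s * n%:R)).
  (* An empty left half would mean [s * n <= 0], against [delta <= s]. *)
  case: p hpcut {pn t1 A} hpn => [|p] hpcut hpn.
    exfalso; have : delta * n%:R <= s * n%:R by rewrite ler_pM2r.
    have := hpcut 0%N; rewrite ltnn => /esym/negbT; rewrite -leNgt => h1.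
    by have : delta * n%:R > 0; [rewrite mulr_gt0|move: h1; lra].
  have t1 : 0 <= h a n * (s * n%:R - p%:R).
    by rewrite mulr_ge0 ?(ltW hp) // subr_ge0 ltW // -hpcut.
  have u1 : s * n%:R - p%:R <= 1.
    have := hpcut p.+1; rewrite ltnn => /esym/negbT; rewrite -leNgt -natr1; lra.
  have tL : h a n * (s * n%:R - p%:R) <= L.
    by apply: le_trans hL1; rewrite -[leRHS]mulr1 ler_pM2l.
  have := half_sum_ge p.+1 (ltW hp) t1 tL hI2.
  rewrite min_r; last first.
    rewrite /L [X in _ <= _ + X]mulrC -mulrDr ler_pM2l // -natr1.
    have : delta * n%:R <= s * n%:R by rewrite ler_pM2r.
    by lra.
  move=> H; apply: le_trans (le_trans _ H) _.
    rewrite lerD2l lerN2; apply: le_trans Ih; apply: Imon => //.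
    by rewrite -[leRHS]mulr1 ler_pM2l.
  have e2 (i : 'I_p.+1) : h a n * ((p.+1 - i.+1)%:R - s * n%:R) =
      - (h a n * (s * n%:R - p%:R) + i%:R * h a n).
    by rewrite subSS natrB -1?ltnS //; ring.
  rewrite le_eqVlt; apply/orP; left; apply/eqP.
  apply: eq_big => [i|i _]; rewrite e2 ?eN // normrN ger0_norm //.
  by rewrite addr_ge0 // mulr_ge0 // ltW.
have hk : kappa^-1 * (2 * c) = 2 * c - 4 * eta by rewrite /eta; field; rewrite gt_eqF // (lt_trans _ k1).
by move: A B; rewrite hk; lra.
Unshelve. all: by end_near.
Qed.

End Calculus.

(** * Gaussian sums over a lattice in several dimensions *)

Section GaussSums.
Variable K : realType.

Definition posdef d (A : 'M[K]_d) :=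
  A^T = A /\ forall v : 'cV[K]_d, v != 0 -> 0 < quad A v.

Definition grid n d (u : 'cV['I_n.+1]_d) : 'cV[K]_d := \col_i ((u i 0)%:R / n%:R).

Definition pivot d (A : 'M[K]_(1 + d)) : K := ulsubmx A 0 0.

Definition schur d (A : 'M[K]_(1 + d)) : 'M[K]_d :=
  drsubmx A - (pivot A)^-1 *: ((ursubmx A)^T *m ursubmx A).

Lemma quad_schur d (A : 'M[K]_(1 + d)) (t : K) (w : 'cV[K]_d) :
  A^T = A -> pivot A != 0 ->
  quad A (col_mx (const_mx t) w) =
  pivot A * (t + (pivot A)^-1 * (ursubmx A *m w) 0 0) ^+ 2 + quad (schur A) w.
Proof.
move=> As a0.
have e1 : ulsubmx A = (pivot A)%:M by rewrite [LHS]mx11_scalar.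
have e2 : dlsubmx A = (ursubmx A)^T by rewrite -{1}As -trmx_ursub.
rewrite /quad -{1}[A]submxK e1 e2 tr_col_mx mul_row_block mul_row_col /schur.
move: (ursubmx A) (drsubmx A) (pivot A) a0 => b D a a0.
rewrite mulmxBr mulmxBl -scalemxAr -scalemxAl !mulmxDl.
have eb : w^T *m b^T = (b *m w)^T by rewrite trmx_mul.
rewrite !mulmxA eb -!mulmxA; move: (b *m w) => z.
move: (w^T *m (D *m w)) => p.
rewrite !mxE !big_ord1 !mxE !big_ord1 !mxE eqxx mulr1n.
by field.
Qed.

Lemma det_schur d (A : 'M[K]_(1 + d)) : A^T = A -> pivot A != 0 ->
  \det A = pivot A * \det (schur A).
Proof.
move=> As a0.
have e1 : ulsubmx A = (pivot A)%:M by rewrite [LHS]mx11_scalar.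
have e2 : dlsubmx A = (ursubmx A)^T by rewrite -{1}As -trmx_ursub.
have eA : A = block_mx 1%:M 0 ((pivot A)^-1 *: (ursubmx A)^T) 1%:M *m
   block_mx (pivot A)%:M (ursubmx A) 0 (schur A).
  rewrite mulmx_block !mul1mx !mul0mx !addr0 mul_mx_scalar scalerA divff // scale1r.
  by rewrite -scalemxAl /schur addrC subrK -e1 -e2 submxK.
by rewrite {1}eA det_mulmx det_lblock !det1 !mul1r det_ublock det_scalar1.
Qed.

(** For given [w] the value of [t] that annihilates the completed square exhibits [quad (schur A) w]
    as a value of the form of [A]. *)
Lemma posdef_schur d (A : 'M[K]_(1 + d)) : posdef A ->
  0 < pivot A /\ posdef (schur A).
Proof.
move=> [As Ap].
have a0 : 0 < pivot A.
  have nz : col_mx (const_mx 1) 0 != 0 :> 'cV[K]_(1 + d).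
    rewrite col_mx_eq0 negb_and; apply/orP; left.
    by apply/eqP => /matrixP /(_ 0 0) /eqP; rewrite !mxE oner_eq0.
  have := Ap _ nz; rewrite -{1}[A]submxK /quad tr_col_mx mul_row_block mul_row_col.
  rewrite !mulmx0 addr0 trmx_const trmx0 !mul0mx addr0.
  by rewrite /pivot !mxE big_ord1 !mxE big_ord1 !mxE mul1r mulr1.
split=> //; split.
  rewrite /schur [LHS]linearB /= linearZ /= trmx_mul trmxK; congr (_ - _).
  by rewrite trmx_drsub As.
move=> w w0.
have := @quad_schur d A (- ((pivot A)^-1 * (ursubmx A *m w) 0 0)) w As (lt0r_neq0 a0).
rewrite addNr expr0n mulr0 add0r => <-; apply: Ap.
by rewrite col_mx_eq0 negb_and w0 orbT.
Qed.

Lemma posdef_det d (A : 'M[K]_d) : posdef A -> 0 < \det A.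
Proof.
elim: d A => [|d IH] A hA; first by rewrite det_mx00.
have [a0 hS] := @posdef_schur d A hA.
by rewrite (@det_schur d A (proj1 hA) (lt0r_neq0 a0)) mulr_gt0 ?IH.
Qed.

Lemma posdefZ d (A : 'M[K]_d) (k : K) : 0 < k -> posdef A -> posdef (k *: A).
Proof.
move=> k0 [As Ap]; split; first by rewrite linearZ /= As.
move=> v v0; rewrite /quad -scalemxAr -scalemxAl mxE mulr_gt0 //; exact: Ap.
Qed.

Lemma sum_colS (T : finType) (d : nat) (F : 'cV[T]_(1 + d) -> K) :
  \sum_u F u = \sum_(w : 'cV[T]_d) \sum_(j : T) F (col_mx (const_mx j) w).
Proof.
rewrite pair_big /=.
rewrite (reindex (fun p : 'cV[T]_d * T => col_mx (const_mx p.2) p.1)) //=.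
exists (fun u => (dsubmx u, usubmx u 0 0)) => [[w j] _|u _] /=.
  by rewrite col_mxKd col_mxKu mxE.
rewrite -[RHS]vsubmxK; congr col_mx.
by apply/matrixP => i k; rewrite mxE !ord1.
Qed.

Lemma grid_col n d (j : 'I_n.+1) (w : 'cV['I_n.+1]_d) :
  grid (col_mx (const_mx j) w : 'cV_(1 + d)) = col_mx (const_mx (j%:R / n%:R)) (grid w).
Proof.
apply/matrixP => i k; rewrite !mxE.
by case: (fintype.split i) => i'; rewrite !mxE.
Qed.

Variable g : K.
Hypothesis hg : gauss_const_spec g.

Let g0 : 0 < g := proj1 hg.

Lemma gauss_shift n d (A : 'M[K]_(1 + d)) (y : 'cV[K]_(1 + d)) j (w : 'cV['I_n.+1]_d) :
  posdef A ->
  let s := usubmx y 0 0 - (pivot A)^-1 * (ursubmx A *m (grid w - dsubmx y)) 0 0 in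
  expR (- (n%:R / 2 * quad A (grid (col_mx (const_mx j) w) - y))) =
  expR (- (n%:R / 2 * quad (schur A) (grid w - dsubmx y))) *
  expR (- (pivot A * n%:R / 2 * (j%:R / n%:R - s) ^+ 2)).
Proof.
move=> hA s; have [a0 _] := posdef_schur hA.
rewrite -expRD grid_col -{1}[y]vsubmxK.
rewrite (_ : usubmx y = const_mx (usubmx y 0 0)); last first.
  by apply/matrixP => i k; rewrite [RHS]mxE !ord1.
rewrite (_ : _ - _ = col_mx (const_mx (j%:R / n%:R - usubmx y 0 0)) (grid w - dsubmx y)); last first.
  by rewrite opp_col_mx add_col_mx; congr col_mx; apply/matrixP => i k; rewrite !mxE.
rewrite quad_schur ?gt_eqF //; last exact: (proj1 hA).
by rewrite /s; congr expR; ring.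
Qed.

Lemma sqrt_pivot n d (A : 'M[K]_(1 + d)) : posdef A ->
  Num.sqrt (n%:R / pivot A) * (Num.sqrt n%:R ^+ d / Num.sqrt (\det (schur A))) =
  Num.sqrt n%:R ^+ d.+1 / Num.sqrt (\det A).
Proof.
move=> hA; have [a0 hS] := posdef_schur hA; have dS := posdef_det hS.
rewrite (det_schur (proj1 hA)) ?gt_eqF // sqrtrM // ?ltW // sqrtrM ?sqrtrV ?ltW //.
by rewrite exprS; field; rewrite !sqrtr_eq0 -!ltNge a0 dS.
Qed.

(* Completing the square in the first coordinate leaves the Schur complement: the sum
   over that coordinate is a shifted one-dimensional sum, and induction on [d] does
   the rest. *)
Lemma gauss_sum_le d (A : 'M[K]_d) (kappa : K) : posdef A -> 1 < kappa ->
  \forall n \near \oo, forall y : 'cV[K]_d,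
   \sum_(u : 'cV['I_n.+1]_d) expR (- (n%:R / 2 * quad A (grid u - y))) <=
   kappa * (g ^+ d * (Num.sqrt n%:R ^+ d / Num.sqrt (\det A))).
Proof.
elim: d A kappa => [|d IH] A kappa hA k1.
  near=> n => y; rewrite det_mx00 sqrtr1 !expr0 divr1 !mulr1.
  apply: le_trans (ltW k1).
  rewrite (eq_bigr (fun=> 1)); last first.
    move=> u _; rewrite /quad (_ : _ - _ = 0); last by apply/matrixP => -[].
    by rewrite mulmx0 mxE mulr0 oppr0 expR0.
  by rewrite sumr_const card_mx mul0n expn0.
have [a0 hS] := @posdef_schur d A hA.
have k0 : 0 < kappa by apply: lt_trans k1.
(* One factor [k'] pays for the first coordinate, the other for the induction hypothesis. *)
pose k' := Num.sqrt kappa.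
have k'1 : 1 < k' by rewrite -[ltLHS]sqrtr1 ltr_sqrt.
have kk : kappa = k' * k' by rewrite -expr2 sqr_sqrtr ?ltW.
have [hup _] := proj2 hg _ _ a0 k'1.
near=> n => y.
rewrite (@sum_colS _ d).
under eq_bigr => w _ do (under eq_bigr do rewrite (@gauss_shift n d A) //; rewrite -mulr_sumr).
apply: (@le_trans _ _ (\sum_(w : 'cV['I_n.+1]_d)
  expR (- (n%:R / 2 * quad (schur A) (grid w - dsubmx (y : 'cV[K]_(1 + d))))) *
   (k' * (g * Num.sqrt (n%:R / pivot A))))).
  apply: ler_sum => w _; rewrite ler_wpM2l ?expR_ge0 //.
  by move: {w}(_ - _ : K) => s; move: s; near: n.
rewrite -mulr_suml mulrC.
have H : \sum_(w : 'cV['I_n.+1]_d)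
    expR (- (n%:R / 2 * quad (schur (A : 'M[K]_(1 + d))) (grid w - dsubmx (y : 'cV[K]_(1 + d))))) <=
    k' * (g ^+ d * (Num.sqrt n%:R ^+ d / Num.sqrt (\det (schur (A : 'M[K]_(1 + d)))))).
  by move: (dsubmx _); near: n; exact: IH.
apply: le_trans (ler_wpM2l _ H) _.
  by rewrite !mulr_ge0 ?sqrtr_ge0 // ltW // (lt_trans _ k'1).
rewrite -sqrt_pivot // kk !exprS le_eqVlt; apply/orP; left; apply/eqP; ring.
Unshelve. all: by end_near.
Qed.

(** The centre of the sum over the first coordinate depends on the others. These are kept in a
    window so small that the centre moves by at most [delta / 2], which leaves half of the margin
    for the one-dimensional bound. *)
Lemma gauss_sum_ge d (A : 'M[K]_d) (kappa delta : K) : posdef A -> 1 < kappa -> 0 < delta ->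
  \forall n \near \oo, forall y : 'cV[K]_d, (forall i, delta <= y i 0 <= 1 - delta) ->
   g ^+ d * (Num.sqrt n%:R ^+ d / Num.sqrt (\det A)) <= kappa *
   \sum_(u : 'cV['I_n.+1]_d | [forall i, `|grid u i 0 - y i 0| <= delta])
      expR (- (n%:R / 2 * quad A (grid u - y))).
Proof.
elim: d A kappa delta => [|d IH] A kappa delta hA k1 d0.
  near=> n => y _; rewrite det_mx00 sqrtr1 !expr0 divr1 !mulr1.
  apply: (le_trans (ltW k1)); rewrite ler_peMr ?(le_trans ler01 (ltW k1)) //.
  rewrite (eq_big xpredT (fun=> 1)); last 2 first.
  - by move=> u; apply/forallP => -[].
  - move=> u _; rewrite /quad (_ : _ - _ = 0); last by apply/matrixP => -[].
    by rewrite mulmx0 mxE mulr0 oppr0 expR0.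
  by rewrite sumr_const card_mx mul0n expn0.
have [a0 hS] := @posdef_schur d A hA.
have k0 : 0 < kappa by apply: lt_trans k1.
pose k' := Num.sqrt kappa.
have k'1 : 1 < k' by rewrite -[ltLHS]sqrtr1 ltr_sqrt.
have kk : kappa = k' * k' by rewrite -expr2 sqr_sqrtr ?ltW.
have k'0 : 0 < k' by apply: lt_trans k'1.
have d20 : 0 < delta / 2 by rewrite divr_gt0.
have [_ /(_ _ d20) hlo] := proj2 hg _ _ a0 k'1.
(* A bound for the sum of the absolute coefficients of the shift; the added 1 keeps it positive. *)
pose M := 1 + \sum_i (`|(pivot (A : 'M[K]_(1 + d)))^-1 * ursubmx (A : 'M[K]_(1 + d)) 0 i|).
have M1 : 1 <= M by rewrite lerDl sumr_ge0.
have M0 : 0 < M by apply: lt_le_trans M1.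
pose d' := Num.min delta (delta / 2 / M).
have d'0 : 0 < d' by rewrite lt_min d0 divr_gt0.
near=> n => y hy.
pose y' := dsubmx (y : 'cV[K]_(1 + d)).
have hy' i : d' <= y' i 0 <= 1 - d'.
  have := hy (rshift 1 i); rewrite mxE => /andP[h1 h2].
  have h3 : d' <= delta by rewrite ge_min lexx.
  by apply/andP; split; lra.
pose s (w : 'cV['I_n.+1]_d) := usubmx (y : 'cV[K]_(1 + d)) 0 0 -
  (pivot (A : 'M[K]_(1 + d)))^-1 * (ursubmx (A : 'M[K]_(1 + d)) *m (grid w - y')) 0 0.
have hs (w : 'cV['I_n.+1]_d) : [forall i, `|grid w i 0 - y' i 0| <= d'] ->
    `|s w - usubmx (y : 'cV[K]_(1 + d)) 0 0| <= delta / 2.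
  move/forallP => hw; rewrite /s addrAC subrr add0r normrN mxE mulr_sumr.
  apply: (le_trans (ler_norm_sum _ _ _)).
  apply: (@le_trans _ _ (\sum_i (`|(pivot (A : 'M[K]_(1 + d)))^-1 * ursubmx (A : 'M[K]_(1 + d)) 0 i| * d'))).
    apply: ler_sum => i _; rewrite mulrA normrM ler_wpM2l //.
    by have := hw i; rewrite !mxE.
  rewrite -mulr_suml; apply: (@le_trans _ _ (M * d')).
    by rewrite ler_wpM2r ?(ltW d'0) // lerDr.
  rewrite mulrC -ler_pdivlMr //; by rewrite ge_min lexx orbT.
have step1 : g ^+ d * (Num.sqrt n%:R ^+ d / Num.sqrt (\det (schur (A : 'M[K]_(1 + d))))) <=
    k' * \sum_(w : 'cV['I_n.+1]_d | [forall i, `|grid w i 0 - y' i 0| <= d'])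
      expR (- (n%:R / 2 * quad (schur (A : 'M[K]_(1 + d))) (grid w - y'))).
  by move: y' hy' {hs s}; near: n; exact: IH.
have step2 (w : 'cV['I_n.+1]_d) : [forall i, `|grid w i 0 - y' i 0| <= d'] ->
    g * Num.sqrt (n%:R / pivot (A : 'M[K]_(1 + d))) <= k' *
     \sum_(j < n.+1 | `|j%:R / n%:R - s w| <= delta / 2)
        expR (- (pivot (A : 'M[K]_(1 + d)) * n%:R / 2 * (j%:R / n%:R - s w) ^+ 2)).
  move=> hw; have : delta / 2 <= s w <= 1 - delta / 2.
    have := hs w hw; have := hy (lshift d (0 : 'I_1)); rewrite [usubmx _ _ _]mxE ler_norml => /andP[h1 h2] /andP[h3 h4].
    by apply/andP; split; lra.
  by move: (s w); near: n.
have step3 : g ^+ d.+1 * (Num.sqrt n%:R ^+ d.+1 / Num.sqrt (\det A)) <=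
   kappa * \sum_(w : 'cV['I_n.+1]_d | [forall i, `|grid w i 0 - y' i 0| <= d'])
     \sum_(j < n.+1 | `|j%:R / n%:R - s w| <= delta / 2)
       expR (- (n%:R / 2 * quad A (grid (col_mx (const_mx j) w : 'cV_(1 + d)) - y))).
  rewrite -sqrt_pivot // exprS mulrACA kk -[leRHS]mulrA.
  apply: (@le_trans _ _ ((g * Num.sqrt (n%:R / pivot (A : 'M[K]_(1 + d)))) *
     (k' * \sum_(w : 'cV['I_n.+1]_d | [forall i, `|grid w i 0 - y' i 0| <= d'])
      expR (- (n%:R / 2 * quad (schur (A : 'M[K]_(1 + d))) (grid w - y')))))).
    by rewrite ler_wpM2l // mulr_ge0 ?sqrtr_ge0 ?ltW.
  rewrite mulrCA ler_pM2l // !mulr_sumr; apply: ler_sum => w hw.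
  under [X in _ <= _ * X]eq_bigr do rewrite (@gauss_shift n d A) //.
  rewrite -mulr_sumr mulrCA mulrC ler_wpM2l ?expR_ge0 //.
  exact: step2.
apply: le_trans step3 _.
rewrite ler_pM2l // big_mkcond [leRHS]big_mkcond (@sum_colS _ d).
apply: ler_sum => w _; case: ifP => [hw|_]; last first.
  by apply: sumr_ge0 => j _; case: ifP => // _; exact: expR_ge0.
rewrite big_mkcond; apply: ler_sum => j _; case: ifP => hj; last first.
  by case: ifP => // _; exact: expR_ge0.
rewrite ifT //; apply/forallP => i; rewrite grid_col.
rewrite -(vsubmxK (y : 'cV[K]_(1 + d))) -/y' [X in `|X - _|]mxE [X in `|_ - X|]mxE.
case: (fintype.split _) => i'; last first.
  by apply: le_trans (forallP hw i') _; rewrite ge_min lexx.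
rewrite mxE ord1.
have := hs w hw; move: hj; rewrite !ler_norml => /andP[h1 h2] /andP[h3 h4].
by apply/andP; split; lra.
Unshelve. all: by end_near.
Qed.

End GaussSums.

(** * Stirling's formula up to the constant *)

Section Stirling.
Variable K : realType.

(** The midpoint and the trapezoidal rule for the integral of the convex function [1 / (1 + t)] over
    [[0, x]]. At [x = 1 / z] they give exactly what Stirling's formula asks of
    [(z + 1 / 2) * ln (1 + 1 / z)]. *)
Lemma ln1Dx_bounds (x : K) : 0 <= x ->
  2 * x / (2 + x) <= ln (1 + x) <= x * (2 + x) / (2 * (1 + x)).
Proof.
move=> x0.
have D1 (y : K) : 0 <= y <= x -> is_derive y 1 (fun z => ln (1 + z)) (1 / (1 + y)).
  move=> /andP[y0 _]; apply: is_derive_ln_fun; last by rewrite ltr_wpDr.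
  by have := is_derive_funD (is_derive_fun_cst y 1) (is_derive_fun_id y); rewrite add0r.
have DV (y a : K) : 0 <= y -> 0 < a -> is_derive y 1 (fun z => (a + z)^-1) (- (a + y) ^- 2).
  move=> y0 a0; have := is_derive_funV (is_derive_funD (is_derive_fun_cst y a) (is_derive_fun_id y)) _.
  by rewrite add0r mulr1; apply; rewrite gt_eqF // ltr_wpDr.
apply/andP; split.
  have D2 (y : K) : 0 <= y <= x ->
      is_derive y 1 (fun z => ln (1 + z) - (2 - 4 * (2 + z)^-1)) (1 / (1 + y) - (0 - 4 * - (2 + y) ^- 2)).
    move=> hy; have /andP[y0 _] := hy; apply: is_derive_funB; first exact: D1.
    exact: (is_derive_funB (is_derive_fun_cst y 2) (is_derive_funZ (DV y 2 y0 _) 4)).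
  have := nondecreasing_of_deriv x0 D2.
  rewrite !addr0 ln1 (_ : 0 - _ = 0); last by field.
  rewrite (_ : 2 - 4 / (2 + x) = 2 * x / (2 + x)); last first.
    by field; rewrite gt_eqF // ltr_wpDr.
  rewrite subr_ge0; apply => y /andP[y0 _].
  rewrite (_ : _ - _ = y ^+ 2 / ((1 + y) * (2 + y) ^+ 2)); last first.
    by field; rewrite !gt_eqF // ltr_wpDr.
  by rewrite divr_ge0 ?sqr_ge0 // mulr_ge0 ?sqr_ge0 // addr_ge0.
have D2 (y : K) : 0 <= y <= x ->
    is_derive y 1 (fun z => 2^-1 * (z - (1 + z)^-1) - ln (1 + z))
      (2^-1 * (1 - - (1 + y) ^- 2) - 1 / (1 + y)).
  move=> hy; have /andP[y0 _] := hy; apply: is_derive_funB; last exact: D1.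
  exact: (is_derive_funZ (is_derive_funB (is_derive_fun_id y) (DV y 1 y0 _)) 2^-1).
have := nondecreasing_of_deriv x0 D2.
rewrite !addr0 ln1 invr1 !subr0 sub0r => h.
have : 0 <= 2^-1 * (x - (1 + x)^-1) - ln (1 + x) - 2^-1 * -1.
  rewrite subr_ge0; apply: h => y /andP[y0 _].
  rewrite (_ : _ - _ = 2^-1 * (y / (1 + y)) ^+ 2); last by field; rewrite gt_eqF // ltr_wpDr.
  by rewrite mulr_ge0 ?sqr_ge0.
rewrite (_ : x * (2 + x) / (2 * (1 + x)) = 2^-1 * (x - (1 + x)^-1) + 2^-1).
  lra.
by field; rewrite gt_eqF // ltr_wpDr.
Qed.

Definition stirling_main (n : nat) : K := Num.sqrt n%:R * n%:R ^+ n * expR (- n%:R).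

(** Here [C] again stands for [sqrt (2 pi)], characterised by the asymptotics alone. *)
Definition stirling_spec (C : K) := 0 < C /\ forall kappa : K, 1 < kappa ->
  \forall n \near \oo, C * stirling_main n <= kappa * n`!%:R /\
                       n`!%:R <= kappa * (C * stirling_main n).

Lemma stirling_main_gt0 n : 0 < stirling_main n.+1.
Proof. by rewrite !mulr_gt0 ?sqrtr_gt0 ?exprn_gt0 ?expR_gt0. Qed.

Lemma ln_stirling_main n : ln (stirling_main n.+1) =
  (n.+1%:R + 2^-1) * ln n.+1%:R - n.+1%:R.
Proof.
rewrite /stirling_main !lnM ?posrE ?mulr_gt0 ?sqrtr_gt0 ?exprn_gt0 ?expR_gt0 //.
rewrite expRK lnXn // -powR12_sqrt ?ler0n // ln_powR -mulr_natl; ring.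
Qed.

(** The logarithm of the quotient of [n!] and [stirling_main n] decreases, by steps below those of
    [1 / n]. These telescope, so it is bounded below and converges; [C] is the exponential of the
    limit. *)
Lemma stirling_exists : exists C, stirling_spec C.
Proof.
(* The index is shifted because [stirling_main 0 = 0]. *)
pose a (n : nat) : K := ln (n.+1)`!%:R - ln (stirling_main n.+1).
have step n : 0 <= a n - a n.+1 <= 1 / n.+1%:R - 1 / n.+2%:R.
  rewrite /a !ln_stirling_main [(n.+2)`!]factS natrM lnM ?posrE ?ltr0n ?fact_gt0 //.
  have n0 : 0 < n.+1%:R :> K by [].
  have -> : n.+2%:R = n.+1%:R * (1 + n.+1%:R^-1) :> K.
    by rewrite -[n.+2%:R]natr1; field; rewrite gt_eqF.
  move: n.+1%:R n0 => z z0.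
  have zi : 0 < z^-1 by rewrite invr_gt0.
  have z1 : 0 < 1 + z^-1 by rewrite addr_gt0.
  rewrite lnM ?posrE //.
  have := ln1Dx_bounds (ltW zi); move: (ln _) (ln _) (ln _) => l1 l2 l3 /andP[h1 h2].
  rewrite (_ : _ - _ = (z + 2^-1) * l3 - 1); last by field; rewrite gt_eqF.
  have zh : 0 <= z + 2^-1 by rewrite addr_ge0 // ltW.
  have := ler_wpM2l zh h1; have := ler_wpM2l zh h2.
  have -> : (z + 2^-1) * (2 / z / (2 + z^-1)) = 1.
    by field; rewrite !gt_eqF // ?addr_gt0 ?mulr_gt0.
  have -> : (z + 2^-1) * (z^-1 * (2 + z^-1) / (2 * (1 + z^-1))) = 1 + (z * (z + 1))^-1 / 4.
    by field; rewrite !gt_eqF // ?addr_gt0 ?mulr_gt0.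
  have -> : 1 / z - 1 / (z * (1 + z^-1)) = (z * (z + 1))^-1.
    by field; rewrite !gt_eqF // ?addr_gt0 ?mulr_gt0.
  have : 0 <= (z * (z + 1))^-1 by rewrite invr_ge0 mulr_ge0 ?addr_ge0 // ltW.
  by move=> h3 h4 h5; apply/andP; split; lra.
have lb n : a 0%N - 1 + 1 / n.+1%:R <= a n.
  elim: n => [|n IH]; first by rewrite divr1 subrK.
  have /andP[_] := step n; move: IH; move: (1 / n.+1%:R) (1 / n.+2%:R) => u v; lra.
have cvga : cvgn a.
  apply: nonincreasing_is_cvgn.
    by apply/nonincreasing_seqP => n; rewrite -subr_ge0; have /andP[] := step n.
  exists (a 0%N - 1) => _ [n _ <-]; apply: le_trans (lb n).
  by rewrite lerDl divr_ge0.
pose l := limn a.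
exists (expR l); split=> [|kappa k1]; first exact: expR_gt0.
have k0 : 0 < kappa by apply: lt_trans k1.
have lk : 0 < ln kappa by exact: ln_gt0.
have [N _ hN] : \forall n \near \oo, `|l - a n| <= ln kappa.
  exact: cvgr_dist_le cvga _ lk.
exists N.+1 => // -[//|n] /= Nn.
have := hN n Nn; rewrite ler_norml => /andP[h1 h2].
have sp := stirling_main_gt0 n.
have fp : 0 < (n.+1)`!%:R :> K by rewrite ltr0n fact_gt0.
rewrite -[X in expR l * X]lnK ?posrE // -[(n.+1)`!%:R]lnK ?posrE // -[kappa]lnK ?posrE //.
rewrite -!expRD !ler_expR.
by move: h1 h2; rewrite /a; lra.
Qed.
End Stirling.

(** * Derivatives of Phi along segments *)

Section LineCalculus.
Variable K : realType.

Lemma taylor2_ge (f df ddf : K -> K) (m : K) :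
  (forall x : K, 0 <= x <= 1 -> is_derive x 1 f (df x)) ->
  (forall x : K, 0 <= x <= 1 -> is_derive x 1 df (ddf x)) ->
  (forall x : K, 0 <= x <= 1 -> ddf x <= m) -> f 1 - f 0 <= df 0 + m / 2.
Proof.
move=> hf hdf hm.
have N (u : K -> K) (a x : K) : is_derive x 1 u a -> is_derive x 1 (fun y => - u y) (- a).
  by move=> h; exact: is_deriveN.
have := @taylor2_le K (fun x => - f x) (fun x => - df x) (fun x => - ddf x) (- m).
have h1 (x : K) : 0 <= x <= 1 -> is_derive x 1 (fun x => - f x) (- df x).
  by move=> /hf; exact: N.
have h2 (x : K) : 0 <= x <= 1 -> is_derive x 1 (fun x => - df x) (- ddf x).
  by move=> /hdf; exact: N.
have h3 (x : K) : 0 <= x <= 1 -> - m <= - ddf x by move=> /hm; rewrite lerN2.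
by move=> /(_ h1 h2 h3); lra.
Qed.

Variables (q : nat) (R : 'M[K]_q) (r : 'cV[K]_q).
Hypothesis hRsym : R^T = R.
Implicit Types (c t : K) (x y v : 'cV[K]_q).

Definition bil (x v : 'cV[K]_q) : K := (x^T *m R *m v) 0 0.

Definition hmat (c : K) (x : 'cV[K]_q) : 'M[K]_q :=
  invmx (diag_mx x^T) + (2 * c / quad R x) *:
        ((2 / quad R x) *: (R *m x *m (x^T *m R)) - R).

(** The directional derivative of [Phi] for directions of coordinate sum 0; in general the summand
    [\sum_i v i 0] would be added. *)
Definition dPhi (c : K) (x v : 'cV[K]_q) : K :=
  \sum_i v i 0 * (ln (x i 0) - ln (r i 0)) - 2 * c / quad R x * bil x v.

Definition ddPhi (c : K) (x v : 'cV[K]_q) : K :=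
  \sum_i v i 0 ^+ 2 / x i 0 +
  2 * c / quad R x * (2 / quad R x * bil x v ^+ 2 - quad R v).

Lemma quad_line x v t : quad R (x + t *: v) = quad R x + t * (2 * bil x v) + t * t * quad R v.
Proof.
have sym : (v^T *m R *m x) 0 0 = bil x v.
  by rewrite /bil -[LHS]trace_mx11 -mxtrace_tr !trmx_mul trmxK hRsym mulmxA trace_mx11.
rewrite /quad [(x + _)^T]linearD /= [(t *: v)^T]linearZ /= !mulmxDr !mulmxDl -!scalemxAr -!scalemxAl.
have mD (M N : 'M[K]_1) : (M + N) 0 0 = M 0 0 + N 0 0 by rewrite mxE.
have mZ k (M : 'M[K]_1) : (k *: M) 0 0 = k * M 0 0 by rewrite mxE.
by rewrite !(mD, mZ) sym /bil; ring.
Qed.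

Lemma bil_line x v t : bil (x + t *: v) v = bil x v + t * quad R v.
Proof.
by rewrite /bil linearD linearZ /= !mulmxDl -!scalemxAl [LHS]mxE [X in _ + X]mxE.
Qed.

Lemma is_derive_Phi c x v t : \sum_i v i 0 = 0 ->
  (forall i, 0 < (x + t *: v) i 0) -> 0 < quad R (x + t *: v) ->
  is_derive t 1 (fun t => Phi R r c (x + t *: v)) (dPhi c (x + t *: v) v).
Proof.
move=> v0 hx hQ.
rewrite (_ : (fun t => Phi R r c (x + t *: v)) = fun t =>
  \sum_i (x i 0 + t * v i 0) * (ln (x i 0 + t * v i 0) - ln (r i 0)) -
  c * ln (quad R x + t * (2 * bil x v) + t * t * quad R v)); last first.
  apply/funext => s; rewrite /Phi quad_line; congr (_ - _).
  by apply: eq_bigr => i _; rewrite !mxE.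
have dl (a b s : K) : is_derive s 1 (fun s => a + s * b) b.
  have := is_derive_funD (is_derive_fun_cst s a) (is_derive_funM (is_derive_fun_id s) (is_derive_fun_cst s b)).
  by rewrite mulr0 !add0r mulr1.
have hx' i : 0 < x i 0 + t * v i 0 by have := hx i; rewrite !mxE.
apply: (@is_derive_eqr _ _ _ (\sum_i ((x i 0 + t * v i 0) * (v i 0 / (x i 0 + t * v i 0) - 0) +
    (ln (x i 0 + t * v i 0) - ln (r i 0)) * v i 0) -
    c * ((2 * bil x v + (t * 1 + t * 1) * quad R v) / (quad R x + t * (2 * bil x v) + t * t * quad R v)))).
  apply: (is_derive_funB (is_derive_fun_sum _) (is_derive_funZ (is_derive_ln_fun _ _) _)); last by rewrite -quad_line.
    move=> i; have D1 := dl (x i 0) (v i 0) t.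
    exact: (is_derive_funM D1 (is_derive_funB (is_derive_ln_fun D1 (hx' i)) (is_derive_fun_cst t _))).
  have := is_derive_funD (dl (quad R x) (2 * bil x v) t) (is_derive_funM (is_derive_funM (is_derive_fun_id t) (is_derive_fun_id t)) (is_derive_fun_cst t (quad R v))).
  by rewrite mulr0 add0r [quad R v * _]mulrC.
rewrite /dPhi bil_line -quad_line; congr (_ - _).
  transitivity (\sum_i v i 0 * (ln ((x + t *: v) i 0) - ln (r i 0)) + \sum_i v i 0).
    rewrite -big_split; apply: eq_bigr => i _ /=.
    by rewrite !mxE; field; rewrite gt_eqF.
  by rewrite v0 addr0.
by field; rewrite gt_eqF.
Qed.

Lemma is_derive_dPhi c x v t :
  (forall i, 0 < (x + t *: v) i 0) -> 0 < quad R (x + t *: v) ->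
  is_derive t 1 (fun t => dPhi c (x + t *: v) v) (ddPhi c (x + t *: v) v).
Proof.
move=> hx hQ.
rewrite (_ : (fun t => dPhi c (x + t *: v) v) = fun t =>
  \sum_i v i 0 * (ln (x i 0 + t * v i 0) - ln (r i 0)) -
  (2 * c) * ((quad R x + t * (2 * bil x v) + t * t * quad R v)^-1 *
    (bil x v + t * quad R v))); last first.
  apply/funext => s; rewrite /dPhi quad_line bil_line [X in _ = _ - X]mulrA; congr (_ - _).
  by apply: eq_bigr => i _; rewrite !mxE.
have dl (a b s : K) : is_derive s 1 (fun s => a + s * b) b.
  have := is_derive_funD (is_derive_fun_cst s a) (is_derive_funM (is_derive_fun_id s) (is_derive_fun_cst s b)).
  by rewrite mulr0 !add0r mulr1.
have hx' i : 0 < x i 0 + t * v i 0 by have := hx i; rewrite !mxE.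
have DQ : is_derive t 1 (fun t => quad R x + t * (2 * bil x v) + t * t * quad R v)
  (2 * bil x v + (t * 1 + t * 1) * quad R v).
  have := is_derive_funD (dl (quad R x) (2 * bil x v) t) (is_derive_funM (is_derive_funM (is_derive_fun_id t) (is_derive_fun_id t)) (is_derive_fun_cst t (quad R v))).
  by rewrite mulr0 add0r [quad R v * _]mulrC.
have Q0 : quad R x + t * (2 * bil x v) + t * t * quad R v != 0.
  by rewrite -quad_line gt_eqF.
have DS := is_derive_fun_sum (fun i => is_derive_funZ (is_derive_funB (is_derive_ln_fun (dl (x i 0) (v i 0) t) (hx' i)) (is_derive_fun_cst t (ln (r i 0)))) (v i 0)).
have DH := is_derive_funB DS (is_derive_funZ (is_derive_funM (is_derive_funV DQ Q0) (dl (bil x v) (quad R v) t)) (2 * c)).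
apply: (is_derive_eqr DH).
rewrite /ddPhi bil_line -quad_line; congr (_ + _).
  apply: eq_bigr => i _; rewrite !mxE subr0 mulrA -expr2 //.
rewrite quad_line; move: Q0; set Q := quad R x + _ + _ => Q0; field.
exact: Q0.
Qed.

Lemma quad_hmat c x v : (forall i, 0 < x i 0) -> quad (hmat c x) v = ddPhi c x v.
Proof.
move=> hx.
rewrite /hmat.
have -> : invmx (diag_mx x^T) = diag_mx (\row_i (x i 0)^-1).
  have e : diag_mx x^T *m diag_mx (\row_i (x i 0)^-1) = 1%:M.
    rewrite mulmx_diag; apply/matrixP => i j; rewrite !mxE.
    by rewrite divff ?(gt_eqF (hx i)).
  have u : diag_mx x^T \in unitmx by case: (mulmx1_unit e).
  by rewrite -[LHS]mulmx1 -e mulKmx.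
rewrite {1}/quad mulmxDr mulmxDl -scalemxAr -scalemxAl mulmxBr mulmxBl -scalemxAr -scalemxAl.
have -> : v^T *m (R *m x *m (x^T *m R)) *m v = (v^T *m R *m x) *m (x^T *m R *m v).
  by rewrite !mulmxA.
have sym : v^T *m R *m x = (x^T *m R *m v)^T.
  by rewrite !trmx_mul trmxK hRsym mulmxA.
rewrite sym [LHS]mxE; congr (_ + _).
  rewrite mxE; apply: eq_bigr => i _; rewrite mul_mx_diag !mxE expr2; ring.
rewrite /bil [quad R v]/quad.
move: (x^T *m R *m v) (v^T *m R *m v) => a b.
by rewrite !mxE big_ord1 !mxE; ring.
Qed.

Lemma hmat_sym c x : (hmat c x)^T = hmat c x.
Proof.
rewrite /hmat [LHS]linearD /= linearZ /= linearB /= linearZ /= trmx_inv tr_diag_mx hRsym.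
by rewrite !trmx_mul trmxK hRsym.
Qed.
End LineCalculus.

(** * Neighbourhoods, and continuity jointly in [c] and [x] *)

Section Nearness.
Variable K : realType.

Definition box q (e : K) (p x : 'cV[K]_q) := forall i, `|x i 0 - p i 0| < e.

Lemma near_boxP q (p : 'cV[K]_q) (P : set 'cV[K]_q) :
  (\forall x \near p, P x) <-> exists2 e : K, 0 < e & forall x, box e p x -> P x.
Proof.
split=> [/nbhs_ballP [e e0 h]|[e e0 h]].
  exists e => // x hx; apply: h; split=> // i j.
  by rewrite !ord1 /ball /= distrC.
apply/nbhs_ballP; exists e => // x [_ hx]; apply: h => i.
by have := hx i 0; rewrite /ball /= distrC.
Qed.

Lemma near_cboxP q (c : K) (p : 'cV[K]_q) (P : K * 'cV[K]_q -> Prop) :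
  (\forall z \near (c, p), P z) <->
  exists2 e : K, 0 < e & forall c' x, `|c' - c| < e -> box e p x -> P (c', x).
Proof.
split=> [/nbhs_ballP [e e0 h]|[e e0 h]].
  exists e => // c' x hc hx; apply: h; split; first by rewrite /ball /= distrC.
  by split=> // i j; rewrite !ord1 /ball /= distrC.
apply/nbhs_ballP; exists e => // -[c' x] [/= hc [_ hx]]; apply: h.
  by move: hc; rewrite /ball /= distrC.
by move=> i; have := hx i 0; rewrite /ball /= distrC.
Qed.

Lemma box_le q (e e' : K) (p x : 'cV[K]_q) : e <= e' -> box e p x -> box e' p x.
Proof. by move=> ee' h i; apply: lt_le_trans (h i) ee'. Qed.

Lemma cvg_sum_ord T (F : set_system T) (FF : Filter F) n (f : 'I_n -> T -> K) (l : 'I_n -> K) :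
  (forall i, f i t @[t --> F] --> l i) ->
  \sum_i f i t @[t --> F] --> \sum_i l i.
Proof.
elim: n f l => [|n IH] f l h.
  by rewrite big_ord0; under eq_fun do rewrite big_ord0; exact: cvg_cst.
rewrite big_ord_recr; under eq_fun do rewrite big_ord_recr.
by apply: cvgD => //; apply: IH => i; exact: h.
Qed.

Lemma cvg_near_gt T (F : set_system T) (FF : Filter F) (f : T -> K) (l a : K) :
  f t @[t --> F] --> l -> a < l -> F [set t | a < f t].
Proof.
move=> /cvgrPdist_lt h al; have := h (l - a); rewrite subr_gt0 al => /(_ isT).
by apply: filterS => t /=; rewrite ltr_norml => /andP[_]; lra.
Qed.

Lemma cvg_near_lt T (F : set_system T) (FF : Filter F) (f : T -> K) (l a : K) :
  f t @[t --> F] --> l -> l < a -> F [set t | f t < a].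
Proof.
move=> /cvgrPdist_lt h al; have := h (a - l); rewrite subr_gt0 al => /(_ isT).
by apply: filterS => t /=; rewrite ltr_norml => /andP[]; lra.
Qed.

End Nearness.

Section Continuity.
Variables (K : realType) (q : nat) (R : 'M[K]_q) (r : 'cV[K]_q).
Variables (T : Type) (F : set_system T).
Hypothesis FF : Filter F.
Variables (c_ : T -> K) (x_ : T -> 'cV[K]_q) (c : K) (x : 'cV[K]_q).
Hypotheses (hc : c_ t @[t --> F] --> c) (hx : forall i, x_ t i 0 @[t --> F] --> x i 0).

Lemma bil_sum (y v : 'cV[K]_q) : bil R y v = \sum_i \sum_j y i 0 * R i j * v j 0.
Proof.
rewrite /bil mxE exchange_big; apply: eq_bigr => j _ /=.
by rewrite mxE big_distrl /=; apply: eq_bigr => i _; rewrite !mxE.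
Qed.

Lemma cvg_quad : quad R (x_ t) @[t --> F] --> quad R x.
Proof.
rewrite quadE; under eq_fun do rewrite quadE.
apply: cvg_sum_ord => i; apply: cvg_sum_ord => j.
by apply: cvgM => //; apply: cvgM => //; exact: cvg_cst.
Qed.

Lemma cvg_bil v : bil R (x_ t) v @[t --> F] --> bil R x v.
Proof.
rewrite bil_sum; under eq_fun do rewrite bil_sum.
apply: cvg_sum_ord => i; apply: cvg_sum_ord => j.
by apply: cvgM; [apply: cvgM => //|]; exact: cvg_cst.
Qed.

Lemma cvg_ln_comp (f : T -> K) (a : K) : 0 < a -> f t @[t --> F] --> a ->
  ln (f t) @[t --> F] --> ln a.
Proof. by move=> a0 hf; apply: continuous_cvg hf; exact: continuous_ln. Qed.

Hypotheses (x0 : forall i, 0 < x i 0) (Q0 : 0 < quad R x).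

Lemma cvg_dPhi v : dPhi R r (c_ t) (x_ t) v @[t --> F] --> dPhi R r c x v.
Proof.
apply: cvgB.
  apply: cvg_sum_ord => i; apply: cvgM; first exact: cvg_cst.
  by apply: cvgB; [exact: cvg_ln_comp|exact: cvg_cst].
apply: cvgM; last exact: cvg_bil.
apply: cvgM; first by apply: cvgM => //; exact: cvg_cst.
by apply: cvgV; [rewrite gt_eqF|exact: cvg_quad].
Qed.

Lemma cvg_Phi : Phi R r (c_ t) (x_ t) @[t --> F] --> Phi R r c x.
Proof.
apply: cvgB.
  apply: cvg_sum_ord => i; apply: cvgM => //.
  by apply: cvgB; [exact: cvg_ln_comp|exact: cvg_cst].
by apply: cvgM => //; apply: cvg_ln_comp => //; exact: cvg_quad.
Qed.

(** The entries of [hmat] without the matrix inverse (see [hmat_hent]); in this form their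
    continuity is immediate. *)
Definition hent (c : K) (x : 'cV[K]_q) i j : K := (i == j)%:R / x i 0 +
  2 * c / quad R x * (2 / quad R x * bil R x (delta_mx i 0) * bil R x (delta_mx j 0) - R i j).

Lemma cvg_hent i j : hent (c_ t) (x_ t) i j @[t --> F] --> hent c x i j.
Proof.
have QV : (quad R (x_ t))^-1 @[t --> F] --> (quad R x)^-1.
  by apply: cvgV; [rewrite gt_eqF|exact: cvg_quad].
apply: cvgD.
  apply: cvgM; first exact: cvg_cst.
  by apply: cvgV => //; rewrite gt_eqF.
apply: cvgM.
  by apply: cvgM => //; apply: cvgM => //; exact: cvg_cst.
apply: cvgB; last exact: cvg_cst.
apply: cvgM; last exact: cvg_bil.
apply: cvgM; last exact: cvg_bil.
by apply: cvgM => //; exact: cvg_cst.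
Qed.

End Continuity.

Section HessianForm.
Variables (K : realType) (q : nat) (R : 'M[K]_q).

Lemma bil_delta (x v : 'cV[K]_q) : bil R x v = \sum_i v i 0 * bil R x (delta_mx i 0).
Proof.
rewrite bil_sum exchange_big; apply: eq_bigr => j _ /=.
transitivity (v j 0 * \sum_i x i 0 * R i j).
  by rewrite mulr_sumr; apply: eq_bigr => i _; ring.
congr (_ * _); rewrite bil_sum exchange_big [RHS](bigD1 j) //= [X in _ + X]big1 ?addr0.
  by apply: eq_bigr => i _; rewrite mxE eqxx mulr1.
by move=> k /negPf kj; apply: big1 => i _; rewrite mxE kj mulr0.
Qed.

Lemma ddPhi_hent c (x v : 'cV[K]_q) :
  ddPhi R c x v = \sum_i \sum_j v i 0 * v j 0 * hent R c x i j.
Proof.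
rewrite /ddPhi.
transitivity (\sum_i \sum_j (v i 0 * v j 0 * ((i == j)%:R / x i 0)
  + (2 * c / quad R x * (2 / quad R x * ((v i 0 * bil R x (delta_mx i 0)) * (v j 0 * bil R x (delta_mx j 0))))
     + - (2 * c / quad R x) * (v i 0 * R i j * v j 0)))); last first.
  by apply: eq_bigr => i _; apply: eq_bigr => j _; rewrite /hent; ring.
under [RHS]eq_bigr do rewrite big_split /=.
rewrite big_split /=; congr (_ + _).
  apply: eq_bigr => i _; rewrite [RHS](bigD1 i) //= eqxx [X in _ = _ + X]big1; last first.
    by move=> j; rewrite eq_sym => /negPf ->; rewrite mul0r mulr0.
  by rewrite expr2 mul1r addr0.
under [RHS]eq_bigr do rewrite big_split /= -!mulr_sumr.
rewrite big_split /= -!mulr_sumr -mulr_suml -quadE -bil_delta.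
ring.
Qed.

(** The entries are made [eta / q.+1]-close; as [|v i * v j|] is at most half of
    [v i ^+ 2 + v j ^+ 2], the [q ^+ 2] errors sum to [q / q.+1] of the bound, for all [v] at
    once. *)
Lemma ddPhi_close (c : K) (x : 'cV[K]_q) (eta : K) : (forall i, 0 < x i 0) -> 0 < quad R x -> 0 < eta ->
  nbhs (c, x) [set z : K * 'cV[K]_q | [/\ forall i, 0 < z.2 i 0, 0 < quad R z.2 &
    forall v, `|ddPhi R z.1 z.2 v - ddPhi R c x v| <= eta * \sum_i v i 0 ^+ 2]].
Proof.
move=> x0 Q0 eta0.
have hc : z.1 @[z --> (c, x)] --> c by exact: cvg_fst.
have hx i : (z.2 : 'cV[K]_q) i 0 @[z --> (c, x)] --> x i 0.
  apply: (@cvg_comp _ _ _ (fun z : K * 'cV[K]_q => z.2) (fun y : 'cV[K]_q => y i 0)).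
    exact: cvg_snd.
  exact: coord_continuous.
have q0 : 0 < q.+1%:R :> K by [].
have FF : Filter (nbhs ((c, x) : K * 'cV[K]_q)) by exact: nbhs_filter.
have h : nbhs (c, x) [set z : K * 'cV[K]_q | forall i j, `|hent R z.1 z.2 i j - hent R c x i j| <= eta / q.+1%:R].
  apply: (@filter_forall _ _ (fun i (z : K * 'cV[K]_q) => forall j,
    `|hent R z.1 z.2 i j - hent R c x i j| <= eta / q.+1%:R) (nbhs (c, x)) _) => i.
  apply: (@filter_forall _ _ (fun j (z : K * 'cV[K]_q) =>
    `|hent R z.1 z.2 i j - hent R c x i j| <= eta / q.+1%:R) (nbhs (c, x)) _) => j.
  have /cvgrPdist_le := @cvg_hent K q R _ (nbhs (c, x)) FF (fun z : K * 'cV[K]_q => z.1) (fun z => z.2) c x hc hx x0 Q0 i j.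
  move=> /(_ (eta / q.+1%:R)); rewrite divr_gt0 // => /(_ isT).
  by apply: filterS => z; rewrite distrC.
have h2 : nbhs (c, x) [set z : K * 'cV[K]_q | forall i, 0 < z.2 i 0].
  apply: (@filter_forall _ _ (fun i (z : K * 'cV[K]_q) => 0 < z.2 i 0) (nbhs (c, x)) _) => i.
  exact: cvg_near_gt (hx i) (x0 i).
have h3 : nbhs (c, x) [set z : K * 'cV[K]_q | 0 < quad R z.2].
  exact: (cvg_near_gt FF (@cvg_quad K q R _ (nbhs (c, x)) FF (fun z : K * 'cV[K]_q => z.2) x hx) Q0).
near=> z; split; [by near: z|by near: z|].
move=> v; have hz : forall i j, `|hent R z.1 z.2 i j - hent R c x i j| <= eta / q.+1%:R by near: z.
rewrite !ddPhi_hent -sumrB; under eq_bigr do rewrite -sumrB.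
apply: (le_trans (ler_norm_sum _ _ _)).
apply: (@le_trans _ _ (\sum_i \sum_j (v i 0 ^+ 2 + v j 0 ^+ 2) / 2 * (eta / q.+1%:R))).
  apply: ler_sum => i _; apply: (le_trans (ler_norm_sum _ _ _)); apply: ler_sum => j _.
  rewrite -mulrBr normrM; apply: ler_pM => //.
  rewrite normrM -(real_normK (num_real (v i 0))) -(real_normK (num_real (v j 0))).
  have := sqr_ge0 (`|v i 0| - `|v j 0|); rewrite sqrrB -mulr_natl; lra.
under eq_bigr do rewrite -mulr_suml -mulr_suml big_split /= sumr_const card_ord.
rewrite -mulr_suml -mulr_suml big_split /= sumr_const card_ord sumrMnl.
set S := \sum_(i < q) _; have S0 : 0 <= S by apply: sumr_ge0 => i _; exact: sqr_ge0.
rewrite -mulr_natr (_ : _ * _ = eta * S * (q%:R / q.+1%:R)); last first.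
  by move: q.+1%:R q0 => z' z'0; field; rewrite gt_eqF.
by rewrite ler_piMr ?mulr_ge0 ?(ltW eta0) // ler_pdivrMr // mul1r ler_nat.
Unshelve. all: by end_near.
Qed.

End HessianForm.

Section MinLemmas.
Variable K : realType.
Lemma min_le_l (a b : K) : Num.min a b <= a. Proof. by rewrite ge_min lexx. Qed.
Lemma min_le_r (a b : K) : Num.min a b <= b. Proof. by rewrite ge_min lexx orbT. Qed.
End MinLemmas.

(** * Positive definite forms *)

Section PositiveForms.
Variable K : realType.

(** For a semidefinite form a vector with [quad A u = 0] is orthogonal to every [w], as in the
    Cauchy-Schwarz inequality, so it lies in the kernel of [A]. *)
Lemma posdef_psd d (A : 'M[K]_d) : A^T = A -> (forall u, 0 <= quad A u) ->
  \det A != 0 -> posdef A.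
Proof.
move=> As Ap dA; split=> // u u0; rewrite lt_neqAle Ap andbT; apply/eqP => qu.
have hb w : bil A u w = 0.
  have hq t : 0 <= t * (2 * bil A u w) + t * t * quad A w.
    by have := Ap (u + t *: w); rewrite (quad_line As) -qu add0r.
  have q0 := Ap w; have q1 : 0 < 1 + quad A w by rewrite ltr_wpDr.
  (* Almost the minimiser in [t] of the quadratic polynomial; the added 1 avoids division by 0 when
     [quad A w = 0]. *)
  have := hq (- bil A u w / (1 + quad A w)).
  rewrite (_ : _ + _ = - (bil A u w ^+ 2 * (2 + quad A w) / (1 + quad A w) ^+ 2)); last first.
    by field; rewrite gt_eqF.
  rewrite oppr_ge0 => h; apply/eqP; rewrite -sqrf_eq0 -[_ == 0]orbF.
  have : bil A u w ^+ 2 * (2 + quad A w) / (1 + quad A w) ^+ 2 == 0.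
    have h2 : 0 <= bil A u w ^+ 2 * (2 + quad A w).
      by rewrite mulr_ge0 ?sqr_ge0 // addr_ge0.
    by rewrite eq_le h /= divr_ge0 ?sqr_ge0.
  have q2 : 0 < 2 + quad A w by rewrite ltr_wpDr.
  by rewrite mulf_eq0 invr_eq0 (gt_eqF (exprn_gt0 2 q1)) orbF mulf_eq0 (gt_eqF q2).
have uA : A *m u = 0.
  apply/matrixP => i j; rewrite ord1 [RHS]mxE -(hb (delta_mx i 0)) /bil -{2}As -trmx_mul.
  by rewrite -colE !mxE.
have uu : A \in unitmx by rewrite unitmxE unitfE.
by move: u0; rewrite -[u](mulKmx uu) uA mulmx0 eqxx.
Qed.

Lemma sumsq_col d t (w : 'cV[K]_d) :
  \sum_i (col_mx (const_mx t) w : 'cV_(1 + d)) i 0 ^+ 2 = t ^+ 2 + \sum_i w i 0 ^+ 2.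
Proof.
rewrite big_split_ord /= big_ord1 col_mxEu mxE; congr (_ + _).
by apply: eq_bigr => i _; rewrite col_mxEd.
Qed.

Lemma posdef_coercive d (A : 'M[K]_d) : posdef A ->
  exists2 k : K, 0 < k & forall v : 'cV[K]_d, k * \sum_i v i 0 ^+ 2 <= quad A v.
Proof.
elim: d A => [|d IH] A hA.
  by exists 1 => // v; rewrite big_ord0 mulr0 /quad mxE big_ord0.
have [a0 hS] := @posdef_schur K d A hA.
have [k k0 hk] := IH _ hS.
pose b i := (pivot (A : 'M[K]_(1 + d)))^-1 * ursubmx (A : 'M[K]_(1 + d)) 0 i.
pose L := (\sum_i `|b i|) ^+ 2.
have L0 : 0 <= L by exact: sqr_ge0.
have L1 : 0 < 2 * L + 1 by rewrite ltr_wpDl // mulr_ge0.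
(* With [z] the shift in the completed square, [t ^+ 2 <= 2 * (t + z) ^+ 2 + 2 * z ^+ 2] and
   [z ^+ 2 <= L * S]; so half of the pivot pays for [t + z], and [2 * L + 1] shares of the minimum
   must fit into [k]. *)
exists (Num.min (pivot (A : 'M[K]_(1 + d)) / 2) (k / (2 * L + 1))).
  by rewrite lt_min !divr_gt0.
move=> v; set k' := Num.min _ _.
have k'0 : 0 < k' by rewrite lt_min !divr_gt0.
have k'1 : k' * 2 <= pivot (A : 'M[K]_(1 + d)) by rewrite -ler_pdivlMr // ge_min lexx.
have k'2 : k' * (2 * L + 1) <= k by rewrite -ler_pdivlMr // ge_min lexx orbT.
rewrite -(vsubmxK (v : 'cV[K]_(1 + d))).
rewrite (_ : usubmx (v : 'cV[K]_(1 + d)) = const_mx (usubmx (v : 'cV[K]_(1 + d)) 0 0)); last first.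
  by apply/matrixP => i j; rewrite [RHS]mxE !ord1.
move: (usubmx (v : 'cV[K]_(1 + d)) 0 0) (dsubmx (v : 'cV[K]_(1 + d))) => t w {v}.
rewrite (@quad_schur K d A) ?(gt_eqF a0) //; last exact: (proj1 hA).
rewrite [X in k' * X](_ : _ = t ^+ 2 + \sum_i w i 0 ^+ 2); last exact: sumsq_col.
set S := \sum_(i < d) _; have S0 : 0 <= S by apply: sumr_ge0 => i _; exact: sqr_ge0.
set z := _^-1 * _.
have hz : z ^+ 2 <= L * S.
  have zE : z = \sum_i b i * w i 0.
    by rewrite /z mxE mulr_sumr; apply: eq_bigr => i _; rewrite mulrA.
  have wS i : `|w i 0| <= Num.sqrt S.
    rewrite -sqrtr_sqr ler_sqrt // /S (bigD1 i) //= lerDl.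
    by apply: sumr_ge0 => j _; exact: sqr_ge0.
  rewrite -(real_normK (num_real z)) -(sqr_sqrtr S0) /L -exprMn.
  rewrite ler_sqr ?nnegrE ?mulr_ge0 ?sqrtr_ge0 ?sumr_ge0 //.
  rewrite zE (le_trans (ler_norm_sum _ _ _)) // mulr_suml; apply: ler_sum => i _.
  by rewrite normrM ler_wpM2l.
have h1 := hk w; rewrite -/S in h1.
have h2 := ler_wpM2r (sqr_ge0 (t + z)) k'1.
have h3 := ler_wpM2r S0 k'2.
have h4 := ler_wpM2l (ltW k'0) hz.
(* This square is the difference of the two sides of [t ^+ 2 <= 2 * (t + z) ^+ 2 + 2 * z ^+ 2]. *)
have h5 : 0 <= k' * (t + 2 * z) ^+ 2 by rewrite mulr_ge0 ?sqr_ge0 // ltW.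
by move: h1 h2 h3 h4 h5; rewrite !sqrrD; nra.
Qed.

End PositiveForms.

Section SumZero.
Variables (K : realType) (d : nat).

(** One concrete parametrization of the sum-zero hyperplane carries the whole analysis;
    [param_factor] transfers the result to [E]. *)
Definition E0 : 'M[K]_(d.+1, d) := \matrix_(i, j)
  (if i == widen_ord (leqnSn d) j then 1 else if i == ord_max then -1 else 0).

Definition top (v : 'cV[K]_d.+1) : 'cV[K]_d := rowsub (widen_ord (leqnSn d)) v.

Lemma E0_widen u j : (E0 *m u : 'cV_d.+1) (widen_ord (leqnSn d) j) 0 = u j 0.
Proof.
rewrite mxE (bigD1 j) //= mxE eqxx mul1r big1 ?addr0 // => k kj.
rewrite mxE ifF; last first.
  by apply/negbTE; apply: contra kj => /eqP /(congr1 val) /= e; apply/eqP/val_inj.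
rewrite ifF ?mul0r //; apply/eqP => /(congr1 val) /= e.
by have := ltn_ord j; rewrite e ltnn.
Qed.

Lemma E0_max u : (E0 *m u : 'cV_d.+1) ord_max 0 = - \sum_j u j 0.
Proof.
rewrite mxE -sumrN; apply: eq_bigr => j _; rewrite mxE ifF ?eqxx ?mulN1r //.
by apply/eqP => /(congr1 val) /= e; have := ltn_ord j; rewrite -e ltnn.
Qed.

Lemma E0_sum u : \sum_i (E0 *m u : 'cV_d.+1) i 0 = 0.
Proof.
by rewrite big_ord_recr /= E0_max; under eq_bigr do rewrite E0_widen; rewrite subrr.
Qed.

Lemma E0_top (v : 'cV[K]_d.+1) : \sum_i v i 0 = 0 -> E0 *m top v = v.
Proof.
rewrite big_ord_recr /= => /eqP; rewrite addr_eq0 => /eqP h.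
have w j : (E0 *m top v) (widen_ord (leqnSn d) j) 0 = v (widen_ord (leqnSn d) j) 0.
  by rewrite E0_widen mxE.
apply/matrixP => i j; rewrite ord1.
case: (unliftP ord_max i) => [k ->|->].
  have -> : lift ord_max k = widen_ord (leqnSn d) k.
    by apply/val_inj; rewrite /= /bump leqNgt ltn_ord.
  exact: w.
by rewrite E0_max; apply/eqP; rewrite eqr_oppLR -h; apply/eqP/eq_bigr => k _; rewrite mxE.
Qed.

End SumZero.

(** * First and second order conditions at a local minimum *)

Section LocalMinima.
Variables (K : realType) (d : nat) (R : 'M[K]_d.+1) (r : 'cV[K]_d.+1).
Hypothesis hRsym : R^T = R.
Hypothesis hQ : forall x, simplex_int x -> 0 < quad R x.
Implicit Types (c t : K) (x y v phi : 'cV[K]_d.+1).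

Definition tangent v := \sum_i v i 0 = 0.

Definition crit c x := forall v, tangent v -> dPhi R r c x v = 0.

Lemma grad_mul m (E : 'M[K]_(d.+1, m)) c x u :
  (((map_mx (@ln K) x)^T - (map_mx (@ln K) r)^T
     - (2 * c / quad R x) *: (x^T *m R)) *m E *m u) 0 0 = dPhi R r c x (E *m u).
Proof.
rewrite -mulmxA mulmxBl -scalemxAl; move: (E *m u) => v.
rewrite mxE [X in _ + X]mxE [X in _ - X]mxE -/(bil R x v); congr (_ - _).
by rewrite mxE; apply: eq_bigr => i _; rewrite !mxE mulrC.
Qed.

Lemma grad0P c x : grad_Phi R r (@E0 K d) c x = 0 <-> crit c x.
Proof.
split=> [h v v0|h].
  by rewrite -(E0_top v0) -grad_mul [X in X *m _]h mul0mx mxE.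
apply/matrixP => i j; rewrite ord1 [RHS]mxE.
have := h (E0 K d *m delta_mx j 0) (E0_sum _); rewrite -grad_mul => <-.
by rewrite -colE [RHS]mxE.
Qed.

Lemma quad_hess c x u : (forall i, 0 < x i 0) ->
  quad (hess_Phi R (@E0 K d) c x) u = ddPhi R c x (E0 K d *m u).
Proof.
move=> x0; rewrite -(quad_hmat hRsym) // /quad /hess_Phi -/(hmat R c x).
by rewrite trmx_mul !mulmxA.
Qed.

Lemma hess_sym c x : (hess_Phi R (@E0 K d) c x)^T = hess_Phi R (@E0 K d) c x.
Proof.
rewrite /hess_Phi -/(hmat R c x) !trmx_mul trmxK mulmxA.
by rewrite (hmat_sym hRsym).
Qed.

Lemma simplex_intW x : simplex_int x -> simplex x.
Proof. by move=> [h1 h2]; split=> // i; exact: ltW. Qed.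

Lemma segment_int x y t : simplex_int x -> simplex_int y -> 0 <= t <= 1 ->
  simplex_int (x + t *: (y - x)).
Proof.
move=> [x0 x1] [y0 y1] /andP[t0 t1]; split=> [i|].
  rewrite !mxE (_ : _ + _ = (1 - t) * x i 0 + t * y i 0); last by ring.
  have := x0 i; have := y0 i; case: (ltrP 0 t) => [tp y0' x0'|t0' _ x0'].
    by rewrite ltr_wpDl ?mulr_gt0 // mulr_ge0 ?subr_ge0 // ltW.
  have -> : t = 0 by apply/le_anti; rewrite t0 t0'.
  by rewrite subr0 mul0r addr0 mul1r.
under eq_bigr do rewrite !mxE.
by rewrite big_split /= -mulr_sumr sumrB x1 y1 subrr mulr0 addr0.
Qed.

Lemma tangentB x y : simplex x -> simplex y -> tangent (y - x).
Proof.
move=> [_ x1] [_ y1]; rewrite /tangent; under eq_bigr do rewrite !mxE.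
by rewrite sumrB x1 y1 subrr.
Qed.

Lemma Phi_taylor c x y : simplex_int x -> simplex_int y ->
  (forall m, (forall t, 0 <= t <= 1 -> m <= ddPhi R c (x + t *: (y - x)) (y - x)) ->
     dPhi R r c x (y - x) + m / 2 <= Phi R r c y - Phi R r c x) /\
  (forall m, (forall t, 0 <= t <= 1 -> ddPhi R c (x + t *: (y - x)) (y - x) <= m) ->
     Phi R r c y - Phi R r c x <= dPhi R r c x (y - x) + m / 2).
Proof.
move=> hx hy.
have v0 := tangentB (simplex_intW hx) (simplex_intW hy).
have hs t : 0 <= t <= 1 -> simplex_int (x + t *: (y - x)) by exact: segment_int.
have h1 t : 0 <= t <= 1 -> is_derive t 1 (fun t => Phi R r c (x + t *: (y - x)))
    (dPhi R r c (x + t *: (y - x)) (y - x)).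
  by move=> /hs h; apply: is_derive_Phi => //; [exact: (proj1 h)|exact: hQ].
have h2 t : 0 <= t <= 1 -> is_derive t 1 (fun t => dPhi R r c (x + t *: (y - x)) (y - x))
    (ddPhi R c (x + t *: (y - x)) (y - x)).
  by move=> /hs h; apply: is_derive_dPhi => //; [exact: (proj1 h)|exact: hQ].
split=> m hm; [have := taylor2_le h1 h2 hm|have := taylor2_ge h1 h2 hm];
  by rewrite scale1r scale0r addr0 [x + (y - x)]addrC subrK.
Qed.

Lemma fermat_Phi c x : simplex_int x ->
  (\forall y \near x, simplex y -> Phi R r c x <= Phi R r c y) -> crit c x.
Proof.
move=> hx /near_boxP [e e0 he] v v0.
have [x0 x1] := hx.
have hin : \forall t \near (0 : K), simplex_int (x + t *: v) /\ box e x (x + t *: v).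
  have hc i : (x i 0 + t * v i 0) @[t --> (0 : K)] --> x i 0.
    have h : (x i 0 + t * v i 0) @[t --> (0 : K)] --> x i 0 + 0 * v i 0.
      by apply: cvgD; [exact: cvg_cst|apply: cvgM; [exact: cvg_id|exact: cvg_cst]].
    by rewrite mul0r addr0 in h.
  have h1 : \forall t \near (0 : K), forall i, 0 < x i 0 + t * v i 0.
    apply: (@filter_forall _ _ (fun i (t : K) => 0 < x i 0 + t * v i 0) (nbhs (0 : K)) _) => i.
    exact: cvg_near_gt (hc i) (x0 i).
  have h2 : \forall t \near (0 : K), forall i, `|t * v i 0| < e.
    apply: (@filter_forall _ _ (fun i (t : K) => `|t * v i 0| < e) (nbhs (0 : K)) _) => i.
    have /cvgrPdistC_lt /(_ e e0) := hc i.
    by apply: filterS => t; rewrite addrAC subrr add0r.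
  near=> t; split; first split.
  - by move=> i; rewrite !mxE; move: i; near: t.
  - under eq_bigr do rewrite !mxE.
    by rewrite big_split /= -mulr_sumr v0 mulr0 addr0.
  - by move=> i; rewrite !mxE addrAC subrr add0r; move: i; near: t.
have /nbhs_ballP [s s0 hs] := hin.
have hs' t : t \in `]- s, s[%R -> simplex_int (x + t *: v) /\ box e x (x + t *: v).
  rewrite in_itv /= => /andP[h1 h2]; apply: hs.
  by rewrite /ball /= sub0r normrN ltr_norml h1.
pose f t := Phi R r c (x + t *: v).
have dfe t : t \in `]- s, s[%R -> is_derive t 1 f (dPhi R r c (x + t *: v) v).
  by move=> /hs' [h _]; apply: is_derive_Phi => //; [exact: (proj1 h)|exact: hQ].
have z : (0 : K) \in `]- s, s[%R by rewrite in_itv /= oppr_lt0 s0.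
have D0 : is_derive (0 : K) 1 f 0.
  apply: (@derive1_at_min K f (- s) s 0) => //.
  - by rewrite (@le_trans _ _ 0) ?oppr_le0 // ltW.
  - by move=> t /dfe h; case: h.
  - move=> t /hs' [h1 h2]; rewrite /f scale0r addr0; apply: he => //.
    exact: simplex_intW.
have D1 := dfe 0 z; rewrite scale0r addr0 in D1.
by rewrite -(@derive_val _ _ _ _ _ _ _ D1) (@derive_val _ _ _ _ _ _ _ D0).
Unshelve. all: by end_near.
Qed.

Lemma ddPhi_scale c x v t : ddPhi R c x (t *: v) = t ^+ 2 * ddPhi R c x v.
Proof.
rewrite !ddPhi_hent mulr_sumr; apply: eq_bigr => i _; rewrite mulr_sumr.
by apply: eq_bigr => j _; rewrite !mxE; ring.
Qed.

Lemma second_order c x : simplex_int x ->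
  (\forall y \near x, simplex y -> Phi R r c x <= Phi R r c y) ->
  forall v, tangent v -> 0 <= ddPhi R c x v.
Proof.
move=> hx hmin v v0; have hcr := fermat_Phi hx hmin.
have [x0 x1] := hx; rewrite leNgt; apply/negP => neg.
pose N := \sum_i v i 0 ^+ 2.
have N0 : 0 <= N by apply: sumr_ge0 => i _; exact: sqr_ge0.
(* Half of the negative curvature: continuity may cost up to [m], and the curvature along the
   segment is still at most [- m]. *)
pose m := - ddPhi R c x v / 2.
have m0 : 0 < m by rewrite divr_gt0 // oppr_gt0.
have /near_cboxP [e1 e10 h1] := @ddPhi_close K _ R c x (m / (N + 1)) x0 (hQ hx)
   (divr_gt0 m0 (ltr_wpDl N0 ltr01)).
have /near_boxP [e2 e20 h2] := hmin.
pose e := Num.min e1 e2.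
have e0 : 0 < e by rewrite lt_min e10.
(* Since [|v i 0| <= N + 1], this step keeps the segment inside the box of radius [e]. *)
pose t := e / (2 * (N + 1)).
have N1 : 0 < N + 1 by rewrite ltr_wpDl.
have t0 : 0 < t by rewrite divr_gt0 // mulr_gt0.
have bx s : 0 <= s <= 1 -> box e x (x + s *: (t *: v)).
  move=> /andP[s0 s1] i; rewrite !mxE addrAC subrr add0r normrM (ger0_norm s0).
  apply: (@le_lt_trans _ _ `|t * v i 0|); first by rewrite ler_piMl.
  rewrite normrM (gtr0_norm t0).
  have vN : `|v i 0| <= N + 1.
    have : v i 0 ^+ 2 <= N.
      by rewrite /N (bigD1 i) //= lerDl; apply: sumr_ge0 => j _; exact: sqr_ge0.
    rewrite -(real_normK (num_real (v i 0))).
    by have := sqr_ge0 (`|v i 0| - 1); rewrite sqrrB1 -mulr_natl; lra.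
  apply: (le_lt_trans (ler_wpM2l (ltW t0) vN)).
  rewrite /t invfM mulrA divfK ?gt_eqF // ltr_pdivrMr //.
  by rewrite mulr_natr mulr2n ltrDl.
have hy : simplex_int (x + t *: v).
  have b := bx 1; rewrite ler01 lexx scale1r in b.
  split=> [i|].
    have [|h _ _] := h1 c (x + t *: v) _ (box_le (min_le_l _ _) (b isT)).
    - by rewrite subrr normr0.
    - exact: h.
  under eq_bigr do rewrite !mxE.
  by rewrite big_split /= -mulr_sumr v0 mulr0 addr0.
have yx : x + t *: v - x = t *: v by rewrite addrAC subrr add0r.
have [_ /(_ (- m * t ^+ 2))] := Phi_taylor c hx hy.
rewrite yx hcr; last by rewrite /tangent; under eq_bigr do rewrite mxE; rewrite -mulr_sumr v0 mulr0.
have hb : forall s, 0 <= s <= 1 -> ddPhi R c (x + s *: (t *: v)) (t *: v) <= - m * t ^+ 2.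
  move=> s hs; rewrite ddPhi_scale mulrC ler_wpM2r ?sqr_ge0 //.
  have [|_ _ /(_ v)] := h1 c (x + s *: (t *: v)) _ (box_le (min_le_l _ _) (bx s hs)).
    by rewrite subrr normr0.
  have : m / (N + 1) * N <= m.
    by rewrite mulrAC ler_pdivrMr // ler_wpM2l ?(ltW m0) // lerDl.
  by rewrite -/N /= ler_norml => h3 /andP[_ h4]; rewrite /m in h3 h4 *; lra.
move=> /(_ hb).
have bt := bx 1; rewrite ler01 lexx scale1r in bt.
have := h2 (x + t *: v) (box_le (min_le_r _ _) (bt isT)) (simplex_intW hy).
have : 0 < m * t ^+ 2 by rewrite mulr_gt0 ?exprn_gt0.
lra.
Qed.

End LocalMinima.

(** * Persistence and covering of local minima *)

Section Compactness.
Variables (K : realType) (q : nat).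

Lemma closed_coords (P : 'I_q -> set K) : (forall i, closed (P i)) ->
  closed [set x : 'cV[K]_q | forall i, P i (x i 0)].
Proof.
move=> hP.
rewrite (_ : [set x : 'cV[K]_q | _] =
    \bigcap_(i in [set: 'I_q]) ((fun x : 'cV[K]_q => x i 0) @^-1` P i)).
  apply: closed_bigI => i _; apply: preimage_closed => // x _.
  exact: coord_continuous.
by apply/seteqP; split=> [x h i _|x h i]; [exact: h|exact: (h i I)].
Qed.

Lemma closed_simplex : closed (@simplex K q).
Proof.
apply: closedI; first exact: (closed_coords (fun=> @closed_ge K 0)).
apply: (@preimage_closed _ _ (fun x : 'cV[K]_q => \sum_i x i 0) [set t | t = 1]).
  move=> x _; apply: (@cvg_sum_ord K _ (nbhs x) _ q (fun i (y : 'cV[K]_q) => y i 0)) => i.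
  exact: coord_continuous.
exact: closed_eq.
Qed.

Lemma simplex_le1 (x : 'cV[K]_q) i : simplex x -> x i 0 <= 1.
Proof.
by move=> [h <-]; rewrite (bigD1 i) //= lerDl; apply: sumr_ge0.
Qed.

Lemma compact_simplex : compact (@simplex K q).
Proof.
(* Heine-Borel is applied to row vectors and the result transported by transposition. *)
have -> : @simplex K q = trmx @` [set y : 'rV[K]_q | simplex y^T].
  apply/seteqP; split=> [x hx|_ [y hy <-] //].
  by exists x^T; rewrite /= ?trmxK.
have ct (m n : nat) : continuous (@trmx K m n).
  move=> y A /nbhs_ballP [e e0 h]; apply/nbhs_ballP; exists e => // z [_ hz].
  by apply: h; split=> // i j; rewrite !mxE; exact: hz.
apply: continuous_compact; first by apply: continuous_subspaceT; exact: ct.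
apply: bounded_closed_compact.
  exists 1; split; first exact: num_real.
  move=> M M1 y hy /=; rewrite [leLHS]/Num.norm /= mx_normrE.
  apply/bigmax_leP; split=> [|[i j] _ /=]; first by rewrite (le_trans ler01 (ltW M1)).
  have := simplex_le1 j hy; have [h _] := hy; have := h j; rewrite mxE ord1 => y0 y1.
  by rewrite ger0_norm // (le_trans y1) // ltW.
apply: (@preimage_closed _ _ (@trmx K 1 q) (@simplex K q)); last exact: closed_simplex.
by move=> x _; exact: ct.
Qed.

End Compactness.

Lemma convex_lt (K : realType) (a b e t : K) : a < e -> b < e -> 0 <= t <= 1 ->
  (1 - t) * a + t * b < e.
Proof.
move=> ae be /andP[t0 t1].
have [->|tn] := eqVneq t 0; first by rewrite subr0 mul1r mul0r addr0.
have h1 : t * b < t * e by rewrite ltr_pM2l // lt_neqAle eq_sym tn.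
have h2 : (1 - t) * a <= (1 - t) * e by rewrite ler_wpM2l ?subr_ge0 // ltW.
lra.
Qed.

Section LocalStructure.
Variables (K : realType) (d : nat) (R : 'M[K]_d.+1) (r : 'cV[K]_d.+1).
Hypothesis hRsym : R^T = R.
Hypothesis hQ : forall x, simplex_int x -> 0 < quad R x.
Implicit Types (c t : K) (x y v phi : 'cV[K]_d.+1).

Let H c x := hess_Phi R (@E0 K d) c x.
Let LM c := local_minima R r (@E0 K d) c.

Lemma LM_posdef c phi : LM c phi -> \det (H c phi) != 0 -> posdef (H c phi).
Proof.
move=> [h1 _ h3] hd; apply: posdef_psd => // [|u]; first exact: hess_sym.
rewrite quad_hess //; last exact: (proj1 h1).
by apply: (second_order hRsym hQ h1 h3); exact: E0_sum.
Qed.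

Lemma hess_coercive c phi : simplex_int phi -> posdef (H c phi) ->
  exists2 k : K, 0 < k & forall v, tangent v -> k * \sum_i v i 0 ^+ 2 <= ddPhi R c phi v.
Proof.
move=> [p0 _] /posdef_coercive [k k0 hk].
(* The last coordinate of [v] is minus the sum of the others, so its square is at most [d ^+ 2]
   times their sum of squares. *)
pose D := 1 + d%:R ^+ 2 : K.
have D0 : 0 < D by rewrite ltr_pwDl // sqr_ge0.
exists (k / D); first by rewrite divr_gt0.
move=> v v0; rewrite -(E0_top v0) -(quad_hess hRsym) //; apply: le_trans (hk _).
rewrite mulrAC ler_pdivrMr // -mulrA ler_pM2l //.
move: (top v) => u; rewrite big_ord_recr /= E0_max.
under eq_bigr do rewrite E0_widen.
rewrite mulrDr mulr1 lerD2l sqrrN.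
set S := \sum_(i < d) u i 0 ^+ 2.
have S0 : 0 <= S by apply: sumr_ge0 => i _; exact: sqr_ge0.
rewrite -(real_normK (num_real _)) -{1}(sqr_sqrtr S0) mulrC -exprMn.
rewrite ler_sqr ?nnegrE ?mulr_ge0 ?sqrtr_ge0 //.
apply: (le_trans (ler_norm_sum _ _ _)).
apply: (@le_trans _ _ (\sum_(i < d) Num.sqrt S)); last first.
  by rewrite sumr_const card_ord mulr_natl.
apply: ler_sum => i _; rewrite -sqrtr_sqr ler_sqrt // /S (bigD1 i) //= lerDl.
by apply: sumr_ge0 => j _; exact: sqr_ge0.
Qed.

(** Comparing all nearby forms with the one at [(c, phi)] by factors lets a single Gaussian serve
    every [c'] and every local minimum close to [phi]. *)
Definition sandwich c phi kappa e := forall c' x, `|c' - c| < e -> box e phi x ->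
  [/\ forall i, 0 < x i 0, 0 < quad R x &
    forall v, tangent v -> kappa^-1 * ddPhi R c phi v <= ddPhi R c' x v <= kappa * ddPhi R c phi v].

(** Coercivity turns the additive error of [ddPhi_close] into a relative one;
    [1 - kappa^-1 <= kappa - 1] covers the upper side. *)
Lemma local_sandwich c phi kappa : simplex_int phi -> posdef (H c phi) -> 1 < kappa ->
  exists2 e : K, 0 < e & sandwich c phi kappa e.
Proof.
move=> hp hpd k1; have [k k0 hk] := hess_coercive hp hpd.
have kp : 0 < kappa by apply: lt_trans k1.
have ki : kappa^-1 < 1 by rewrite invf_lt1.
have eta0 : 0 < k * (1 - kappa^-1) by rewrite mulr_gt0 // subr_gt0.
have /near_cboxP [e e0 he] := @ddPhi_close K _ R c phi _ (proj1 hp) (hQ hp) eta0.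
exists e => // c' x hc hx; have [h1 h2 h3] := he c' x hc hx; split=> // v v0.
have := h3 v; rewrite /= ler_norml; have := hk v v0.
set B := ddPhi _ _ phi v; set S := \sum_i _ => hB.
have S0 : 0 <= S by apply: sumr_ge0 => i _; exact: sqr_ge0.
have h4 : k * (1 - kappa^-1) * S <= (1 - kappa^-1) * B.
  by rewrite [k * _]mulrC -mulrA ler_wpM2l // subr_ge0 ltW.
have B0 : 0 <= B by apply: le_trans hB; rewrite mulr_ge0 // ltW.
have h5 : (1 - kappa^-1) * B <= (kappa - 1) * B.
  apply: ler_wpM2r => //; rewrite -subr_ge0.
  rewrite (_ : _ - _ = (kappa - 1) ^+ 2 / kappa); first by rewrite divr_ge0 ?sqr_ge0 // ltW.
  by field; rewrite gt_eqF.
by move=> /andP[h6 h7]; apply/andP; split; lra.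
Qed.

Lemma box_segment e phi x y t : box e phi x -> box e phi y -> 0 <= t <= 1 ->
  box e phi (x + t *: (y - x)).
Proof.
move=> hx hy /andP[t0 t1] i; rewrite !mxE.
rewrite (_ : _ - _ = (1 - t) * (x i 0 - phi i 0) + t * (y i 0 - phi i 0)); last by ring.
have := hx i; have := hy i; rewrite !ltr_norml => /andP[h1 h2] /andP[h3 h4].
have t01 : 0 <= t <= 1 by rewrite t0.
rewrite (convex_lt h4 h2 t01) andbT ltrNl.
have := @convex_lt K (- (x i 0 - phi i 0)) (- (y i 0 - phi i 0)) e t.
rewrite ![- _ < e]ltrNl => /(_ h3 h1 t01); lra.
Qed.

(** The expansion is around the critical point [x] for [c'], where the linear term vanishes, while
    the quadratic form remains that of [(c, phi)]. *)
Lemma sandwich_Phi c phi kappa e c' x y : sandwich c phi kappa e -> `|c' - c| < e ->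
  box e phi x -> box e phi y -> simplex_int x -> simplex_int y -> crit R r c' x ->
  kappa^-1 * ddPhi R c phi (y - x) / 2 <= Phi R r c' y - Phi R r c' x
   <= kappa * ddPhi R c phi (y - x) / 2.
Proof.
move=> hs hc bx by_ hx hy hcr.
have v0 := tangentB (simplex_intW hx) (simplex_intW hy).
have [h1 h2] := Phi_taylor r hRsym hQ c' hx hy.
have hb t : 0 <= t <= 1 -> kappa^-1 * ddPhi R c phi (y - x) <=
   ddPhi R c' (x + t *: (y - x)) (y - x) <= kappa * ddPhi R c phi (y - x).
  by move=> ht; have [_ _ ->] := hs c' (x + t *: (y - x)) hc (box_segment bx by_ ht).
have := h1 (kappa^-1 * ddPhi R c phi (y - x)); have := h2 (kappa * ddPhi R c phi (y - x)).
rewrite !hcr // !add0r => h3 h4; rewrite h4 ?h3 // => t /hb /andP[] //.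
Qed.

Lemma sandwich_int c phi kappa e x : 0 < e -> sandwich c phi kappa e -> box e phi x ->
  simplex x -> simplex_int x.
Proof.
move=> e0 hs hx [_ x1]; split=> //; have [|h _ _] := hs c x _ hx; last exact: h.
by rewrite subrr normr0.
Qed.

Lemma tangent_ddPhi_gt0 c phi v : simplex_int phi -> posdef (H c phi) -> tangent v ->
  v != 0 -> 0 < ddPhi R c phi v.
Proof.
move=> hp [_ hpd] v0 vn; rewrite -(E0_top v0) -(quad_hess hRsym); last exact: (proj1 hp).
apply: hpd; apply: contra vn => /eqP e; apply/eqP.
by rewrite -(E0_top v0) e mulmx0.
Qed.

Lemma crit_LM c phi : simplex_int phi -> crit R r c phi -> posdef (H c phi) -> LM c phi.
Proof.
move=> hp hc hpd; split=> //; first exact/grad0P.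
have [e e0 hs] := local_sandwich hp hpd (ltr1n K 2 : 1 < 2).
apply/near_boxP; exists e => // x hx sx.
have sxi := sandwich_int e0 hs hx sx.
have bp : box e phi phi by move=> i; rewrite subrr normr0.
have c0 : `|c - c| < e by rewrite subrr normr0.
have /andP[h _] := sandwich_Phi hs c0 bp hx hp sxi hc.
rewrite -subr_ge0; apply: le_trans h; rewrite divr_ge0 // mulr_ge0 ?invr_ge0 //.
have [->|vn] := eqVneq (x - phi) 0.
  by have := ddPhi_scale R c phi phi 0; rewrite scale0r expr0n mul0r => ->.
by apply/ltW/tangent_ddPhi_gt0 => //; apply: tangentB => //; exact: simplex_intW.
Qed.

(** Applied at both points, the lower bound of the sandwich would make each of two distinct critical
    values smaller than the other. *)
Lemma LM_unique c phi kappa e c' x y : 0 < kappa -> simplex_int phi -> posdef (H c phi) ->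
  sandwich c phi kappa e -> `|c' - c| < e ->
  box e phi x -> box e phi y -> LM c' x -> LM c' y -> x = y.
Proof.
move=> k0 hp hpd hs hc bx by_ [hx /grad0P cx _] [hy /grad0P cy _].
apply/eqP; rewrite -subr_eq0; apply/eqP; apply: contrapT => /eqP vn.
have /andP[h1 _] := sandwich_Phi hs hc bx by_ hx hy cx.
have /andP[h2 _] := sandwich_Phi hs hc by_ bx hy hx cy.
have ki : 0 < kappa^-1 by rewrite invr_gt0.
have p1 : 0 < kappa^-1 * ddPhi R c phi (x - y).
  by rewrite mulr_gt0 // tangent_ddPhi_gt0 //; apply: tangentB; exact: simplex_intW.
have p2 : 0 < kappa^-1 * ddPhi R c phi (y - x).
  rewrite mulr_gt0 // tangent_ddPhi_gt0 //; first by apply: tangentB; exact: simplex_intW.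
  by rewrite -opprB oppr_eq0.
by lra.
Qed.

(** A minimiser for [c'] over a closed box around [phi] exists by compactness. On the faces [Phi] at
    [c] exceeds its value at [phi] by a fixed amount, which a small change of [c] cannot undo, so
    the minimiser lies inside. *)
Lemma LM_exists c phi (e' : K) : LM c phi -> \det (H c phi) != 0 -> 0 < e' ->
  \forall c' \near c, exists2 x, LM c' x & box e' phi x.
Proof.
move=> hLM hdet e'0; have hpd := LM_posdef hLM hdet; have [hp /grad0P hcr _] := hLM.
have [e1 e10 hs] := local_sandwich hp hpd (ltr1n K 2 : 1 < 2).
have [k k0 hk] := hess_coercive hp hpd.
have hlnQ : \forall x \near phi, `|ln (quad R x)| <= `|ln (quad R phi)| + 1.
  have : ln (quad R x) @[x --> phi] --> ln (quad R phi).
    apply: (@cvg_ln_comp K _ (nbhs phi) _ (fun x => quad R x) _ (hQ hp)).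
    apply: (@cvg_quad K d.+1 R _ (nbhs phi) _ (fun x => x)) => i; exact: coord_continuous.
  move/cvgrPdistC_le => /(_ 1 ltr01); apply: filterS => x h.
  rewrite -[X in `|X| <= _](subrK (ln (quad R phi))) addrC.
  by apply: (le_trans (ler_normD _ _)); rewrite lerD2l.
have /near_boxP [e2 e20 h2] := hlnQ.
pose e := Num.min e' (Num.min e1 e2) / 2.
have e0 : 0 < e by rewrite divr_gt0 // !lt_min e'0 e10.
have eb x : (forall i, `|x i 0 - phi i 0| <= e) -> [/\ box e' phi x, box e1 phi x & box e2 phi x].
  have he : e < Num.min e' (Num.min e1 e2).
    by rewrite /e ltr_pdivrMr // mulr_natr mulr2n ltrDl !lt_min e'0 e10.
  move=> h; split=> i; apply: le_lt_trans (h i) (lt_le_trans he _).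
  - exact: min_le_l.
  - exact: le_trans (min_le_r _ _) (min_le_l _ _).
  - exact: le_trans (min_le_r _ _) (min_le_r _ _).
pose A := [set x : 'cV[K]_d.+1 | forall i, `|x i 0 - phi i 0| <= e] `&` @simplex K d.+1.
have Ap : A phi.
  by split; [move=> i; rewrite subrr normr0 ltW|exact: simplex_intW].
have Ai x : A x -> simplex_int x.
  by move=> [hx sx]; have [_ b _] := eb x hx; exact: sandwich_int hs b sx.
have cA : compact A.
  apply: subclosed_compact (@compact_simplex K d.+1) _; last by move=> x [].
  apply: closedI; last exact: closed_simplex.
  apply: (@closed_coords K d.+1 (fun i => [set t | `|t - phi i 0| <= e])) => i.
  apply: (@preimage_closed _ _ (fun t : K => `|t - phi i 0|) [set s | s <= e]).
    move=> t _; apply: cvg_norm; apply: cvgB; [exact: cvg_id|exact: cvg_cst].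
  exact: closed_le.
(* On the faces the sandwich with factor 2 gives a height of at least [k * e ^+ 2 / 4], twice [m],
   while passing from [c] to [c'] changes each of the two values by less than [m / 2]. *)
pose m := k * e ^+ 2 / 8.
have m0 : 0 < m by rewrite divr_gt0 // mulr_gt0 // exprn_gt0.
pose M := `|ln (quad R phi)| + 1.
have M0 : 0 < M by rewrite ltr_wpDl.
have hc1 : \forall c' \near c, `|c' - c| < e1.
  apply/nbhs_ballP; exists e1 => // c'; by rewrite /ball /= distrC.
have hc2 : \forall c' \near c, `|c' - c| < m / M / 2.
  apply/nbhs_ballP; exists (m / M / 2) => [|c']; last by rewrite /ball /= distrC.
  by rewrite /= divr_gt0 // divr_gt0.
near=> c'.
have c1 : `|c' - c| < e1 by near: c'.
have c2 : `|c' - c| < m / M / 2 by near: c'.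
have [x Ax hmin] : exists2 x, x \in A & forall y, y \in A -> Phi R r c' x <= Phi R r c' y.
  apply: compact_EVT_min => //; first by exists phi.
  apply: continuous_in_subspaceT => x; rewrite inE => hx.
  have [x0 _] := Ai x hx.
  apply: (@cvg_Phi K d.+1 R r _ (nbhs x) _ (fun=> c') (fun y => y)) => //.
  - exact: cvg_cst.
  - by move=> i; exact: coord_continuous.
  - by apply: hQ; exact: Ai.
rewrite inE in Ax; have [xb xs] := Ax; have xi := Ai x Ax.
have [b1 b2 b3] := eb x xb.
have dPhi_c y : box e2 phi y -> `|Phi R r c' y - Phi R r c y| <= `|c' - c| * M.
  move=> hy; rewrite (_ : _ - _ = - ((c' - c) * ln (quad R y))); last by rewrite /Phi; ring.
  by rewrite normrN normrM ler_wpM2l //; exact: h2.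
have xin i : `|x i 0 - phi i 0| < e.
  rewrite lt_neqAle xb andbT; apply/eqP => eqe.
  have bp : box e1 phi phi by move=> j; rewrite subrr normr0.
  have bp2 : box e2 phi phi by move=> j; rewrite subrr normr0.
  have cc : `|c - c| < e1 by rewrite subrr normr0.
  have /andP[h _] := sandwich_Phi hs cc bp b2 hp xi hcr.
  have h4 := hk _ (tangentB (simplex_intW hp) xs).
  have h5 : e ^+ 2 <= \sum_j (x - phi) j 0 ^+ 2.
    rewrite (bigD1 i) //= mxE mxE -eqe real_normK ?num_real // lerDl.
    by apply: sumr_ge0 => j _; exact: sqr_ge0.
  have h6 := ler_wpM2l (ltW k0) h5.
  have := dPhi_c _ b3; have := dPhi_c _ bp2; rewrite !ler_norml => /andP[h7 h8] /andP[h9 h10].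
  have := hmin phi; rewrite inE => /(_ Ap) h11.
  have : `|c' - c| * M < m / 2 by rewrite -ltr_pdivlMr // mulrAC.
  have : 0 < m by []. move: h h4 h6 h7 h8 h9 h10 h11; rewrite /m; lra.
have near_min : \forall y \near x, simplex y -> Phi R r c' x <= Phi R r c' y.
  have : \forall y \near x, box e phi y.
    apply: (@filter_forall _ _ (fun i (y : 'cV[K]_d.+1) => `|y i 0 - phi i 0| < e) (nbhs x) _) => i.
    apply: cvg_near_lt (xin i); apply: cvg_norm.
    by apply: cvgB; [exact: coord_continuous|exact: cvg_cst].
  apply: filterS => y hy sy; apply: hmin; rewrite inE; split=> // i; exact: ltW.
exists x => //; split=> //.
  apply/grad0P; apply: (fermat_Phi hRsym hQ) => //.
Unshelve. all: by end_near.
Qed.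

End LocalStructure.

Lemma seq_argmax (K : realType) (T : eqType) (f : T -> K) (s : seq T) : s != [::] ->
  exists2 x, x \in s & forall y, y \in s -> f y <= f x.
Proof.
elim: s => // a s IH _; case: (eqVneq s [::]) => [->|/IH [b bs hb]].
  by exists a => [|y]; rewrite ?inE // => /eqP ->.
case: (lerP (f a) (f b)) => ab.
  exists b => [|y]; first by rewrite inE bs orbT.
  by rewrite inE => /orP[/eqP -> //|]; exact: hb.
exists a => [|y]; first by rewrite inE eqxx.
by rewrite inE => /orP[/eqP -> //|/hb h]; exact: le_trans h (ltW ab).
Qed.

(* Near-covering along growing finite lists turns compactness into the existence
   of a finite subcover. *)
Definition growing (T : eqType) : set_system (seq T) :=
  [set P : set (seq T) | exists L0 : seq T, forall L : seq T, {subset L0 <= L} -> P L].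

Lemma growing_filter (T : eqType) : Filter (@growing T).
Proof.
split.
- by exists [::].
- move=> P Q [L1 h1] [L2 h2]; exists (L1 ++ L2) => L hL; split.
    by apply: h1 => x xL; apply: hL; rewrite mem_cat xL.
  by apply: h2 => x xL; apply: hL; rewrite mem_cat xL orbT.
- by move=> P Q PQ [L0 h]; exists L0 => L /h; exact: PQ.
Qed.

Lemma cvg_compK (K : realType) T (F : set_system T) (f : T -> K) (g : K -> K) (a b : K) :
  f t @[t --> F] --> a -> g s @[s --> a] --> b -> g (f t) @[t --> F] --> b.
Proof. exact: cvg_comp. Qed.

(** * Global maxima of [Psi], the boundary of the simplex, and the finite cover *)

Section GlobalMax.
Variables (K : realType) (d : nat) (R : 'M[K]_d.+1) (r : 'cV[K]_d.+1).
Hypothesis hRsym : R^T = R.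
Hypothesis hRge0 : forall i j, 0 <= R i j.
Hypothesis hr : forall i, 0 < r i 0.
Hypothesis hQ : forall x, simplex_int x -> 0 < quad R x.
Implicit Types (c t : K) (x y v phi : 'cV[K]_d.+1).

Let LM c := local_minima R r (@E0 K d) c.

Definition ent x : K := \sum_i x i 0 * (ln (x i 0) - ln (r i 0)).

(* [exp (- Phi)], with the value [0] (or [1 * exp (- ent)] when [c = 0]) where
   the quadratic form vanishes. *)
Definition Psi c x : K := expR (- ent x) * quad R x `^ c.

Lemma PsiE c x : 0 < quad R x -> Psi c x = expR (- Phi R r c x).
Proof. by move=> q0; rewrite /Psi /powR gt_eqF // -expRD /Phi opprB addrC. Qed.

Lemma Psi_ge0 c x : 0 <= Psi c x.
Proof. by rewrite mulr_ge0 ?expR_ge0 ?powR_ge0. Qed.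

Lemma quad_ge0 x : simplex x -> 0 <= quad R x.
Proof.
move=> [x0 _]; rewrite quadE; apply: sumr_ge0 => i _; apply: sumr_ge0 => j _.
by rewrite !mulr_ge0.
Qed.

(** From [ln y < y] at [y = 1 / sqrt t]. Nonpositive [t] are included by [ln t = 0], which makes the
    limit of [t * ln t] at 0 two-sided. *)
Lemma norm_xlnx_le (t : K) : t <= 1 -> `|t * ln t| <= 2 * Num.sqrt t.
Proof.
move=> t1; have [t0|t0] := lerP t 0.
  by rewrite ln0 // mulr0 normr0 mulr_ge0 ?sqrtr_ge0.
have s0 : 0 < Num.sqrt t by rewrite sqrtr_gt0.
have l0 : ln t <= 0 by exact: ln_le0.
have := ln_sublinear (_ : 0 < (Num.sqrt t)^-1); rewrite invr_gt0 => /(_ s0).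
rewrite lnV ?posrE // => h.
have e : ln t = 2 * ln (Num.sqrt t) by rewrite -{1}(sqr_sqrtr (ltW t0)) expr2 lnM ?posrE //; ring.
rewrite normrM (gtr0_norm t0) ler0_norm // e.
rewrite -{1}(sqr_sqrtr (ltW t0)) expr2.
move: h; rewrite -(ltr_pM2l s0) mulfV ?gt_eqF // => h.
have := ler_wpM2l (ltW s0) (ltW h).
by move: (Num.sqrt t) (ln _) => a b; lra.
Qed.

Lemma cvg_xlnx (s : K) : 0 <= s -> t * ln t @[t --> s] --> s * ln s.
Proof.
rewrite le_eqVlt => /orP[/eqP <-|s0]; last first.
  by apply: cvgM; [exact: cvg_id|exact: continuous_ln].
rewrite mul0r; apply/cvgrPdist_le => e e0.
have e20 : 0 < (e / 2) ^+ 2 by rewrite exprn_gt0 // divr_gt0.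
near=> t; rewrite sub0r normrN.
have t1 : t < 1 by near: t; exact: (cvg_near_lt _ (@cvg_id _ (nbhs (0 : K))) ltr01).
have t2 : t < (e / 2) ^+ 2 by near: t; exact: (cvg_near_lt _ (@cvg_id _ (nbhs (0 : K))) e20).
apply: (le_trans (norm_xlnx_le (ltW t1))).
have e2 : 0 < e / 2 by rewrite divr_gt0.
rewrite mulrC -ler_pdivlMr // -[leRHS]gtr0_norm // -sqrtr_sqr.
by rewrite ler_sqrt ?(ltW t2) // ltW.
Unshelve. all: by end_near.
Qed.

Lemma cvg_ent T (F : set_system T) (FF : Filter F) (x_ : T -> 'cV[K]_d.+1) x :
  simplex x -> (forall i, x_ t i 0 @[t --> F] --> x i 0) -> ent (x_ t) @[t --> F] --> ent x.
Proof.
move=> [x0 _] hx; apply: cvg_sum_ord => i.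
under eq_fun do rewrite mulrBr; rewrite mulrBr.
apply: cvgB; last by apply: cvgM => //; exact: cvg_cst.
exact: (cvg_compK (hx i) (cvg_xlnx (x0 i))).
Qed.

Lemma powR_le1 (s c : K) : 0 <= s <= 1 -> 0 <= c -> s `^ c <= 1.
Proof.
move=> /andP[s0 s1] c0; rewrite /powR; case: ifP => _.
  by case: (c == 0).
by rewrite -[leRHS]expR0 ler_expR mulr_ge0_le0 // ln_le0.
Qed.

(** Continuity can fail where [c = 0] and the form vanishes: there the power is 1, but it is 0 at
    the same point for positive exponents. From above it is bounded by 1, and that gives the
    inequality. *)
Lemma Psi_usc c x (M : K) : 0 <= c -> simplex x -> Psi c x < M ->
  nbhs (c, x) [set z : K * 'cV[K]_d.+1 | 0 <= z.1 -> simplex z.2 -> Psi z.1 z.2 < M].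
Proof.
move=> c0 sx hM.
have FF : Filter (nbhs ((c, x) : K * 'cV[K]_d.+1)) by exact: nbhs_filter.
have hc : z.1 @[z --> (c, x)] --> c by exact: cvg_fst.
have hx i : (z.2 : 'cV[K]_d.+1) i 0 @[z --> (c, x)] --> x i 0.
  apply: (@cvg_comp _ _ _ (fun z : K * 'cV[K]_d.+1 => z.2) (fun y : 'cV[K]_d.+1 => y i 0)).
    exact: cvg_snd.
  exact: coord_continuous.
have hq : quad R (z.2 : 'cV[K]_d.+1) @[z --> (c, x)] --> quad R x.
  exact: (@cvg_quad K d.+1 R _ (nbhs (c, x)) FF (fun z : K * 'cV[K]_d.+1 => z.2) x hx).
have he : expR (- ent (z.2 : 'cV[K]_d.+1)) @[z --> (c, x)] --> expR (- ent x).
  have h : - ent (z.2 : 'cV[K]_d.+1) @[z --> (c, x)] --> - ent x.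
    by apply: cvgN; exact: (@cvg_ent _ (nbhs (c, x)) FF (fun z : K * 'cV[K]_d.+1 => z.2)).
  exact: (cvg_compK h (@continuous_expR K _)).
have := quad_ge0 sx; rewrite le_eqVlt => /orP[/eqP q0|q0]; last first.
  have h1 : expR (- ent (z.2 : 'cV[K]_d.+1)) * expR (z.1 * ln (quad R z.2)) @[z --> (c, x)]
      --> expR (- ent x) * expR (c * ln (quad R x)).
    apply: cvgM => //.
    have h : z.1 * ln (quad R (z.2 : 'cV[K]_d.+1)) @[z --> (c, x)] --> c * ln (quad R x).
      by apply: cvgM => //; exact: (@cvg_ln_comp K _ (nbhs (c, x)) FF (fun z : K * 'cV[K]_d.+1 => quad R z.2) _ q0 hq).
    exact: (cvg_compK h (@continuous_expR K _)).
  have hM' : expR (- ent x) * expR (c * ln (quad R x)) < M.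
    by move: hM; rewrite /Psi /powR gt_eqF.
  have := cvg_near_lt FF h1 hM'; have := cvg_near_gt FF hq q0.
  apply: filterS2 => z /= z1 z2 _ _.
  by rewrite /Psi /powR gt_eqF.
have [c00|cn0] := eqVneq c 0.
  have hM' : expR (- ent x) < M by move: hM; rewrite /Psi c00 powRr0 mulr1.
  have q1 : quad R x < 1 by rewrite -q0.
  have := cvg_near_lt FF he hM'; have := cvg_near_lt FF hq q1.
  apply: filterS2 => z /= z1 z2 z3 z4; apply: le_lt_trans z2.
  rewrite ler_piMr ?expR_ge0 // powR_le1 // quad_ge0 //=; exact: ltW.
have cp : 0 < c by rewrite lt_neqAle eq_sym cn0.
have M0 : 0 < M by move: hM; rewrite /Psi -q0 powR0 // mulr0.
pose B := expR (- ent x) + 1.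
have B0 : 0 < B by rewrite addr_gt0 ?expR_gt0.
pose mu := Num.min (M / B) 1.
have mu0 : 0 < mu by rewrite lt_min divr_gt0 // ltr01.
have mu1 : mu <= 1 by exact: min_le_r.
(* The [c / 2]-th power of [delta] is [mu]; so for exponents above [c / 2] a form value below
   [delta] has a power below [mu], and [B * mu <= M]. *)
pose delta := expR (2 / c * ln mu).
have hB : expR (- ent x) < B by rewrite ltrDl.
have hd : quad R x < delta by rewrite -q0 expR_gt0.
have hc2 : c / 2 < c by rewrite ltr_pdivrMr // mulr_natr mulr2n ltrDl.
have := cvg_near_lt FF he hB; have := cvg_near_lt FF hq hd; have := cvg_near_gt FF hc hc2.
apply: filterS3 => z /= z1 z2 z3 z4 z5.
have z10 : 0 < z.1 by apply: lt_trans z1; rewrite divr_gt0.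
rewrite /Psi /powR; case: ifP => [_|qz].
  by rewrite (gt_eqF z10) mulr0.
have qz0 : 0 < quad R z.2 by rewrite lt_neqAle quad_ge0 // eq_sym qz.
have : expR (z.1 * ln (quad R z.2)) < mu.
  rewrite -[mu]lnK ?posrE // ltr_expR.
  have l1 : ln (quad R z.2) < 2 / c * ln mu by rewrite -ltr_expR lnK ?posrE.
  have l2 : ln mu <= 0 by exact: ln_le0.
  have l3 : ln (quad R z.2) <= 0.
    apply: (le_trans (ltW l1)); rewrite mulr_ge0_le0 // divr_ge0 // ltW.
  have l4 : c / 2 * ln (quad R z.2) < ln mu.
    rewrite -ltr_pdivlMl ?divr_gt0 // invf_div //.
  apply: le_lt_trans l4; apply: ler_wnM2r => //; exact: ltW.
move=> h; apply: (@lt_le_trans _ _ (B * mu)).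
  by apply: ltr_pM => //; exact: expR_ge0.
by rewrite mulrC -ler_pdivlMr //; exact: min_le_l.
Qed.

Definition barycenter : 'cV[K]_d.+1 := const_mx (d.+1%:R^-1).

Lemma barycenter_int : simplex_int barycenter.
Proof.
split=> [i|]; first by rewrite mxE invr_gt0.
by under eq_bigr do rewrite mxE; rewrite sumr_const card_ord -[LHS]mulr_natr mulVf ?pnatr_eq0.
Qed.

(** If every point were beaten, then by upper semicontinuity a neighbourhood of it would be beaten
    by the same competitor; a finite list of competitors would beat the whole simplex, its own best
    member included. *)
Lemma Psi_max c : 0 <= c -> exists2 x, simplex x & forall y, simplex y -> Psi c y <= Psi c x.
Proof.
move=> c0; apply: contrapT => hno.
have hb x : simplex x -> exists2 y, simplex y & Psi c x < Psi c y.
  move=> sx; apply: contrapT => hx; apply: hno; exists x => // y sy.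
  by rewrite leNgt; apply/negP => h; apply: hx; exists y.
have FG := growing_filter 'cV[K]_d.+1.
have /compact_near_coveringP := @compact_simplex K d.+1.
move=> /(_ _ (@growing 'cV[K]_d.+1) (fun L x => simplex x ->
   exists2 y, (y \in L) && `[< simplex y >] & Psi c x < Psi c y) FG).
have hcov x : simplex x -> \forall x' \near x & L \near @growing 'cV[K]_d.+1,
    simplex x' -> exists2 y, (y \in L) && `[< simplex y >] & Psi c x' < Psi c y.
  move=> sx; have [y sy hy] := hb x sx.
  have /near_cboxP [e e0 he] := Psi_usc c0 sx hy.
  exists ([set x' : 'cV[K]_d.+1 | simplex x' -> Psi c x' < Psi c y], [set L : seq 'cV[K]_d.+1 | y \in L]).
    split.
      apply/near_boxP; exists e => // x' bx sx'; apply: (he c x') => //.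
      by rewrite subrr normr0.
    by exists [:: y] => L; apply; rewrite inE.
  move=> [x' L] [/= h1 h2] sx'; exists y; last exact: h1.
  by rewrite h2; apply/asboolP.
move=> /(_ hcov) [L hL]; have {}hL := hL L (fun _ h => h).
pose L' := [seq y <- L | `[< simplex y >]].
have L'n : L' != [::].
  have s0 : simplex barycenter.
    by have [h1 h2] := barycenter_int; split=> // i; exact: ltW.
  have [y /andP[yL sy] _] := hL _ s0 s0.
  have : y \in L' by rewrite mem_filter sy.
  by case: L'.
have [x xL hx] := seq_argmax (Psi c) L'n.
move: xL; rewrite mem_filter => /andP[/asboolP sx _].
have [y /andP[yL sy]] := hL x sx sx.
by rewrite ltNge hx // mem_filter sy.
Qed.

(** The weighted sum of the inequalities [x * ln m <= x * ln x + (m - x)] at [a] and [b], whose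
    linear errors cancel; this form admits [a = 0]. *)
Lemma xlnx_convex (a b t : K) : 0 <= a -> 0 < b -> 0 < t < 1 ->
  ((1 - t) * a + t * b) * ln ((1 - t) * a + t * b) <=
  (1 - t) * (a * ln a) + t * (b * ln b).
Proof.
move=> a0 b0 /andP[t0 t1].
have s0 : 0 < 1 - t by rewrite subr_gt0.
have m0 : 0 < (1 - t) * a + t * b by rewrite ltr_wpDl ?mulr_gt0 // mulr_ge0 // ltW.
set m := (1 - t) * a + t * b.
have key (x : K) : 0 <= x -> x * ln m <= x * ln x + (m - x).
  rewrite le_eqVlt => /orP[/eqP <-|x0]; first by rewrite !mul0r add0r subr0 ltW.
  have := le_ln1Dx (_ : -1 < m / x - 1); rewrite ltrBrDr addNr divr_gt0 // => /(_ isT).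
  rewrite addrC subrK ln_div ?posrE // => h.
  have := ler_wpM2l (ltW x0) h.
  rewrite !mulrBr [x * (m / x)]mulrC divfK ?gt_eqF // mulr1; lra.
have h1 := ler_wpM2l (ltW s0) (key a a0); have h2 := ler_wpM2l (ltW t0) (key b (ltW b0)).
rewrite mulrDl -!mulrA; apply: le_trans (lerD h1 h2) _.
by rewrite /m; lra.
Qed.

(* The slope of [t * ln t] at [0] is [-oo], so moving from a boundary point towards
   the barycenter increases [Psi]. *)
Lemma Psi_max_int c x : 0 <= c -> simplex x ->
  (forall y, simplex y -> Psi c y <= Psi c x) -> simplex_int x.
Proof.
move=> c0 sx hmax; have [x0 x1] := sx; split=> // i.
rewrite lt_neqAle x0 andbT eq_sym; apply/eqP => xi0.
have hu := barycenter_int; set u := barycenter in hu; have [u0 u1] := hu.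
have Px : 0 < Psi c x.
  apply: lt_le_trans (hmax u (simplex_intW hu)).
  by rewrite mulr_gt0 ?expR_gt0 ?powR_gt0 // hQ.
(* A positive maximum rules out a vanishing form, except for exponent 0. *)
have hcQ : c = 0 \/ 0 < quad R x.
  have := quad_ge0 sx; rewrite le_eqVlt => /orP[/eqP q0|]; last by right.
  left; apply/eqP; apply: contraLR Px => cn.
  by rewrite /Psi -q0 powR0 // mulr0 ltxx.
have Psix : Psi c x = expR (- ent x + c * ln (quad R x)).
  case: hcQ => [->|q0]; first by rewrite /Psi powRr0 mulr1 mul0r addr0.
  by rewrite /Psi /powR gt_eqF // expRD.
(* The change of [Psi] at distance [t] is controlled by [t * (M + u i 0 * ln t)]. The part [4 * c]
   comes from [2 * ln (1 - t) >= - 4 * t] for [t <= 1 / 2]. *)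
pose M := ent u - ent x + 4 * c.
have key (t : K) : 0 < t <= 1 / 2 -> 0 <= M + u i 0 * ln t.
  move=> /andP[t0 t2]; have t1 : t < 1 by apply: (le_lt_trans t2); rewrite mul1r invf_lt1 // ltr1n.
  pose y := x + t *: (u - x).
  have yE j : y j 0 = (1 - t) * x j 0 + t * u j 0 by rewrite !mxE; ring.
  have hy : simplex_int y.
    split=> [j|]; first by rewrite yE ltr_wpDl ?mulr_gt0 // mulr_ge0 // subr_ge0 ltW.
    under eq_bigr do rewrite yE.
    by rewrite big_split /= -!mulr_sumr x1 u1; ring.
  have Qy : 0 < quad R y by exact: hQ.
  have h1 : ent y <= (1 - t) * ent x + t * ent u + t * (u i 0 * ln t).
    rewrite /ent (bigD1 i) //= [in leRHS](bigD1 i) //= [\sum_j u j 0 * _](bigD1 i) //=.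
    rewrite yE xi0 mulr0 add0r lnM ?posrE // mul0r add0r.
    have : \sum_(j < d.+1 | j != i) y j 0 * (ln (y j 0) - ln (r j 0)) <=
       (1 - t) * (\sum_(j < d.+1 | j != i) x j 0 * (ln (x j 0) - ln (r j 0))) +
       t * (\sum_(j < d.+1 | j != i) u j 0 * (ln (u j 0) - ln (r j 0))).
      rewrite !mulr_sumr -big_split; apply: ler_sum => j _ /=; rewrite yE.
      have := xlnx_convex (x0 j) (u0 j) (_ : 0 < t < 1); rewrite t0 t1 => /(_ isT).
      by lra.
    by lra.
  have h2 : c * ln (quad R x) - 4 * c * t <= c * ln (quad R y).
    case: hcQ => [->|q0]; first by rewrite !(mul0r, mulr0) subr0.
    rewrite [4 * c]mulrC -mulrA -mulrBr; apply: ler_wpM2l => //.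
    have q1 : (1 - t) ^+ 2 * quad R x <= quad R y.
      rewrite !quadE mulr_sumr; apply: ler_sum => j _; rewrite mulr_sumr; apply: ler_sum => k _.
      rewrite !yE (_ : _ * _ = ((1 - t) * x j 0) * R j k * ((1 - t) * x k 0)); last by ring.
      have s0 : 0 <= 1 - t by rewrite subr_ge0 ltW.
      have p1 (l : 'I_d.+1) : 0 <= (1 - t) * x l 0 by rewrite mulr_ge0.
      have p2 (l : 'I_d.+1) : (1 - t) * x l 0 <= (1 - t) * x l 0 + t * u l 0.
        by rewrite lerDl mulr_ge0 // ltW.
      by apply: ler_pM => //; [rewrite mulr_ge0|apply: ler_wpM2r].
    have s0 : 0 < 1 - t by rewrite subr_gt0.
    have q2 : 0 < (1 - t) ^+ 2 * quad R x by rewrite mulr_gt0 ?exprn_gt0.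
    have : ln ((1 - t) ^+ 2 * quad R x) <= ln (quad R y).
      by rewrite ler_ln ?posrE.
    apply: le_trans; rewrite lnM ?posrE ?exprn_gt0 // lnXn // -mulr_natl.
    have := le_ln1Dx (_ : -1 < t / (1 - t)); rewrite (@lt_le_trans _ _ 0) ?divr_ge0 ?(ltW t0) ?(ltW s0) ?ltrN10 // => /(_ isT).
    rewrite (_ : 1 + t / (1 - t) = (1 - t)^-1); last by field; rewrite gt_eqF.
    rewrite lnV ?posrE // => h3.
    have : t / (1 - t) <= 2 * t by rewrite ler_pdivrMr //; nra.
    by move: h3; lra.
  have h3 : - ent y + c * ln (quad R y) <= - ent x + c * ln (quad R x).
    have := hmax y (simplex_intW hy).
    by rewrite Psix PsiE // ler_expR /Phi -/(ent y); lra.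
  have : 0 <= t * (M + u i 0 * ln t) by rewrite /M; lra.
  by rewrite pmulr_rge0.
(* Small enough for [u i 0 * ln t <= - (M + 1)], which contradicts [key]. *)
pose t := Num.min (1 / 2) (expR (- (M + 1) / u i 0)).
have t0 : 0 < t by rewrite lt_min divr_gt0 // expR_gt0.
have := key t; rewrite t0 min_le_l => /(_ isT).
have : ln t <= - (M + 1) / u i 0.
  by rewrite -[leRHS]expRK ler_ln ?posrE ?expR_gt0 //; exact: min_le_r.
rewrite ler_pdivlMr // mulrC; lra.
Qed.

Lemma Psi_max_LM c x : 0 <= c -> simplex x ->
  (forall y, simplex y -> Psi c y <= Psi c x) -> LM c x.
Proof.
move=> c0 sx hmax; have hx := Psi_max_int c0 sx hmax.
have near_min : \forall y \near x, simplex y -> Phi R r c x <= Phi R r c y.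
  have : \forall y \near x, forall i, 0 < (y : 'cV[K]_d.+1) i 0.
    apply: (@filter_forall _ _ (fun i (y : 'cV[K]_d.+1) => 0 < y i 0) (nbhs x) _) => i.
    by apply: cvg_near_gt (proj1 hx i); exact: coord_continuous.
  apply: filterS => y y0 sy.
  have hy : simplex_int y by split=> //; exact: (proj2 sy).
  by have := hmax y sy; rewrite !PsiE ?hQ // ler_expR lerN2.
split=> //; apply/grad0P; exact: (fermat_Phi hRsym hQ).
Qed.

(* Hence critical points cannot accumulate at the boundary of the simplex. *)
Lemma crit_lower c b x i : 0 <= c <= b -> simplex_int x -> crit R r c x ->
  r i 0 * expR (- (2 * d.+1%:R + \sum_j `|ln (r j 0)| + 2 * b)) <= x i 0.
Proof.
move=> /andP[c0 cb] hx hc; have [x0 x1] := hx; have Q0 := hQ hx.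
(* Stationarity is tested towards the vertex [i]: it expresses [ln (x i 0) - ln (r i 0)] as
   [ent x - 2 * c] plus a nonnegative term. *)
have tv : tangent (delta_mx i 0 - x).
  rewrite /tangent; under eq_bigr do rewrite !mxE andbT.
  rewrite sumrB x1 (bigD1 i) //= eqxx big1 ?addr0 ?subrr // => j /negPf -> //.
have := hc _ tv; rewrite /dPhi.
have -> : bil R x (delta_mx i 0 - x) = bil R x (delta_mx i 0) - quad R x.
  by rewrite /bil mulmxBr mxE [X in _ + X]mxE.
rewrite (eq_bigr (fun j => (j == i)%:R * (ln (x j 0) - ln (r j 0)) - x j 0 * (ln (x j 0) - ln (r j 0)))); last first.
  by move=> j _; rewrite !mxE andbT; ring.
rewrite sumrB -/(ent x) (bigD1 i) //= eqxx mul1r big1 ?addr0; last first.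
  by move=> j /negPf ->; rewrite mul0r.
rewrite mulrBr divfK ?gt_eqF //.
have b0 : 0 <= 2 * c / quad R x * bil R x (delta_mx i 0).
  rewrite mulr_ge0 ?divr_ge0 ?mulr_ge0 ?(ltW Q0) // bil_sum.
  apply: sumr_ge0 => j _; apply: sumr_ge0 => k _.
  by rewrite !mulr_ge0 ?(ltW (x0 j)) // mxE ler0n.
have hent : - (2 * d.+1%:R + \sum_j `|ln (r j 0)|) <= ent x.
  rewrite opprD -mulrN -sumrN.
  have -> : 2 * - d.+1%:R = \sum_(j < d.+1) (-2 : K).
    by rewrite sumr_const card_ord -mulr_natr; ring.
  rewrite -big_split; apply: ler_sum => j _ /=; rewrite mulrBr.
  have xj1 := simplex_le1 j (simplex_intW hx).
  have := norm_xlnx_le xj1; rewrite ler_norml => /andP[h1 _].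
  have h2 : Num.sqrt (x j 0) <= 1 by rewrite -[leRHS]sqrtr1 ler_sqrt.
  have h3 : x j 0 * ln (r j 0) <= `|ln (r j 0)|.
    apply: (le_trans (ler_norm _)); rewrite normrM (gtr0_norm (x0 j)).
    by rewrite ler_piMl.
  by lra.
move=> h.
rewrite -[r i 0]lnK ?posrE // -expRD -[x i 0]lnK ?posrE // ler_expR.
move: h b0 hent; move: (bil _ _ _) => B; lra.
Qed.

(** There are three ways of not being a local minimum, each stable in [c] and [x]: a direction of
    negative curvature at a critical point, a nonzero first derivative, or a zero coordinate,
    excluded nearby by [crit_lower]. *)
Lemma not_LM_near c x : 0 <= c -> simplex x ->
  (simplex_int x -> \det (hess_Phi R (@E0 K d) c x) != 0) -> ~ LM c x ->
  nbhs (c, x) [set z : K * 'cV[K]_d.+1 | 0 <= z.1 -> ~ LM z.1 z.2].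
Proof.
move=> c0 sx hdet hn.
have FF : Filter (nbhs ((c, x) : K * 'cV[K]_d.+1)) by exact: nbhs_filter.
have hc : z.1 @[z --> (c, x)] --> c by exact: cvg_fst.
have hx i : (z.2 : 'cV[K]_d.+1) i 0 @[z --> (c, x)] --> x i 0.
  apply: (@cvg_comp _ _ _ (fun z : K * 'cV[K]_d.+1 => z.2) (fun y : 'cV[K]_d.+1 => y i 0)).
    exact: cvg_snd.
  exact: coord_continuous.
case: (pselect (simplex_int x)) => [xi|nxi].
  have [x0 _] := xi; have Q0 := hQ xi.
  case: (pselect (crit R r c x)) => [xc|nxc].
    have [u hu] : exists u, quad (hess_Phi R (@E0 K d) c x) u < 0.
      apply: contrapT => hno; apply: hn; apply: (crit_LM hRsym hQ) => //.
      apply: posdef_psd; [exact: hess_sym|move=> u|exact: hdet].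
      by rewrite leNgt; apply/negP => h; apply: hno; exists u.
    rewrite (quad_hess hRsym) // in hu.
    set v := E0 K d *m u in hu; have v0 : tangent v by exact: E0_sum.
    pose N := \sum_i v i 0 ^+ 2.
    have N0 : 0 <= N by apply: sumr_ge0 => i _; exact: sqr_ge0.
    have N1 : 0 < N + 1 by rewrite ltr_wpDl.
    pose m := - ddPhi R c x v / 2.
    have m0 : 0 < m by rewrite divr_gt0 // oppr_gt0.
    have := @ddPhi_close K _ R c x (m / (N + 1)) x0 Q0 (divr_gt0 m0 N1).
    apply: filterS => z [_ _ /(_ v) hz] z0 [z1 _ z3].
    have := second_order hRsym hQ z1 z3 v0.
    have : m / (N + 1) * N <= m.
      by rewrite mulrAC ler_pdivrMr // ler_wpM2l ?(ltW m0) // lerDl.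
    move: hz; rewrite -/N ler_norml => /andP[_ h2] h3 h4; rewrite /m in h2 h3 m0.
    by lra.
  have [v v0 hv] : exists2 v, tangent v & dPhi R r c x v != 0.
    apply: contrapT => hno; apply: nxc => v v0; apply/eqP; apply: contrapT => /negP h.
    by apply: hno; exists v.
  have := @cvg_dPhi K d.+1 R r _ (nbhs (c, x)) FF (fun z : K * 'cV[K]_d.+1 => z.1) (fun z => z.2) c x hc hx x0 Q0 v.
  move/cvgrPdist_lt => /(_ `|dPhi R r c x v|); rewrite normr_gt0 hv => /(_ isT).
  apply: filterS => z hz _ [_ /grad0P zc _].
  by move: hz; rewrite zc // subr0 ltxx.
have [i xi0] : exists i, x i 0 = 0.
  apply: contrapT => hno; apply: nxi; split; last exact: (proj2 sx).
  move=> i; rewrite lt_neqAle (proj1 sx) andbT eq_sym; apply/eqP => h.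
  by apply: hno; exists i.
pose k := r i 0 * expR (- (2 * d.+1%:R + \sum_j `|ln (r j 0)| + 2 * (c + 1))).
have k0 : x i 0 < k by rewrite xi0 mulr_gt0 ?expR_gt0.
have c1 : c < c + 1 by rewrite ltrDl.
have := cvg_near_lt FF (hx i) k0; have := cvg_near_lt FF hc c1.
apply: filterS2 => z /= z1 z2 z3 [z4 /grad0P z5 _].
have : 0 <= z.1 <= c + 1 by rewrite z3 ltW.
by move=> /crit_lower /(_ z4 z5) => /(_ i); rewrite leNgt z2.
Qed.

(** A point that is no local minimum does not maximise [Psi c], so the level halfway between its
    value and the maximum bounds [Psi] nearby, for nearby [c'] too. Finitely many such levels have a
    maximum [M'] still below the global one. *)
Lemma cover_LM c (e_ : 'cV[K]_d.+1 -> K) : 0 <= c ->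
  (forall x, simplex_int x -> \det (hess_Phi R (@E0 K d) c x) != 0) ->
  (forall phi, LM c phi -> 0 < e_ phi) ->
  exists (L : seq 'cV[K]_d.+1) (phi0 : 'cV[K]_d.+1) (M' : K),
    [/\ uniq L, (forall phi, phi \in L -> LM c phi), phi0 \in L, 0 < M' < Psi c phi0 &
      \forall c' \near c, 0 <= c' -> forall x, simplex x ->
        (exists2 phi, phi \in L & box (e_ phi) phi x) \/ (Psi c' x <= M' /\ ~ LM c' x)].
Proof.
move=> c0 hdet he; have [xm sxm hmax] := Psi_max c0.
have LMm := Psi_max_LM c0 sxm hmax.
set M := Psi c xm.
have M0 : 0 < M.
  by rewrite /M PsiE ?expR_gt0 //; apply: hQ; case: LMm.
pose g y := (Psi c y + M) / 2.
(* The index couples a nearby exponent with a list of centres, so compactness yields one list and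
   one neighbourhood of [c] together. *)
pose P (i : K * seq 'cV[K]_d.+1) x := 0 <= i.1 -> simplex x ->
  exists2 y, (y \in i.2) && `[< simplex y >] &
    (LM c y /\ box (e_ y) y x) \/ (~ LM c y /\ Psi i.1 x < g y /\ ~ LM i.1 x).
have FG := @growing_filter 'cV[K]_d.+1.
have FP : Filter (filter_prod (nbhs c) (@growing 'cV[K]_d.+1)) by exact: filter_prod_filter.
have /compact_near_coveringP := @compact_simplex K d.+1.
move=> /(_ _ (filter_prod (nbhs c) (@growing 'cV[K]_d.+1)) P FP).
have hcov x : simplex x -> \forall x' \near x & i \near filter_prod (nbhs c) (@growing 'cV[K]_d.+1), P i x'.
  move=> sx; case: (pselect (LM c x)) => [xL|xnL].
    exists ([set x' : 'cV[K]_d.+1 | box (e_ x) x x'],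
      [set i : K * seq 'cV[K]_d.+1 | x \in i.2]).
      split; first by apply/near_boxP; exists (e_ x) => //; exact: he.
      exists ([set: K], [set L : seq 'cV[K]_d.+1 | x \in L]).
        by split; [exact: filterT|exists [:: x] => L; apply; rewrite inE].
      by move=> [? ?] [].
    move=> [x' [c' L]] [/= h1 h2] _ _; exists x; last by left.
    by rewrite h2; apply/asboolP.
  have xM : Psi c x < M.
    rewrite lt_neqAle hmax // andbT; apply/eqP => e; apply: xnL.
    by apply: Psi_max_LM => // y sy; rewrite e; exact: hmax.
  have xg : Psi c x < g x by rewrite /g; lra.
  have /near_cboxP [e1 e10 h1] := Psi_usc c0 sx xg.
  have /near_cboxP [e2 e20 h2] := not_LM_near c0 sx (hdet x) xnL.
  pose e := Num.min e1 e2; have e0 : 0 < e by rewrite lt_min e10.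
  exists ([set x' : 'cV[K]_d.+1 | box e x x'],
      [set i : K * seq 'cV[K]_d.+1 | `|i.1 - c| < e /\ x \in i.2]).
    split; first by apply/near_boxP; exists e.
    exists ([set c' : K | `|c' - c| < e], [set L : seq 'cV[K]_d.+1 | x \in L]).
      split; last by exists [:: x] => L; apply; rewrite inE.
      by apply/nbhs_ballP; exists e => // c'; rewrite /ball /= distrC.
    by move=> [? ?] [].
  move=> [x' [c' L]] [/= b1 [hc' xL]] c'0 sx'; exists x; first by rewrite xL; apply/asboolP.
  right; split=> //; split.
    apply: (h1 c' x') => //; first exact: lt_le_trans hc' (min_le_l _ _).
    exact: box_le (min_le_l _ _) b1.
  apply: (h2 c' x') => //; first exact: lt_le_trans hc' (min_le_r _ _).
  exact: box_le (min_le_r _ _) b1.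
move=> /(_ hcov) [[A B] [/= hA [L0 hB]] hAB].
have {}hAB c' x : A c' -> P (c', L0) x.
  by move=> Ac; case: (pselect (simplex x)) => [sx|nsx _ //]; apply: (hAB (c', L0)) => //; split=> //; exact: hB.
pose L1 := [seq y <- L0 | `[< simplex y >]].
(* Local minima impose no level; [M / 2] is a harmless value strictly between 0 and [M]. *)
pose f y := if `[< LM c y >] then M / 2 else g y.
have Ac := nbhs_singleton hA.
have L1n : L1 != [::].
  have [y /andP[yL sy] _] := hAB c xm Ac c0 sxm.
  have : y \in L1 by rewrite mem_filter sy.
  by case: (L1).
have [ym ymL hym] := seq_argmax f L1n.
pose L := undup (xm :: [seq y <- L1 | `[< LM c y >]]).
have fM y : y \in L1 -> 0 < f y < M.
  rewrite mem_filter => /andP[/asboolP sy _]; rewrite /f; case: asboolP => [_|ny].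
    by apply/andP; split; lra.
  have : Psi c y < M.
    rewrite lt_neqAle hmax // andbT; apply/eqP => e; apply: ny.
    by apply: Psi_max_LM => // z sz; rewrite e; exact: hmax.
  by have := Psi_ge0 c y; rewrite /g => ? ?; apply/andP; split; lra.
exists L, xm, (f ym); split.
- exact: undup_uniq.
- move=> phi; rewrite mem_undup inE => /orP[/eqP -> //|].
  by rewrite mem_filter => /andP[/asboolP].
- by rewrite mem_undup inE eqxx.
- exact: fM.
apply: filterS hA => c' /hAB hc' c'0 x sx.
have [y /andP[yL /asboolP sy] [[yLM hb]|[nLM [h1 h2]]]] := hc' x c'0 sx.
  left; exists y => //; rewrite mem_undup inE !mem_filter; apply/orP; right.
  by apply/and3P; split=> //; apply/asboolP.
right; split=> //.
have yL1 : y \in L1 by rewrite mem_filter yL andbT; apply/asboolP.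
apply: (le_trans (ltW h1)); apply: le_trans (hym y yL1).
by rewrite /f; case: asboolP.
Qed.

End GlobalMax.

(** * Laplace's method for the lattice sum *)

Section Close.
Variable K : realType.
Implicit Types k a b : K.

Definition factor_close k a b := a <= k * b /\ b <= k * a.

Lemma closeM k k' a b a' b' : 0 <= a -> 0 <= b -> 0 <= a' -> 0 <= b' ->
  factor_close k a b -> factor_close k' a' b' -> factor_close (k * k') (a * a') (b * b').
Proof.
move=> a0 b0 a'0 b'0 [h1 h2] [h3 h4].
by split; rewrite mulrACA; apply: ler_pM.
Qed.

Lemma closeV k a b : 0 < a -> 0 < b -> factor_close k a b -> factor_close k a^-1 b^-1.
Proof.
move=> a0 b0 [h1 h2]; split.
  by rewrite -[leLHS]mulr1 mulrC ler_pdivrMr // mulrAC ler_pdivlMr // mul1r.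
by rewrite -[leLHS]mulr1 mulrC ler_pdivrMr // mulrAC ler_pdivlMr // mul1r.
Qed.

Lemma close_prod k n (a b : 'I_n -> K) : (forall i, 0 <= a i) -> (forall i, 0 <= b i) ->
  (forall i, factor_close k (a i) (b i)) -> factor_close (k ^+ n) (\prod_i a i) (\prod_i b i).
Proof.
elim: n a b => [|n IH] a b a0 b0 h.
  by rewrite !big_ord0 expr0 /factor_close mul1r.
rewrite !big_ord_recr /= exprSr.
by apply: closeM => //; try (exact: prodr_ge0); apply: IH.
Qed.

Lemma cvg_factor_close T (F : set_system T) (FF : Filter F) (f : T -> K) (l k : K) :
  f t @[t --> F] --> l -> 0 < l -> 1 < k -> F [set t | 0 < f t /\ factor_close k (f t) l].
Proof.
move=> hf l0 k1; have k0 : 0 < k by apply: lt_trans k1.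
have h1 : l < k * l by rewrite ltr_pMl.
have h2 : k^-1 * l < l by rewrite ltr_pdivrMl // ltr_pMl.
have := cvg_near_lt FF hf h1; have := cvg_near_gt FF hf h2.
apply: filterS2 => t /= t1 t2; split; first by apply: lt_trans t1; rewrite mulr_gt0 // invr_gt0.
by split; [exact: ltW|rewrite -ler_pdivrMl // ltW].
Qed.

Lemma root_gt1 (k : K) (n : nat) : 1 < k -> exists2 k', 1 < k' & k' ^+ n.+1 = k.
Proof.
move=> k1; have k0 : 0 < k by apply: lt_trans k1.
exists (expR (ln k / n.+1%:R)).
  by rewrite -[ltLHS]expR0 ltr_expR divr_gt0 // ln_gt0.
by rewrite -expRM_natl mulrC divfK // lnK ?posrE.
Qed.

End Close.

Section LatticeTerms.
Variables (K : realType) (d : nat) (R : 'M[K]_d.+1) (r : 'cV[K]_d.+1).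
Hypothesis hRsym : R^T = R.
Hypothesis hRge0 : forall i j, 0 <= R i j.
Hypothesis hr : forall i, 0 < r i 0.

(** The probability that [n] independent draws from the distribution [k / n] have the counts [k]. *)
Definition multi n (k : {ffun 'I_d.+1 -> 'I_n.+1}) : K :=
  n`!%:R / (\prod_i (k i)`!)%:R * \prod_i cvec K k i 0 ^+ k i.

Lemma cvec_simplex n (k : {ffun 'I_d.+1 -> 'I_n.+1}) : (0 < n)%N -> (\sum_i k i)%N = n ->
  simplex (cvec K k).
Proof.
move=> n0 hk; split=> [i|]; first by rewrite mxE.
under eq_bigr do rewrite mxE.
by rewrite -mulr_suml -natr_sum hk divff // pnatr_eq0 -lt0n.
Qed.

Lemma lattice_termE n m (k : {ffun 'I_d.+1 -> 'I_n.+1}) : (0 < n)%N -> (\sum_i k i)%N = n ->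
  lattice_term R r m k = multi k * Psi R r (m%:R / n%:R) (cvec K k) ^+ n.
Proof.
move=> n0 hk; have sx := cvec_simplex n0 hk.
have nn : n%:R != 0 :> K by rewrite pnatr_eq0 -lt0n.
rewrite /lattice_term /multi /Psi exprMn -[(_ `^ _) ^+ n]powR_mulrn ?powR_ge0 //.
rewrite -powRrM divfK // powR_mulrn; last exact: quad_ge0.
rewrite mulrA; congr (_ * _); rewrite -!mulrA; congr (_ * (_ * _)).
rewrite -expRM_natl mulrN /ent mulr_sumr -sumrN expR_sum -big_split.
apply: eq_bigr => i _ /=; rewrite mxE.
(* An absent type contributes 1 on both sides, by [0 ^+ 0 = 1] and [0 * ln 0 = 0]. *)
case hki : (k i : nat) => [|ki]; first by rewrite !expr0 mul0r !(mulr0, mul0r) oppr0 expR0 mulr1.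
have x0 : 0 < ki.+1%:R / n%:R :> K by rewrite divr_gt0 // ltr0n.
rewrite mulrA [n%:R * _]mulrC divfK // -mulrN opprB.
rewrite expRM_natl -ln_div ?posrE // lnK ?posrE ?divr_gt0 //.
  by rewrite -exprMn mulrC divfK // gt_eqF.
by rewrite ltr0n.
Qed.

Lemma lattice_term_le n m (k : {ffun 'I_d.+1 -> 'I_n.+1}) : (0 < n)%N -> (\sum_i k i)%N = n ->
  lattice_term R r m k <= Psi R r (m%:R / n%:R) (cvec K k) ^+ n.
Proof.
move=> n0 hk; rewrite lattice_termE // ler_piMl ?exprn_ge0 ?Psi_ge0 //.
have [x0 x1] := cvec_simplex n0 hk.
exact: (@multinomial_le1 K d.+1 n k (fun i => cvec K k i 0)).
Qed.

Lemma lattice_term_ge0 n m (k : {ffun 'I_d.+1 -> 'I_n.+1}) : (0 < n)%N -> (\sum_i k i)%N = n ->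
  0 <= lattice_term R r m k.
Proof.
move=> n0 hk; have sx := cvec_simplex n0 hk.
rewrite /lattice_term !mulr_ge0 ?invr_ge0 ?ler0n ?exprn_ge0 ?quad_ge0 //.
by apply: prodr_ge0 => i _; rewrite exprn_ge0 // ltW.
Qed.

Variable C : K.
Hypothesis hC : stirling_spec C.

(** Stirling's formula is applied to [n!] and to the [d.+1] factorials below it, hence the [d.+2]-th
    root of [kappa]. The powers and exponentials cancel and the square roots leave [n] to the power
    [- d / 2]. *)
Lemma multi_close (delta kappa : K) : 0 < delta -> 1 < kappa ->
  \forall n \near \oo, forall k : {ffun 'I_d.+1 -> 'I_n.+1}, (\sum_i k i)%N = n ->
    (forall i, delta <= cvec K k i 0) ->
    factor_close kappa (multi k) ((C * Num.sqrt n%:R) ^- d / Num.sqrt (\prod_i cvec K k i 0)).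
Proof.
move=> d0 k1; have [C0 hCk] := hC.
have [k' k'1 k'E] := root_gt1 d.+1 k1.
have [N _ hN] := hCk _ k'1.
near=> n => k hk hx.
have n0 : (0 < n)%N by near: n; exact: nbhs_infty_gt.
have n0' : 0 < n%:R :> K by rewrite ltr0n.
have nN : (N <= n)%N by near: n; exact: nbhs_infty_ge.
(* Since [k i >= delta * n], this puts all counts beyond the threshold of Stirling's formula. *)
have ndN : N.+1%:R / delta <= n%:R by near: n; exact: nbhs_infty_ger.
have kN i : (N < k i)%N.
  rewrite -(ltr_nat K); apply: (@lt_le_trans _ _ N.+1%:R); first by rewrite ltr_nat.
  rewrite ler_pdivrMr // in ndN; apply: (le_trans ndN); have := hx i.
  by rewrite mxE ler_pdivlMr // mulrC.
have kp i : 0 < (k i)%:R :> K by rewrite ltr0n (leq_ltn_trans _ (kN i)).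
have sp j : (0 < j)%N -> 0 < stirling_main K j by case: j => // j _; exact: stirling_main_gt0.
have kp' i : (0 < k i)%N by rewrite (leq_ltn_trans _ (kN i)).
have xp i : 0 < cvec K k i 0 by rewrite mxE divr_gt0.
have h1 : factor_close k' n`!%:R (C * stirling_main K n).
  by have [h1 h2] := hN n nN; split.
have h2 : factor_close (k' ^+ d.+1) (\prod_i (k i)`!%:R) (\prod_i (C * stirling_main K (k i))).
  apply: close_prod => [i|i|i]; rewrite ?ler0n ?mulr_ge0 ?(ltW C0) ?(ltW (sp _ (kp' i))) //.
  by have [h2 h3] := hN (k i) (ltnW (kN i)); split.
have p1 : 0 < \prod_i (k i)`!%:R :> K by apply: prodr_gt0 => i _; rewrite ltr0n fact_gt0.
have p2 : 0 < \prod_i (C * stirling_main K (k i)) by apply: prodr_gt0 => i _; rewrite mulr_gt0 // sp.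
have h3 := closeM (ler0n K n`!) (ltW (mulr_gt0 C0 (sp n n0))) (ltW (_ : 0 < (\prod_i (k i)`!%:R)^-1))
   (ltW (_ : 0 < (\prod_i (C * stirling_main K (k i)))^-1)) h1 (closeV p1 p2 h2).
rewrite !invr_gt0 in h3; have {}h3 := h3 p1 p2.
have p3 : 0 < \prod_i cvec K k i 0 ^+ k i by apply: prodr_gt0 => i _; rewrite exprn_gt0.
have one : factor_close 1 (\prod_i cvec K k i 0 ^+ k i) (\prod_i cvec K k i 0 ^+ k i).
  by split; rewrite mul1r.
have := closeM _ _ (ltW p3) (ltW p3) h3 one.
rewrite -exprS k'E mulr1 divr_ge0 ?(ltW p1) ?ler0n // divr_ge0 ?(ltW p2) ?(ltW (mulr_gt0 C0 (sp n n0))) //.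
move=> /(_ isT isT); rewrite /multi natr_prod; congr (factor_close _ _ _).
have sxp : \prod_i Num.sqrt (cvec K k i 0) = Num.sqrt (\prod_i cvec K k i 0).
  elim: (index_enum _) => [|i s IH]; first by rewrite !big_nil sqrtr1.
  by rewrite !big_cons IH sqrtrM // ltW.
have -> : \prod_i (C * stirling_main K (k i)) =
   (C * Num.sqrt n%:R) ^+ d.+1 * Num.sqrt (\prod_i cvec K k i 0) *
   (\prod_i cvec K k i 0 ^+ k i) * (n%:R ^+ n * expR (- n%:R)).
  have e1 : n%:R ^+ n = \prod_(i < d.+1) (n%:R ^+ k i : K).
    by rewrite -expr_sum hk.
  have e2 : expR (- n%:R) = \prod_(i < d.+1) expR (- (k i)%:R : K).
    by rewrite -expR_sum sumrN -natr_sum hk.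
  have e3 : (C * Num.sqrt n%:R) ^+ d.+1 = \prod_(i < d.+1) (C * Num.sqrt n%:R).
    by rewrite prodr_const card_ord.
  rewrite e1 e2 e3 -sxp -!big_split; apply: eq_bigr => i _ /=.
  rewrite /stirling_main (_ : (k i)%:R = n%:R * cvec K k i 0 :> K); last first.
    by rewrite mxE mulrC divfK // gt_eqF.
  by rewrite sqrtrM // exprMn; ring.
rewrite /stirling_main exprS; field.
have q1 : 0 < Num.sqrt (\prod_i cvec K k i 0) by rewrite sqrtr_gt0; apply: prodr_gt0.
have q2 : 0 < Num.sqrt n%:R :> K by rewrite sqrtr_gt0.
have q3 : 0 < (C * Num.sqrt n%:R) ^+ d by rewrite exprn_gt0 // mulr_gt0.
by rewrite (gt_eqF q1) (gt_eqF q3) (gt_eqF (expR_gt0 _)) (gt_eqF (exprn_gt0 n n0'))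
  (gt_eqF p3) (gt_eqF q2) (gt_eqF C0).
Unshelve. all: by end_near.
Qed.

End LatticeTerms.

Section DetContinuity.
Variables (K : realType) (d : nat) (R : 'M[K]_d.+1).
Hypothesis hRsym : R^T = R.
Hypothesis hQ : forall x : 'cV[K]_d.+1, simplex_int x -> 0 < quad R x.

Definition gauss_norm c (x : 'cV[K]_d.+1) : K :=
  Num.sqrt (\det (hess_Phi R (@E0 K d) c x) * \prod_i x i 0).

Lemma hmat_hent c (x : 'cV[K]_d.+1) : (forall i, 0 < x i 0) ->
  hmat R c x = \matrix_(i, j) hent R c x i j.
Proof.
move=> hx; rewrite /hmat.
have -> : invmx (diag_mx x^T) = diag_mx (\row_i (x i 0)^-1).
  have e : diag_mx x^T *m diag_mx (\row_i (x i 0)^-1) = 1%:M.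
    rewrite mulmx_diag; apply/matrixP => i j; rewrite !mxE.
    by rewrite divff ?(gt_eqF (hx i)).
  have u : diag_mx x^T \in unitmx by case: (mulmx1_unit e).
  by rewrite -[LHS]mulmx1 -e mulKmx.
apply/matrixP => i j; rewrite [RHS]mxE /hent.
have b j' : bil R x (delta_mx j' 0) = (x^T *m R) 0 j'.
  by rewrite /bil -colE mxE.
have b' : (R *m x) i 0 = bil R x (delta_mx i 0).
  have e : x^T *m R = (R *m x)^T by rewrite trmx_mul hRsym.
  by rewrite b e [RHS]mxE.
rewrite -b' b; move: (R *m x) (x^T *m R) => u w.
by rewrite !mxE big_ord1; case: eqP => _ /=; rewrite ?mulr1n ?mulr0n ?mul1r ?mul0r; ring.
Qed.

Lemma cvg_prod_ord T (F : set_system T) (FF : Filter F) n (f : 'I_n -> T -> K) (l : 'I_n -> K) :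
  (forall i, f i t @[t --> F] --> l i) ->
  \prod_i f i t @[t --> F] --> \prod_i l i.
Proof.
elim: n f l => [|n IH] f l h.
  by rewrite big_ord0; under eq_fun do rewrite big_ord0; exact: cvg_cst.
rewrite big_ord_recr; under eq_fun do rewrite big_ord_recr.
by apply: cvgM => //; apply: IH => i; exact: h.
Qed.

Lemma cvg_sum_seq T (F : set_system T) (FF : Filter F) (I : Type) (s : seq I) (f : I -> T -> K) (l : I -> K) :
  (forall i, f i t @[t --> F] --> l i) ->
  \sum_(i <- s) f i t @[t --> F] --> \sum_(i <- s) l i.
Proof.
move=> h; elim: s => [|i s IH].
  by rewrite big_nil; under eq_fun do rewrite big_nil; exact: cvg_cst.
rewrite big_cons; under eq_fun do rewrite big_cons.
by apply: cvgD.
Qed.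

Lemma cvg_det T (F : set_system T) (FF : Filter F) n (A : T -> 'M[K]_n) (B : 'M[K]_n) :
  (forall i j, A t i j @[t --> F] --> B i j) -> \det (A t) @[t --> F] --> \det B.
Proof.
move=> h; rewrite /determinant; apply: cvg_sum_seq => s.
by apply: cvgM; [exact: cvg_cst|apply: cvg_prod_ord].
Qed.

Lemma gauss_norm_close (c kappa : K) (phi : 'cV[K]_d.+1) : simplex_int phi ->
  0 < \det (hess_Phi R (@E0 K d) c phi) -> 1 < kappa ->
  nbhs (c, phi) [set z : K * 'cV[K]_d.+1 |
    [/\ 0 < gauss_norm z.1 z.2, factor_close kappa (gauss_norm z.1 z.2) (gauss_norm c phi) &
      factor_close kappa (Num.sqrt (\prod_i z.2 i 0)) (Num.sqrt (\prod_i phi i 0))]].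
Proof.
move=> hp hd k1; have [p0 _] := hp.
have FF : Filter (nbhs ((c, phi) : K * 'cV[K]_d.+1)) by exact: nbhs_filter.
have hc : z.1 @[z --> (c, phi)] --> c by exact: cvg_fst.
have hx i : (z.2 : 'cV[K]_d.+1) i 0 @[z --> (c, phi)] --> phi i 0.
  apply: (@cvg_comp _ _ _ (fun z : K * 'cV[K]_d.+1 => z.2) (fun y : 'cV[K]_d.+1 => y i 0)).
    exact: cvg_snd.
  exact: coord_continuous.
have hpr : \prod_i (z.2 : 'cV[K]_d.+1) i 0 @[z --> (c, phi)] --> \prod_i phi i 0.
  exact: (cvg_prod_ord FF hx).
have pp : 0 < \prod_i phi i 0 by apply: prodr_gt0.
pose A c' (x : 'cV[K]_d.+1) := (E0 K d)^T *m (\matrix_(i, j) hent R c' x i j) *m E0 K d.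
have AE c' (x : 'cV[K]_d.+1) : (forall i, 0 < x i 0) -> hess_Phi R (@E0 K d) c' x = A c' x.
  by move=> x0; rewrite /A -hmat_hent.
have hdet : \det (A z.1 z.2) @[z --> (c, phi)] --> \det (hess_Phi R (@E0 K d) c phi).
  rewrite AE //; apply: (cvg_det FF) => i j.
  have e c' x : A c' x i j = \sum_k \sum_l E0 K d l i * hent R c' x l k * E0 K d k j.
    rewrite mxE; apply: eq_bigr => k _; rewrite mxE mulr_suml; apply: eq_bigr => l _.
    by rewrite !mxE.
  rewrite e; under eq_fun do rewrite e.
  apply: cvg_sum_ord => k; apply: cvg_sum_ord => l.
  apply: cvgM; last exact: cvg_cst.
  apply: cvgM; first exact: cvg_cst.
  exact: (@cvg_hent K d.+1 R _ (nbhs (c, phi)) FF (fun z : K * 'cV[K]_d.+1 => z.1) (fun z => z.2) c phi hc hx p0 (hQ hp)).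
have hD : Num.sqrt (\det (A z.1 z.2) * \prod_i (z.2 : 'cV[K]_d.+1) i 0) @[z --> (c, phi)] --> gauss_norm c phi.
  exact: (cvg_compK (cvgM hdet hpr) (@sqrt_continuous K _)).
have D0 : 0 < gauss_norm c phi by rewrite sqrtr_gt0 mulr_gt0.
have hS : Num.sqrt (\prod_i (z.2 : 'cV[K]_d.+1) i 0) @[z --> (c, phi)] --> Num.sqrt (\prod_i phi i 0).
  exact: (cvg_compK hpr (@sqrt_continuous K _)).
have S0 : 0 < Num.sqrt (\prod_i phi i 0) by rewrite sqrtr_gt0.
have hpos : nbhs (c, phi) [set z : K * 'cV[K]_d.+1 | forall i, 0 < z.2 i 0].
  apply: (@filter_forall _ _ (fun i (z : K * 'cV[K]_d.+1) => 0 < z.2 i 0) (nbhs (c, phi)) _) => i.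
  exact: cvg_near_gt (hx i) (p0 i).
have := cvg_factor_close FF hD D0 k1; have := cvg_factor_close FF hS S0 k1; move: hpos.
apply: filterS3 => z /= z1 [z2 z3] [z4 z5].
by rewrite /gauss_norm AE.
Qed.

End DetContinuity.

Section SumInj.
Variable K : realType.

Lemma sum_le_inj (I J : finType) (P : pred I) (Q : pred J) (F : I -> K) (G : J -> K) (h : I -> J) :
  {in P &, injective h} -> (forall i, P i -> Q (h i) /\ F i <= G (h i)) ->
  (forall j, Q j -> 0 <= G j) -> \sum_(i | P i) F i <= \sum_(j | Q j) G j.
Proof.
move=> hinj hPQ G0.
apply: (@le_trans _ _ (\sum_(i | P i) G (h i))).
  by apply: ler_sum => i /hPQ [].
have e : \sum_(i in [set i | P i]%SET) G (h i) = \sum_(j in (h @: [set i | P i])%SET) G j.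
  by rewrite big_imset //= => i j; rewrite !inE; exact: hinj.
rewrite (_ : \sum_(i | P i) G (h i) = \sum_(i in [set i | P i]%SET) G (h i)); last first.
  by apply: eq_bigl => i; rewrite inE.
rewrite e (bigID (fun j => j \in (h @: [set i | P i])%SET) Q) /=.
rewrite (eq_bigl (fun j => Q j && (j \in (h @: [set i | P i])%SET))); last first.
  move=> j; apply/idP/andP => [jh|[]//]; split=> //.
  by move: jh => /imsetP [i]; rewrite inE => /hPQ [q _] ->.
by rewrite lerDl; apply: sumr_ge0 => j /andP[/G0].
Qed.

End SumInj.

(** * Laplace estimates in one box *)

Section LocalSums.
Variables (K : realType) (d : nat) (R : 'M[K]_d.+1) (r : 'cV[K]_d.+1).
Hypothesis hRsym : R^T = R.
Hypothesis hRge0 : forall i j, 0 <= R i j.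
Hypothesis hr : forall i, 0 < r i 0.
Hypothesis hQ : forall x, simplex_int x -> 0 < quad R x.
Implicit Types (c t : K) (x y v phi : 'cV[K]_d.+1).
Variables (C g : K).
Hypotheses (hC : stirling_spec C) (hg : gauss_const_spec g).

Let H c x := hess_Phi R (@E0 K d) c x.
Let LM c := local_minima R r (@E0 K d) c.

(** The bound by [phi i 0 / 2] keeps the coordinates away from 0, as Stirling's formula for every
    count demands; the two closeness conditions freeze the prefactors at [phi]. *)
Definition good_box c phi kappa e := [/\ 0 < e, sandwich R c phi kappa e &
  forall c' x, `|c' - c| < e -> box e phi x -> [/\ forall i, phi i 0 / 2 < x i 0,
    0 < gauss_norm R c' x, factor_close kappa (gauss_norm R c' x) (gauss_norm R c phi) &
      factor_close kappa (Num.sqrt (\prod_i x i 0)) (Num.sqrt (\prod_i phi i 0))]].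

Lemma good_box_exists c phi kappa : LM c phi -> \det (H c phi) != 0 -> 1 < kappa ->
  exists e : K, good_box c phi kappa e.
Proof.
move=> hL hdet k1; have hpd := LM_posdef hRsym hQ hL hdet.
have [hp _ _] := hL; have [p0 _] := hp.
have [e1 e10 h1] := local_sandwich hRsym hQ hp hpd k1.
have /near_cboxP [e2 e20 h2] := gauss_norm_close hRsym hQ hp (posdef_det hpd) k1.
have : \forall x \near phi, forall i, phi i 0 / 2 < (x : 'cV[K]_d.+1) i 0.
  apply: (@filter_forall _ _ (fun i (x : 'cV[K]_d.+1) => phi i 0 / 2 < x i 0) (nbhs phi) _) => i.
  apply: (@cvg_near_gt K _ (nbhs phi) _ (fun x : 'cV[K]_d.+1 => x i 0) (phi i 0)).
    exact: coord_continuous.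
  by rewrite ltr_pdivrMr // mulr_natr mulr2n ltrDl.
move=> /near_boxP [e3 e30 h3].
exists (Num.min e1 (Num.min e2 e3)); split; first by rewrite !lt_min e10 e20.
  move=> c' x hc hx; apply: h1; last exact: box_le (min_le_l _ _) hx.
  exact: lt_le_trans hc (min_le_l _ _).
move=> c' x hc hx.
have hx2 := box_le (min_le_l _ _) (box_le (min_le_r _ _) hx).
have hx3 := box_le (min_le_r _ _) (box_le (min_le_r _ _) hx).
have hc2 := lt_le_trans (lt_le_trans hc (min_le_r _ _)) (min_le_l _ _).
have [a1 a2 a3] := h2 c' x hc2 hx2.
by split=> //; exact: h3.
Qed.

(** As the counts sum to [n], the first [d] determine the last; this turns the sum into one over a
    full [d]-dimensional grid. *)
Definition top_count n (k : {ffun 'I_d.+1 -> 'I_n.+1}) : 'cV['I_n.+1]_d :=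
  \col_j k (widen_ord (leqnSn d) j).

Lemma top_count_inj n (k1 k2 : {ffun 'I_d.+1 -> 'I_n.+1}) :
  (\sum_i k1 i = n)%N -> (\sum_i k2 i = n)%N -> top_count k1 = top_count k2 -> k1 = k2.
Proof.
move=> h1 h2 e.
have ew j : k1 (widen_ord (leqnSn d) j) = k2 (widen_ord (leqnSn d) j).
  by move/matrixP: e => /(_ j 0); rewrite !mxE.
apply/ffunP => i; apply/val_inj.
case: (unliftP ord_max i) => [j ->|->].
  have -> : lift ord_max j = widen_ord (leqnSn d) j.
    by apply/val_inj; rewrite /= /bump leqNgt ltn_ord.
  by rewrite ew.
have : (\sum_i k1 i = \sum_i k2 i)%N by rewrite h1 h2.
rewrite !big_ord_recr /=.
under eq_bigr do rewrite ew.
by move/addnI.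
Qed.

Lemma top_cvec n (k : {ffun 'I_d.+1 -> 'I_n.+1}) x :
  top (cvec K k - x) = grid K (top_count k) - top x.
Proof. by apply/matrixP => i j; rewrite !mxE. Qed.

(* The summand of the asymptotic formula, see [peak_param]. *)
Definition peak n c x : K := Psi R r c x ^+ n / gauss_norm R c x.

Lemma quad_scale m (A : 'M[K]_m) (k : K) (v : 'cV[K]_m) : quad (k *: A) v = k * quad A v.
Proof. by rewrite /quad -scalemxAr -scalemxAl mxE. Qed.

Lemma Psi_local c phi kappa e c' phi' x n : 1 < kappa -> simplex_int phi -> good_box c phi kappa e ->
  `|c' - c| < e -> LM c' phi' -> box e phi phi' -> simplex x -> box e phi x ->
  Psi R r c' phi' ^+ n * expR (- (n%:R / 2 * quad (kappa *: H c phi) (top (x - phi')))) <=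
  Psi R r c' x ^+ n <=
  Psi R r c' phi' ^+ n * expR (- (n%:R / 2 * quad (kappa^-1 *: H c phi) (top (x - phi')))).
Proof.
move=> k1 hp [e0 hs _] hc [hp' /grad0P hcr _] b' sx bx.
have sxi := sandwich_int e0 hs bx sx.
have := sandwich_Phi hRsym hQ hs hc b' bx hp' sxi hcr.
have tv := tangentB (simplex_intW hp') sx.
rewrite -(E0_top tv) -(quad_hess hRsym); last exact: (proj1 hp).
rewrite (E0_top tv) !PsiE ?hQ // !quad_scale -!expRM_natl -!expRD !ler_expR.
rewrite -/(H c phi); move: (quad _ _) => q1 /andP[h1 h2].
have n0 : 0 <= n%:R :> K by [].
have := ler_wpM2l n0 h1; have := ler_wpM2l n0 h2.
by move=> h3 h4; apply/andP; split; lra.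
Qed.

Lemma det_scale_bound m (A : 'M[K]_m) kappa : 1 < kappa -> posdef A ->
  1 / Num.sqrt (\det (kappa^-1 *: A)) <= kappa ^+ m / Num.sqrt (\det A) /\
  1 / Num.sqrt (\det A) <= kappa ^+ m / Num.sqrt (\det (kappa *: A)).
Proof.
move=> k1 hA; have dA := posdef_det hA; have k0 : 0 < kappa by apply: lt_trans k1.
have s0 : 0 < Num.sqrt (\det A) by rewrite sqrtr_gt0.
have km : 1 <= kappa ^+ m by rewrite exprn_ege1 // ltW.
have km0 : 0 < kappa ^+ m by rewrite exprn_gt0.
have sk : Num.sqrt (kappa ^+ m) <= kappa ^+ m.
  rewrite -[leRHS]ger0_norm ?(ltW km0) // -sqrtr_sqr ler_sqrt ?exprn_ge0 ?(ltW km0) ?(ltW k0) //.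
  by rewrite expr2 ler_peMl // ltW.
have sk0 : 0 < Num.sqrt (kappa ^+ m) by rewrite sqrtr_gt0.
split.
  rewrite detZ sqrtrM ?exprn_ge0 ?invr_ge0 ?(ltW k0) // exprVn sqrtrV ?exprn_ge0 ?(ltW k0) //.
  by rewrite invfM invrK mul1r ler_wpM2r // invr_ge0 ltW.
rewrite detZ sqrtrM ?exprn_ge0 ?(ltW k0) // invfM mulrA ler_wpM2r ?invr_ge0 ?(ltW s0) //.
by rewrite ler_pdivlMr // mul1r.
Qed.

(** All terms being nonnegative, the sum may be enlarged to the whole grid. The exponent [d + 4]
    collects one factor [kappa] each for Stirling's formula, the product of coordinates, the
    Gaussian sum and [gauss_norm], and [d] for rescaling the determinant. *)
Lemma local_upper c phi kappa e : LM c phi -> posdef (H c phi) -> 1 < kappa ->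
  good_box c phi kappa e ->
  \forall n \near \oo, forall m phi', let c' := m%:R / n%:R in
    `|c' - c| < e -> LM c' phi' -> box e phi phi' ->
    \sum_(k : {ffun 'I_d.+1 -> 'I_n.+1} | ((\sum_i k i)%N == n) && `[< box e phi (cvec K k) >])
       lattice_term R r m k <= kappa ^+ (d + 4) * ((g / C) ^+ d * peak n c' phi').
Proof.
move=> hL hpd k1 hgb; have [hp _ _] := hL; have [p0 p1] := hp.
have [C0 _] := hC; have [g0 _] := hg; have k0 : 0 < kappa by apply: lt_trans k1.
pose dl := \big[Num.min/1]_i (phi i 0 / 2).
have dl0 : 0 < dl by apply: lt_bigmin => // i _; rewrite divr_gt0.
have dle i : dl <= phi i 0 / 2 by exact: bigmin_le_cond.
have hm := @multi_close K d C hC dl kappa dl0 k1.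
have hpd' : posdef (kappa^-1 *: H c phi) by apply: posdefZ => //; rewrite invr_gt0.
have hgs := gauss_sum_le hg hpd' k1.
near=> n; move=> m phi'; set c' := m%:R / n%:R; move=> hc hL' hb'.
have n0 : (0 < n)%N by near: n; exact: nbhs_infty_gt.
have sn : 0 < Num.sqrt n%:R :> K by rewrite sqrtr_gt0 ltr0n.
have [e0 hs hbx] := hgb.
pose Sp := Num.sqrt (\prod_i phi i 0).
have Sp0 : 0 < Sp by rewrite sqrtr_gt0; apply: prodr_gt0.
have P0 : 0 <= Psi R r c' phi' ^+ n by rewrite exprn_ge0 // Psi_ge0.
have Cn : 0 < (C * Num.sqrt n%:R) ^+ d by rewrite exprn_gt0 // mulr_gt0.
have [_ D0 Dc _] := hbx c' phi' hc hb'.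
have term (k : {ffun 'I_d.+1 -> 'I_n.+1}) : (\sum_i k i)%N = n -> box e phi (cvec K k) ->
    lattice_term R r m k <= kappa ^+ 2 * (C * Num.sqrt n%:R) ^- d / Sp * Psi R r c' phi' ^+ n *
      expR (- (n%:R / 2 * quad (kappa^-1 *: H c phi) (grid K (top_count k) - top phi'))).
  move=> hk bk; have sk := cvec_simplex K n0 hk.
  have [hlo _ _ Sc] := hbx c' _ hc bk.
  have [m1 _] : factor_close kappa (multi K k) ((C * Num.sqrt n%:R) ^- d / Num.sqrt (\prod_i cvec K k i 0)).
    have hmn : forall k : {ffun 'I_d.+1 -> 'I_n.+1}, (\sum_i k i)%N = n ->
      (forall i, dl <= cvec K k i 0) ->
      factor_close kappa (multi K k) ((C * Num.sqrt n%:R) ^- d / Num.sqrt (\prod_i cvec K k i 0)).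
      by near: n.
    by apply: hmn => // i; apply: le_trans (dle i) (ltW (hlo i)).
  have Sk0 : 0 < Num.sqrt (\prod_i cvec K k i 0).
    by rewrite sqrtr_gt0; apply: prodr_gt0 => i _; apply: lt_trans (hlo i); rewrite divr_gt0.
  have [S1 _] := closeV Sk0 Sp0 Sc.
  have /andP[_ hP] := Psi_local n k1 hp hgb hc hL' hb' sk bk.
  rewrite lattice_termE // -/c' -top_cvec.
  rewrite -mulrA; apply: ler_pM => //.
  - by rewrite /multi mulr_ge0 ?divr_ge0 ?ler0n // prodr_ge0 // => i _; rewrite exprn_ge0 // (proj1 sk).
  - by rewrite exprn_ge0 // Psi_ge0.
  apply: (le_trans m1); rewrite expr2 -!mulrA ler_pM2l //.
  rewrite [leRHS]mulrCA ler_wpM2l // ?invr_ge0 ?(ltW Cn) //.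
apply: (@le_trans _ _ (kappa ^+ 2 * (C * Num.sqrt n%:R) ^- d / Sp * Psi R r c' phi' ^+ n *
   \sum_(u : 'cV['I_n.+1]_d) expR (- (n%:R / 2 * quad (kappa^-1 *: H c phi) (grid K u - top phi'))))).
  rewrite mulr_sumr.
  apply: (@sum_le_inj K _ _ _ xpredT _ _ (@top_count n)).
  - by move=> k1' k2' /andP[/eqP h1 _] /andP[/eqP h2 _]; exact: top_count_inj.
  - by move=> k /andP[/eqP hk /asboolP bk]; split=> //; exact: term.
  - move=> u _; rewrite mulr_ge0 ?expR_ge0 // !mulr_ge0 ?invr_ge0 ?(ltW Sp0) ?(ltW Cn) ?exprn_ge0 ?(ltW k0) ?Psi_ge0 //.
have hgn : \sum_(u : 'cV['I_n.+1]_d) expR (- (n%:R / 2 * quad (kappa^-1 *: H c phi) (grid K u - top phi')))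
   <= kappa * (g ^+ d * (Num.sqrt n%:R ^+ d / Num.sqrt (\det (kappa^-1 *: H c phi)))).
  by move: (top phi'); near: n.
have A0 : 0 <= kappa ^+ 2 * (C * Num.sqrt n%:R) ^- d / Sp * Psi R r c' phi' ^+ n.
  by rewrite !mulr_ge0 ?invr_ge0 ?(ltW Sp0) ?(ltW Cn) ?exprn_ge0 ?(ltW k0) ?Psi_ge0.
apply: (le_trans (ler_wpM2l A0 hgn)).
have dp := posdef_det hpd; have sd : 0 < Num.sqrt (\det (H c phi)) by rewrite sqrtr_gt0.
have [db _] := det_scale_bound k1 hpd.
have Dphi : gauss_norm R c phi = Num.sqrt (\det (H c phi)) * Sp.
  by rewrite /gauss_norm sqrtrM // ltW.
have [_ Dc2] := Dc.
have Dinv : 1 / (Num.sqrt (\det (H c phi)) * Sp) <= kappa / gauss_norm R c' phi'.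
  rewrite -Dphi ler_pdivrMr ?Dphi ?mulr_gt0 // mulrAC ler_pdivlMr // mul1r -Dphi.
  by have [] := Dc.
rewrite /peak.
rewrite (_ : _ * (kappa * _) = kappa ^+ 3 * (g / C) ^+ d * Psi R r c' phi' ^+ n / Sp *
   (1 / Num.sqrt (\det (kappa^-1 *: H c phi)))); last first.
  rewrite [(C * _) ^+ d]exprMn [(g / C) ^+ d]expr_div_n; field.
  rewrite !gt_eqF ?exprn_gt0 ?(posdef_det hpd') ?sqrtr_gt0 ?(posdef_det hpd') ?ltr0n //.
  by apply: prodr_gt0.
have B0 : 0 <= kappa ^+ 3 * (g / C) ^+ d * Psi R r c' phi' ^+ n.
  by rewrite !mulr_ge0 ?exprn_ge0 ?divr_ge0 ?(ltW k0) ?(ltW C0) ?(ltW g0) ?Psi_ge0.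
apply: (@le_trans _ _ (kappa ^+ 3 * (g / C) ^+ d * Psi R r c' phi' ^+ n / Sp *
   (kappa ^+ d / Num.sqrt (\det (H c phi))))).
  by rewrite ler_wpM2l // divr_ge0 // ltW.
rewrite (_ : _ * _ = kappa ^+ 3 * (g / C) ^+ d * Psi R r c' phi' ^+ n * kappa ^+ d *
   (1 / (Num.sqrt (\det (H c phi)) * Sp))); last by field; rewrite !gt_eqF.
apply: (@le_trans _ _ (kappa ^+ 3 * (g / C) ^+ d * Psi R r c' phi' ^+ n * kappa ^+ d *
   (kappa / gauss_norm R c' phi'))).
  by rewrite ler_wpM2l // mulr_ge0 // exprn_ge0 // ltW.
rewrite le_eqVlt; apply/orP; left; apply/eqP.
by rewrite exprD; field; rewrite gt_eqF // gt_eqF.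
Unshelve. all: by end_near.
Qed.

Lemma good_box_le c phi kappa e e' : 0 < e' <= e -> good_box c phi kappa e ->
  good_box c phi kappa e'.
Proof.
move=> /andP[e0 le] [_ h1 h2]; split=> // [c' x hc hx|c' x hc hx].
  by apply: h1; [exact: lt_le_trans hc le | exact: box_le le hx].
by apply: h2; [exact: lt_le_trans hc le | exact: box_le le hx].
Qed.

(* Outside of [\sum_j u j 0 <= n] the last coordinate is truncated to [0]. *)
Definition lift_count n (u : 'cV['I_n.+1]_d) : {ffun 'I_d.+1 -> 'I_n.+1} :=
  [ffun i => if unlift ord_max i is Some j then u j 0 else inord (n - \sum_j u j 0%R)%N].

Lemma lift_count_widen n (u : 'cV['I_n.+1]_d) j : lift_count u (widen_ord (leqnSn d) j) = u j 0.
Proof.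
have -> : widen_ord (leqnSn d) j = lift ord_max j.
  by apply/val_inj; rewrite /= /bump leqNgt ltn_ord.
by rewrite ffunE liftK.
Qed.

Lemma lift_countK n : cancel (@lift_count n) (@top_count n).
Proof.
by move=> u; apply/matrixP => j k; rewrite mxE lift_count_widen ord1.
Qed.

Lemma sum_lift_count n (u : 'cV['I_n.+1]_d) : (\sum_j u j 0%R <= n)%N ->
  (\sum_i lift_count u i = n)%N.
Proof.
move=> h; rewrite big_ord_recr /=; under eq_bigr do rewrite lift_count_widen.
by rewrite ffunE unlift_none inordK ?ltnS ?leq_subr // subnKC.
Qed.

(** The last coordinate is minus the sum of the others up to a constant, so it deviates from [phi']
    by up to [d * dl], and [phi'] from [phi] by [dl]; the same margin shows that it is not
    negative. *)
Lemma window_box n (u : 'cV['I_n.+1]_d) (phi phi' : 'cV[K]_d.+1) (dl : K) : (0 < n)%N ->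
  simplex_int phi' -> (forall i, dl * d.+2%:R <= phi i 0) -> box dl phi phi' ->
  (forall j, `|grid K u j 0 - top phi' j 0| <= dl) ->
  (\sum_j u j 0%R <= n)%N /\ box (dl * d.+2%:R) phi (cvec K (lift_count u)).
Proof.
move=> n0 [p0' p1'] hd hb hu.
have nK : 0 < n%:R :> K by rewrite ltr0n.
have dl0 : 0 < dl by apply: le_lt_trans (hb ord0).
have hS : `|\sum_j (grid K u j 0 - top phi' j 0)| <= dl * d%:R.
  apply: (le_trans (ler_norm_sum _ _ _)); apply: (le_trans (ler_sum _ (fun j _ => hu j))).
  by rewrite sumr_const card_ord mulr_natr.
have sE : \sum_j (grid K u j 0 - top phi' j 0) = (\sum_j u j 0%R)%N%:R / n%:R - (1 - phi' ord_max 0).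
  rewrite sumrB; congr (_ - _).
    by rewrite natr_sum mulr_suml; apply: eq_bigr => j _; rewrite mxE.
  rewrite -p1' big_ord_recr /= addrK; apply: eq_bigr => j _; rewrite mxE //.
have hn : (\sum_j u j 0%R <= n)%N.
  rewrite -(ler_nat K) -[leRHS]mul1r -ler_pdivrMr //.
  move: hS; rewrite sE => /(le_trans (ler_norm _)) h1.
  have := hb ord_max; have := hd ord_max; rewrite ltr_norml -[d.+2]addn2 natrD => h2 /andP[h3 h4].
  nra.
split=> // i.
case: (unliftP ord_max i) => [j ->|->].
  have -> : lift ord_max j = widen_ord (leqnSn d) j.
    by apply/val_inj; rewrite /= /bump leqNgt ltn_ord.
  rewrite mxE lift_count_widen; have := hu j; rewrite !mxE => h1.
  have h2 := hb (widen_ord (leqnSn d) j).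
  rewrite -[X in `|X|](subrKA (phi' (widen_ord (leqnSn d) j) 0)).
  apply: (le_lt_trans (ler_normD _ _)); apply: (lt_le_trans (ler_ltD h1 h2)).
  by rewrite -[d.+2]add2n natrD mulrDr mulr_natr mulr2n lerDl mulr_ge0 ?(ltW dl0).
rewrite mxE ffunE unlift_none inordK ?ltnS ?leq_subr // natrB // mulrBl divff ?gt_eqF //.
move: hS; rewrite sE => h1; have h2 := hb ord_max.
rewrite -[X in `|X|](subrKA (phi' ord_max 0)).
apply: (le_lt_trans (ler_normD _ _)).
have h3 : `|1 - (\sum_j u j 0%R)%N%:R / n%:R - phi' ord_max 0| <= dl * d%:R.
  by rewrite -normrN; apply: le_trans h1; rewrite le_eqVlt; apply/orP; left; apply/eqP; congr `|_|; ring.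
apply: (lt_le_trans (ler_ltD h3 h2)).
by rewrite -[d.+2]addn2 natrD mulrDr lerD2l mulr_natr mulr2n lerDl ltW.
Qed.

Lemma local_lower c phi kappa e : LM c phi -> posdef (H c phi) -> 1 < kappa ->
  good_box c phi kappa e ->
  exists2 e' : K, 0 < e' & \forall n \near \oo, forall m phi', let c' := m%:R / n%:R in
    `|c' - c| < e -> LM c' phi' -> box e' phi phi' ->
    (g / C) ^+ d * peak n c' phi' <= kappa ^+ (d + 4) *
    \sum_(k : {ffun 'I_d.+1 -> 'I_n.+1} | ((\sum_i k i)%N == n) && `[< box e phi (cvec K k) >])
       lattice_term R r m k.
Proof.
move=> hL hpd k1 hgb; have [hp _ _] := hL; have [p0 p1] := hp.
have [C0 _] := hC; have [g0 _] := hg; have k0 : 0 < kappa by apply: lt_trans k1.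
have [e0 hs hbx] := hgb.
pose dl := \big[Num.min/1]_i (phi i 0 / 2).
have dl0 : 0 < dl by apply: lt_bigmin => // i _; rewrite divr_gt0.
have dle i : dl <= phi i 0 / 2 by exact: bigmin_le_cond.
have hm := @multi_close K d C hC dl kappa dl0 k1.
(* Divided by [d.+2] as in [window_box], so that every grid point of the window is the top of a
   count vector lying in the box of radius [e]. *)
pose w := Num.min e dl / d.+2%:R.
have w0 : 0 < w by rewrite divr_gt0 ?ltr0n // lt_min e0.
have we : w * d.+2%:R <= e by rewrite /w divfK ?min_le_l // gt_eqF ?ltr0n.
have wd : w * d.+2%:R <= dl by rewrite /w divfK ?min_le_r // gt_eqF ?ltr0n.
have wphi i : w * d.+2%:R <= phi i 0.
  by apply: (le_trans wd); apply: (le_trans (dle i)); have := p0 i; lra.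
have wle : w <= w * d.+2%:R by rewrite ler_peMr ?(ltW w0) ?ler1n.
have w2 i : w + w <= phi i 0.
  apply: le_trans (wphi i).
  by rewrite -[d.+2]add2n natrD mulrDr mulr_natr mulr2n lerDl mulr_ge0 ?(ltW w0).
exists w => //.
have hpd' : posdef (kappa *: H c phi) by apply: posdefZ.
have hgs := gauss_sum_ge hg hpd' k1 w0.
near=> n; move=> m phi'; set c' := m%:R / n%:R; move=> hc hL' hb'.
have n0 : (0 < n)%N by near: n; exact: nbhs_infty_gt.
have sn : 0 < Num.sqrt n%:R :> K by rewrite sqrtr_gt0 ltr0n.
pose Sp := Num.sqrt (\prod_i phi i 0).
have Sp0 : 0 < Sp by rewrite sqrtr_gt0; apply: prodr_gt0.
have P0 : 0 <= Psi R r c' phi' ^+ n by rewrite exprn_ge0 // Psi_ge0.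
have Cn : 0 < (C * Num.sqrt n%:R) ^+ d by rewrite exprn_gt0 // mulr_gt0.
have hbe := box_le (le_trans wle we) hb'.
have [_ D0 Dc _] := hbx c' phi' hc hbe.
have [hp' _ _] := hL'; have [p0' p1'] := hp'.
have plo i : w <= phi' i 0.
  by have := hb' i; have := w2 i; rewrite ltr_norml => h1 /andP[h2 _]; lra.
have term (u : 'cV['I_n.+1]_d) : (\sum_i lift_count u i)%N = n -> box e phi (cvec K (lift_count u)) ->
    (C * Num.sqrt n%:R) ^- d / Sp * Psi R r c' phi' ^+ n *
      expR (- (n%:R / 2 * quad (kappa *: H c phi) (grid K u - top phi')))
    <= kappa ^+ 2 * lattice_term R r m (lift_count u).
  set k := lift_count u; move=> hk bk; have sk := cvec_simplex K n0 hk.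
  have [hlo _ _ Sc] := hbx c' _ hc bk.
  have [_ m1] : factor_close kappa (multi K k) ((C * Num.sqrt n%:R) ^- d / Num.sqrt (\prod_i cvec K k i 0)).
    have hmn : forall k : {ffun 'I_d.+1 -> 'I_n.+1}, (\sum_i k i)%N = n ->
      (forall i, dl <= cvec K k i 0) ->
      factor_close kappa (multi K k) ((C * Num.sqrt n%:R) ^- d / Num.sqrt (\prod_i cvec K k i 0)).
      by near: n.
    by apply: hmn => // i; apply: le_trans (dle i) (ltW (hlo i)).
  have Sk0 : 0 < Num.sqrt (\prod_i cvec K k i 0).
    by rewrite sqrtr_gt0; apply: prodr_gt0 => i _; apply: lt_trans (hlo i); rewrite divr_gt0.
  have [_ S1] := closeV Sk0 Sp0 Sc.
  have /andP[hP _] := Psi_local n k1 hp hgb hc hL' hbe sk bk.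
  rewrite lattice_termE // -/c' -(lift_countK u) -top_cvec -/k.
  rewrite -mulrA [leRHS]mulrA; apply: ler_pM => //.
  - by rewrite divr_ge0 ?invr_ge0 ?(ltW Cn) ?(ltW Sp0).
  - by rewrite mulr_ge0 ?expR_ge0.
  rewrite expr2 -mulrA; apply: le_trans (ler_wpM2l (ltW k0) m1).
  by rewrite [leRHS]mulrCA ler_wpM2l // ?invr_ge0 ?(ltW Cn) //.
have hgn : g ^+ d * (Num.sqrt n%:R ^+ d / Num.sqrt (\det (kappa *: H c phi))) <= kappa *
   \sum_(u : 'cV['I_n.+1]_d | [forall i, `|grid K u i 0 - top phi' i 0| <= w])
     expR (- (n%:R / 2 * quad (kappa *: H c phi) (grid K u - top phi'))).
  have hy i : w <= top phi' i 0 <= 1 - w.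
    rewrite mxE plo /=.
    have : phi' (widen_ord (leqnSn d) i) 0 + phi' ord_max 0 <= 1.
      rewrite -p1' big_ord_recr /= lerD2r (bigD1 i) //= lerDl sumr_ge0 // => j _; exact: ltW.
    by have := plo ord_max; lra.
  by move: (top phi') hy; near: n.
pose A := (C * Num.sqrt n%:R) ^- d / Sp * Psi R r c' phi' ^+ n.
have A0 : 0 <= A by rewrite mulr_ge0 ?divr_ge0 ?invr_ge0 ?(ltW Cn) ?(ltW Sp0).
have hsum : A * \sum_(u : 'cV['I_n.+1]_d | [forall i, `|grid K u i 0 - top phi' i 0| <= w])
     expR (- (n%:R / 2 * quad (kappa *: H c phi) (grid K u - top phi'))) <= kappa ^+ 2 *
    \sum_(k : {ffun 'I_d.+1 -> 'I_n.+1} | ((\sum_i k i)%N == n) && `[< box e phi (cvec K k) >])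
       lattice_term R r m k.
  rewrite !mulr_sumr.
  apply: (@sum_le_inj K _ _ _ _ _ _ (@lift_count n)).
  - by move=> u1 u2 _ _; exact: (can_inj (@lift_countK n)).
  - move=> u /forallP hu.
    have [h1 h2] := window_box n0 hp' wphi hb' hu.
    have h3 := sum_lift_count h1; have h4 := box_le we h2.
    by split; [rewrite h3 eqxx /=; apply/asboolP | exact: term].
  - by move=> k /andP[/eqP hk _]; rewrite mulr_ge0 ?exprn_ge0 ?(ltW k0) ?lattice_term_ge0.
have dp := posdef_det hpd; have sd : 0 < Num.sqrt (\det (H c phi)) by rewrite sqrtr_gt0.
have dp' := posdef_det hpd'.
have sd' : 0 < Num.sqrt (\det (kappa *: H c phi)) by rewrite sqrtr_gt0.
have [_ db] := det_scale_bound k1 hpd.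
have Dphi : gauss_norm R c phi = Num.sqrt (\det (H c phi)) * Sp.
  by rewrite /gauss_norm sqrtrM // ltW.
have [Dc1 Dc2] := Dc.
have Dinv : 1 / gauss_norm R c' phi' <= kappa * (1 / (Num.sqrt (\det (H c phi)) * Sp)).
  by rewrite -Dphi mulrA ler_pdivlMr ?Dphi ?mulr_gt0 // mulrAC ler_pdivrMr // mul1r mulr1 -Dphi.
have B0 : 0 <= (g / C) ^+ d * Psi R r c' phi' ^+ n.
  by rewrite mulr_ge0 // exprn_ge0 // divr_ge0 // ltW.
rewrite /peak.
have st1 : (g / C) ^+ d * (Psi R r c' phi' ^+ n / gauss_norm R c' phi') <=
    (g / C) ^+ d * Psi R r c' phi' ^+ n * (kappa * (1 / Sp * (kappa ^+ d / Num.sqrt (\det (kappa *: H c phi))))).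
  rewrite mulrA ler_wpM2l //; rewrite div1r in Dinv; apply: (le_trans Dinv); rewrite ler_pM2l //.
  by rewrite invfM mul1r [leLHS]mulrC !div1r ler_pM2l ?invr_gt0 // -div1r.
apply: (le_trans st1).
have -> : (g / C) ^+ d * Psi R r c' phi' ^+ n * (kappa * (1 / Sp * (kappa ^+ d / Num.sqrt (\det (kappa *: H c phi)))))
   = kappa ^+ d * kappa * (A * (g ^+ d * (Num.sqrt n%:R ^+ d / Num.sqrt (\det (kappa *: H c phi))))).
  rewrite /A [(C * _) ^+ d]exprMn [(g / C) ^+ d]expr_div_n; field.
  by rewrite !gt_eqF ?exprn_gt0.
have kd : 0 <= kappa ^+ d * kappa by rewrite mulr_ge0 ?exprn_ge0 ?(ltW k0).
apply: (le_trans (ler_wpM2l kd (ler_wpM2l A0 hgn))).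
rewrite [A * _]mulrCA; apply: (le_trans (ler_wpM2l kd (ler_wpM2l (ltW k0) hsum))).
rewrite le_eqVlt; apply/orP; left; apply/eqP.
by rewrite exprD; ring.
Unshelve. all: by end_near.
Qed.

End LocalSums.

Lemma near_seq (I : eqType) (T : Type) (F : set_system T) (FF : Filter F) (s : seq I)
    (P : I -> T -> Prop) :
  (forall i, i \in s -> \forall t \near F, P i t) ->
  \forall t \near F, forall i, i \in s -> P i t.
Proof.
elim: s => [|j s IH] h; first by apply: nearW.
have h1 := h j (mem_head _ _).
have h2 : \forall t \near F, forall i, i \in s -> P i t.
  by apply: IH => i hi; apply: h; rewrite in_cons hi orbT.
apply: filterS2 h1 h2 => t h1 h2 i; rewrite in_cons => /orP[/eqP ->//|]; exact: h2.
Qed.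

Section SumBounds.
Variable K : realType.

Lemma sum_le1 (I : eqType) (s : seq I) (P : pred I) (a : K) : uniq s -> 0 <= a ->
  {in s &, forall i j, P i -> P j -> i = j} -> \sum_(i <- s | P i) a <= a.
Proof.
move=> us a0 h; case: (boolP (has P s)) => [/hasP[i si Pi]|hn].
  rewrite (big_rem i) //= Pi gerDl big1_seq // => j /andP[Pj]; rewrite mem_rem_uniq // inE => /andP[ji sj].
  by rewrite (h j i) ?eqxx in ji.
by rewrite big_hasC.
Qed.

(** The term of degree [p.+1] of the exponential series bounds [t ^- n] from below; the factor
    [2 ^+ p] in [D] comes from [n.+1 <= 2 * n]. *)
Lemma poly_geometric (p : nat) (t eps : K) : 0 < t < 1 -> 0 < eps ->
  \forall n \near \oo, n.+1%:R ^+ p * t ^+ n <= eps.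
Proof.
move=> /andP[t0 t1] e0.
pose a := - ln t; have a0 : 0 < a by rewrite oppr_gt0 ln_lt0 // t0.
pose D := 2 ^+ p * p.+1`!%:R / a ^+ p.+1.
near=> n.
have n0 : (0 < n)%N by near: n; exact: nbhs_infty_gt.
have nK : 0 < n%:R :> K by rewrite ltr0n.
have hn : D / eps <= n%:R by near: n; exact: nbhs_infty_ger.
have tE : t ^+ n = (expR (n%:R * a))^-1.
  by rewrite /a mulrN expRN invrK expRM_natl lnK.
rewrite tE ler_pdivrMr ?expR_gt0 //.
have an : 0 <= n%:R * a by rewrite mulr_ge0 ?ltW.
have := expR_ge1Dxn p an => h1.
have f0 : 0 < p.+1`!%:R :> K by rewrite ltr0n fact_gt0.
have h2 : (n%:R * a) ^+ p.+1 / p.+1`!%:R <= expR (n%:R * a) by lra.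
apply: le_trans (ler_wpM2l (ltW e0) h2).
have h3 : n.+1%:R ^+ p <= (n%:R * 2) ^+ p :> K.
  by rewrite lerXn2r ?nnegrE ?mulr_ge0 // -natrM ler_nat muln2 -addnn -addn1 leq_add2l.
apply: (le_trans h3); rewrite !exprMn exprS.
have -> : eps * (n%:R * n%:R ^+ p * a ^+ p.+1 / p.+1`!%:R) =
   n%:R ^+ p * (eps * n%:R * a ^+ p.+1 / p.+1`!%:R) by ring.
rewrite ler_wpM2l ?exprn_ge0 // ler_pdivlMr //.
move: hn; rewrite ler_pdivrMr // /D ler_pdivrMr ?exprn_gt0 // => hn.
by rewrite [eps * _]mulrC.
Unshelve. all: by end_near.
Qed.

End SumBounds.

(** * Assembling the boxes near one value of [c] *)

Section Core.
Variables (K : realType) (d : nat) (R : 'M[K]_d.+1) (r : 'cV[K]_d.+1).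
Hypothesis hRsym : R^T = R.
Hypothesis hRge0 : forall i j, 0 <= R i j.
Hypothesis hr : forall i, 0 < r i 0.
Hypothesis hQ : forall x, simplex_int x -> 0 < quad R x.
Implicit Types (c t : K) (x y v phi : 'cV[K]_d.+1).
Variables (C g : K).
Hypotheses (hC : stirling_spec C) (hg : gauss_const_spec g).

Let H c x := hess_Phi R (@E0 K d) c x.
Let LM c := local_minima R r (@E0 K d) c.

Lemma disjoint_boxes phi psi : phi != psi ->
  \forall e \near 0^'+, forall x, box e phi x -> ~ box e psi x.
Proof.
move=> ne.
have [i hi] : exists i, phi i 0 != psi i 0.
  apply: contrapT => hn; case/eqP: ne; apply/matrixP => i j; rewrite ord1.
  by apply/eqP; apply: contrapT => h; apply: hn; exists i; apply/negP.
have h0 : 0 < `|phi i 0 - psi i 0| / 2 by rewrite divr_gt0 // normr_gt0 subr_eq0.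
near=> e => x /(_ i) h1 /(_ i) h2.
have he : e < `|phi i 0 - psi i 0| / 2 by near: e; exact: nbhs_right_lt.
have : `|phi i 0 - psi i 0| <= `|x i 0 - phi i 0| + `|x i 0 - psi i 0|.
  by rewrite -[X in `|X|](subrKA (x i 0)) [`|x i 0 - phi i 0|]distrC ler_normD.
lra.
Unshelve. all: by end_near.
Qed.

Lemma Psi_local_max c phi kappa e c' phi' x : 1 < kappa -> simplex_int phi -> posdef (H c phi) ->
  good_box R c phi kappa e -> `|c' - c| < e -> LM c' phi' -> box e phi phi' ->
  simplex x -> box e phi x -> Psi R r c' x <= Psi R r c' phi'.
Proof.
move=> k1 hp hpd hgb hc hL hb sx bx.
have /andP[_] := Psi_local hRsym hQ 1%N k1 hp hgb hc hL hb sx bx.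
rewrite !expr1 => h; apply: (le_trans h); rewrite ler_piMr ?Psi_ge0 // -expR0 ler_expR oppr_le0.
have k0 : 0 < kappa by apply: lt_trans k1.
rewrite mulr_ge0 // quad_scale mulr_ge0 ?invr_ge0 ?(ltW k0) //.
have [->|u0] := eqVneq (top (x - phi')) 0; first by rewrite /quad mulmx0 mxE.
by apply: ltW; have [_] := hpd; apply.
Qed.

Lemma Psi_gt_near c phi (M : K) : simplex_int phi -> M < Psi R r c phi ->
  \forall c' \near c, M < Psi R r c' phi.
Proof.
move=> hp; rewrite PsiE ?hQ // => hM.
have : expR (- Phi R r c' phi) @[c' --> c] --> expR (- Phi R r c phi).
  apply: continuous_cvg; first exact: continuous_expR.
  apply: cvgN.
  apply: (@cvg_Phi K d.+1 R r _ (nbhs c) _ id (fun=> phi)).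
  - exact: cvg_id.
  - by move=> i; exact: cvg_cst.
  - exact: (proj1 hp).
  - exact: hQ.
move=> /cvg_near_gt /(_ hM); apply: filterS => c' h; by rewrite PsiE ?hQ.
Qed.

Definition types_sum n m : K :=
  \sum_(k : {ffun 'I_d.+1 -> 'I_n.+1} | (\sum_i k i)%N == n) lattice_term R r m k.

Definition peaks n c : K := \sum_(phi \in LM c) peak R r n c phi.

(** A count vector in several boxes is counted repeatedly, which an upper bound tolerates; outside
    the boxes the number of count vectors is only polynomial. *)
Lemma types_sum_le n m (L : seq 'cV[K]_d.+1) (e_ : 'cV[K]_d.+1 -> K) (M : K) : (0 < n)%N -> 0 <= M ->
  (forall x, simplex x -> (exists2 phi, phi \in L & box (e_ phi) phi x) \/
     Psi R r (m%:R / n%:R) x <= M) ->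
  types_sum n m <= \sum_(phi <- L)
    \sum_(k : {ffun 'I_d.+1 -> 'I_n.+1} | ((\sum_i k i)%N == n) && `[< box (e_ phi) phi (cvec K k) >])
       lattice_term R r m k + n.+1%:R ^+ d.+1 * M ^+ n.
Proof.
move=> n0 M0 hcov; rewrite /types_sum.
have Mn : 0 <= M ^+ n by rewrite exprn_ge0.
apply: (@le_trans _ _ (\sum_(k : {ffun 'I_d.+1 -> 'I_n.+1} | (\sum_i k i)%N == n)
   (\sum_(phi <- L | `[< box (e_ phi) phi (cvec K k) >]) lattice_term R r m k + M ^+ n))).
  apply: ler_sum => k /eqP hk; have sk := cvec_simplex K n0 hk.
  have l0 := lattice_term_ge0 hRge0 hr m n0 hk.
  have [[phi hL hb]|hM] := hcov _ sk.
    rewrite (big_rem phi) //=; case: asboolP => // _.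
    by rewrite -addrA lerDl addr_ge0 // sumr_ge0.
  apply: (le_trans (lattice_term_le hRge0 hr m n0 hk)).
  apply: (@le_trans _ _ (M ^+ n)); first by rewrite lerXn2r ?nnegrE ?Psi_ge0.
  by rewrite lerDr sumr_ge0.
rewrite big_split /=; apply: lerD.
  rewrite le_eqVlt; apply/orP; left; apply/eqP.
  under eq_bigr do rewrite big_mkcond.
  by rewrite exchange_big /=; apply: eq_bigr => phi _; rewrite big_mkcondr.
rewrite sumr_const -[X in X <= _]mulr_natl ler_wpM2r // -natrX ler_nat.
by apply: (leq_trans (max_card _)); rewrite card_ffun !card_ord.
Qed.

Lemma types_sum_ge n m (L : seq 'cV[K]_d.+1) (e : K) : (0 < n)%N -> uniq L ->
  {in L &, forall phi psi, phi != psi -> forall x, box e phi x -> ~ box e psi x} ->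
  \sum_(phi <- L)
    \sum_(k : {ffun 'I_d.+1 -> 'I_n.+1} | ((\sum_i k i)%N == n) && `[< box e phi (cvec K k) >])
       lattice_term R r m k <= types_sum n m.
Proof.
move=> n0 uL hL; under eq_bigr do rewrite big_mkcondr.
rewrite exchange_big /=; apply: ler_sum => k /eqP hk; rewrite -big_mkcond.
apply: sum_le1 => //; first exact: lattice_term_ge0.
move=> phi psi h1 h2 /asboolP b1 /asboolP b2; apply/eqP; apply: contrapT => /negP ne.
exact: hL h1 h2 ne _ b1 b2.
Qed.

Lemma peak_ge0 n c x : 0 <= peak R r n c x.
Proof. by rewrite divr_ge0 ?exprn_ge0 ?Psi_ge0 ?sqrtr_ge0. Qed.

Lemma box_center (e : K) phi : 0 < e -> box e phi phi.
Proof. by move=> e0 i; rewrite subrr normr0. Qed.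

(** Three radii are at work: [e_ phi] for the cover in the upper bound, a common [e1] that makes the
    boxes disjoint for the lower bound, and [e2] confining the local minima for [c] so that
    [local_lower] applies. *)
Lemma types_sum_close c0 kappa : 0 <= c0 ->
  (forall x, simplex_int x -> \det (H c0 x) != 0) -> 1 < kappa ->
  exists2 e : K, 0 < e & \forall n \near \oo, forall m, let c := m%:R / n%:R in
    `|c - c0| < e -> factor_close kappa (types_sum n m) ((g / C) ^+ d * peaks n c).
Proof.
move=> c00 hdet k1.
have [C0 _] := hC; have [g0 _] := hg; have k0 : 0 < kappa by apply: lt_trans k1.
have rho0 : 0 < (g / C) ^+ d by rewrite exprn_gt0 // divr_gt0.
have [k k'1 kE] := root_gt1 (d + 4) k1; have k'0 : 0 < k by apply: lt_trans k'1.
have /choice [e_ he_] : forall phi, exists e, LM c0 phi -> good_box R c0 phi k e.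
  move=> phi; case: (pselect (LM c0 phi)) => [hL|]; last by exists 0.
  have [hp _ _] := hL.
  by have [e he] := good_box_exists hRsym hQ hL (hdet _ hp) k'1; exists e.
have e_0 phi : LM c0 phi -> 0 < e_ phi by move=> /he_ [].
have [L [phi0 [M' [uL hL phi0L /andP[M'0 M'P] hcov]]]] :=
  cover_LM hRsym hRge0 hr hQ c00 hdet e_0.
have hint phi : phi \in L -> simplex_int phi by move=> /hL [].
have hpd phi : phi \in L -> posdef (H c0 phi).
  by move=> h; apply: (LM_posdef hRsym hQ (hL _ h)); exact: hdet (hint _ h).
have [e1 e10 he1] : exists2 e1 : K, 0 < e1 & forall phi, phi \in L -> e1 <= e_ phi /\
    forall psi, psi \in L -> phi != psi -> forall x, box e1 phi x -> ~ box e1 psi x.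
  have : \forall e \near (0 : K)^'+, forall phi, phi \in L -> e <= e_ phi /\
    forall psi, psi \in L -> phi != psi -> forall x, box e phi x -> ~ box e psi x.
    apply: near_seq => phi hphi; near=> e; split.
      by near: e; apply: nbhs_right_le; exact: e_0 (hL _ hphi).
    near: e; apply: near_seq => psi hpsi.
    have [->|ne] := eqVneq phi psi; first by apply: nearW.
    by apply: filterS (disjoint_boxes ne) => e h _.
  move=> hn; near (0 : K)^'+ => e; exists e; near: e; [exact: nbhs_right_gt | exact: hn].
have he1_ phi : phi \in L -> e1 <= e_ phi by move=> /he1 [].
have hdisj : {in L &, forall phi psi, phi != psi -> forall x, box e1 phi x -> ~ box e1 psi x}.
  by move=> phi psi h1 h2; have [_ h] := he1 _ h1; exact: h.
have hgood phi : phi \in L -> good_box R c0 phi k e1.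
  by move=> h; apply: good_box_le (he_ _ (hL _ h)); rewrite e10 he1_.
pose lower phi e2 n := forall m phi', let c := m%:R / n%:R in
    `|c - c0| < e1 -> LM c phi' -> box e2 phi phi' ->
    (g / C) ^+ d * peak R r n c phi' <= k ^+ (d + 4) *
    \sum_(k : {ffun 'I_d.+1 -> 'I_n.+1} | ((\sum_i k i)%N == n) && `[< box e1 phi (cvec K k) >])
       lattice_term R r m k.
have [e2 e20 [e21 he2]] : exists2 e2 : K, 0 < e2 & e2 <= e1 /\ forall phi, phi \in L ->
    \forall n \near \oo, lower phi e2 n.
  have : \forall e \near (0 : K)^'+, forall phi, phi \in L -> \forall n \near \oo, lower phi e n.
    apply: near_seq => phi hphi.
    have [e' e'0 he'] := local_lower hRsym hRge0 hr hQ hC hg (hL _ hphi) (hpd _ hphi) k'1 (hgood _ hphi).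
    near=> e; apply: filterS he' => n h m phi' c hc hL' hb; apply: h => //.
    by apply: box_le hb; near: e; exact: nbhs_right_le.
  move=> hn; near (0 : K)^'+ => e; exists e; first by near: e; exact: nbhs_right_gt.
  by split; near: e; [exact: nbhs_right_le | exact: hn].
(* The value at [phi0] stays above this level for [c] near [c0], so the remainder is smaller than
   the main term by [(M' / M) ^+ n], up to polynomial factors. *)
pose M := (M' + Psi R r c0 phi0) / 2.
have MM' : M' < M < Psi R r c0 phi0 by rewrite /M; apply/andP; split; lra.
have /andP[M'M MP] := MM'; have M0 : 0 < M by apply: lt_trans M'M.
clearbody M.
have hex : \forall c' \near c0, forall phi, phi \in L -> exists2 x, LM c' x & box e2 phi x.
  apply: (@near_seq _ _ (nbhs c0) _ L (fun phi c' => exists2 x, LM c' x & box e2 phi x)) => phi h.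
  by apply: (LM_exists hRsym hQ (hL _ h) (hdet _ (hint _ h)) e20).
have hMP := Psi_gt_near (hint _ phi0L) MP.
have : \forall c' \near c0, [/\ `|c' - c0| < e1, M < Psi R r c' phi0,
    (forall phi, phi \in L -> exists2 x, LM c' x & box e2 phi x) &
    0 <= c' -> forall x, simplex x ->
      (exists2 phi, phi \in L & box (e_ phi) phi x) \/ (Psi R r c' x <= M' /\ ~ LM c' x)].
  near=> c'; split; near: c' => //.
  by have := nbhsx_ballx c0 e1 e10; apply: filterS => c'; rewrite /ball /= distrC.
move=> /nbhs_ballP [e e0 he]; exists e => //.
have hup : \forall n \near \oo, forall phi, phi \in L -> forall m phi', let c' := m%:R / n%:R in
    `|c' - c0| < e_ phi -> LM c' phi' -> box (e_ phi) phi phi' ->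
    \sum_(k : {ffun 'I_d.+1 -> 'I_n.+1} | ((\sum_i k i)%N == n) && `[< box (e_ phi) phi (cvec K k) >])
       lattice_term R r m k <= k ^+ (d + 4) * ((g / C) ^+ d * peak R r n c' phi').
  apply: near_seq => phi h.
  exact: (local_upper hRsym hRge0 hr hQ hC hg (hL _ h) (hpd _ h) k'1 (he_ _ (hL _ h))).
have hlo : \forall n \near \oo, forall phi, phi \in L -> lower phi e2 n by exact: near_seq.
have [D0 hD] : 0 < gauss_norm R c0 phi0 /\ forall c' x, `|c' - c0| < e1 -> box e1 phi0 x ->
    0 < gauss_norm R c' x <= k * gauss_norm R c0 phi0.
  have [_ _ h] := hgood _ phi0L; split=> [|c' x hc hx].
    have cc : `|c0 - c0| < e1 by rewrite subrr normr0.
    by have [_ h0 _ _] := h c0 phi0 cc (box_center phi0 e10).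
  by have [_ -> [-> _] _] := h c' x hc hx.
(* Chosen so that the remainder is at most [k - 1] times the bound for the boxes. *)
pose eps := (k - 1) * k ^+ (d + 4) * (g / C) ^+ d / (k * gauss_norm R c0 phi0).
have eps0 : 0 < eps.
  by rewrite divr_gt0 ?(mulr_gt0 k'0) // mulr_gt0 // mulr_gt0 ?exprn_gt0 // subr_gt0.
have tM : 0 < M' / M < 1 by rewrite divr_gt0 // ltr_pdivrMr // mul1r.
have hgeo := poly_geometric d.+1 tM eps0.
near=> n; move=> m; set c := m%:R / n%:R; move=> hc.
have n0 : (0 < n)%N by near: n; exact: nbhs_infty_gt.
have cge : 0 <= c by rewrite divr_ge0.
have [hc1 hMc hexc hcovc] : [/\ `|c - c0| < e1, M < Psi R r c phi0,
    (forall phi, phi \in L -> exists2 x, LM c x & box e2 phi x) &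
    0 <= c -> forall x, simplex x ->
      (exists2 phi, phi \in L & box (e_ phi) phi x) \/ (Psi R r c x <= M' /\ ~ LM c x)].
  by apply: he; rewrite /ball /= distrC.
have /choice [psi hpsi] : forall phi, exists x, phi \in L -> LM c x /\ box e2 phi x.
  move=> phi; case: (boolP (phi \in L)) => [h|]; last by exists 0.
  by have [x] := hexc _ h; exists x.
have psi_inj : {in L &, injective psi}.
  move=> p1 p2 h1 h2 e12; apply/eqP; apply: contrapT => /negP ne.
  apply: (hdisj _ _ h1 h2 ne (psi p1)); first exact: box_le e21 (proj2 (hpsi _ h1)).
  by rewrite e12; exact: box_le e21 (proj2 (hpsi _ h2)).
have hpsie phi : phi \in L -> box (e_ phi) phi (psi phi).
  by move=> h; apply: box_le (le_trans e21 (he1_ _ h)) (proj2 (hpsi _ h)).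
(* Existence, covering and uniqueness identify the set of local minima with a finite list without
   repetitions; only then is the sum over this set an ordinary one. *)
have LME : LM c = [set` map psi L].
  apply/seteqP; split=> [y hy|y /mapP [phi h ->]]; last exact: (proj1 (hpsi _ h)).
  have [hyi _ _] := hy.
  have [[phi h hb]|[_ //]] := hcovc cge y (simplex_intW hyi).
  apply/mapP; exists phi => //.
  have [_ hs _] := he_ _ (hL _ h).
  exact: (LM_unique hRsym hQ k'0 (hint _ h) (hpd _ h) hs (lt_le_trans hc1 (he1_ _ h)) hb
    (hpsie _ h) hy (proj1 (hpsi _ h))).
have peaksE : peaks n c = \sum_(phi <- L) peak R r n c (psi phi).
  by rewrite /peaks LME -fsbig_seq ?map_inj_in_uniq // big_map.
have hupn : forall phi, phi \in L -> forall m phi', let c' := m%:R / n%:R in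
    `|c' - c0| < e_ phi -> LM c' phi' -> box (e_ phi) phi phi' ->
    \sum_(k : {ffun 'I_d.+1 -> 'I_n.+1} | ((\sum_i k i)%N == n) && `[< box (e_ phi) phi (cvec K k) >])
       lattice_term R r m k <= k ^+ (d + 4) * ((g / C) ^+ d * peak R r n c' phi').
  by near: n.
have hlon : forall phi, phi \in L -> lower phi e2 n by near: n.
have kd0 : 0 < k ^+ (d + 4) by rewrite exprn_gt0.
have kle : k ^+ (d + 4) <= kappa by rewrite -kE exprS ler_peMl ?ltW.
have peaks0 : 0 <= peaks n c by rewrite peaksE sumr_ge0 // => phi _; exact: peak_ge0.
split; last first.
  apply: (@le_trans _ _ (k ^+ (d + 4) * types_sum n m)); last first.
    rewrite ler_wpM2r // /types_sum sumr_ge0 // => l /eqP hl; exact: lattice_term_ge0.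
  apply: le_trans (ler_wpM2l (ltW kd0) (types_sum_ge m n0 uL hdisj)).
  rewrite peaksE !mulr_sumr !big_seq; apply: ler_sum => phi h.
  by apply: hlon => //; [exact: (proj1 (hpsi _ h)) | exact: (proj2 (hpsi _ h))].
have hcv x : simplex x -> (exists2 phi, phi \in L & box (e_ phi) phi x) \/ Psi R r c x <= M'.
  by move=> sx; have [|[]] := hcovc cge x sx; [left | right].
apply: (le_trans (types_sum_le n0 (ltW M'0) hcv)).
have u1 : \sum_(phi <- L)
    \sum_(k : {ffun 'I_d.+1 -> 'I_n.+1} | ((\sum_i k i)%N == n) && `[< box (e_ phi) phi (cvec K k) >])
       lattice_term R r m k <= k ^+ (d + 4) * ((g / C) ^+ d * peaks n c).
  rewrite peaksE !mulr_sumr !big_seq; apply: ler_sum => phi h.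
  apply: hupn => //; [exact: lt_le_trans hc1 (he1_ _ h) | exact: (proj1 (hpsi _ h)) | exact: hpsie].
have u2 : n.+1%:R ^+ d.+1 * M' ^+ n <= (k - 1) * (k ^+ (d + 4) * ((g / C) ^+ d * peaks n c)).
  have hb0 : box e1 phi0 (psi phi0) by apply: box_le e21 (proj2 (hpsi _ phi0L)).
  have pk : M ^+ n / (k * gauss_norm R c0 phi0) <= peaks n c.
    apply: (@le_trans _ _ (peak R r n c (psi phi0))); last first.
      by rewrite peaksE (big_rem phi0) //= lerDl sumr_ge0 // => phi _; exact: peak_ge0.
    have /andP[d1 d2] := hD c _ hc1 hb0.
    apply: ler_pM; rewrite ?exprn_ge0 ?invr_ge0 ?mulr_ge0 ?(ltW M0) ?(ltW D0) ?(ltW k'0) //; last first.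
      by rewrite lef_pV2 // posrE mulr_gt0.
    rewrite lerXn2r ?nnegrE ?Psi_ge0 ?(ltW M0) //; apply: (le_trans (ltW hMc)).
    apply: (Psi_local_max k'1 (hint _ phi0L) (hpd _ phi0L) (hgood _ phi0L) hc1 (proj1 (hpsi _ phi0L)) hb0
      (simplex_intW (hint _ phi0L)) (box_center phi0 e10)).
  have hn : n.+1%:R ^+ d.+1 * (M' / M) ^+ n <= eps by near: n.
  have A0 : 0 <= (k - 1) * k ^+ (d + 4) * (g / C) ^+ d.
    by rewrite !mulr_ge0 ?(ltW rho0) ?(ltW kd0) // subr_ge0 ltW.
  rewrite !mulrA; apply: le_trans (ler_wpM2l A0 pk).
  rewrite -[M' in leLHS](divfK (lt0r_neq0 M0)) exprMn mulrA [leRHS]mulrCA [leRHS]mulrC.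
  by rewrite ler_wpM2r ?exprn_ge0 ?(ltW M0).
rewrite -kE [k ^+ (d + 4).+1]exprS -[k * _ * _]mulrA.
have := lerD u1 u2; set X := k ^+ (d + 4) * _ => h; apply: (le_trans h); lra.
Unshelve. all: by end_near.
Qed.

End Core.

(** * The constant *)

Section Constant.
Variable K : realType.

(** The test instance: two types, all weights 1 and [c = 0], where [Phi] on the simplex is the
    negative of the entropy. *)
Let J : 'M[K]_2 := const_mx 1.
Let one : 'cV[K]_2 := const_mx 1.
Let half : 'cV[K]_2 := const_mx 2^-1.

Let quad_J (x : 'cV[K]_2) : simplex_int x -> quad J x = 1.
Proof.
move=> [_ x1]; rewrite quadE.
have -> : \sum_i \sum_j x i 0 * J i j * x j 0 = (\sum_i x i 0) * (\sum_j x j 0).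
  rewrite mulr_suml; apply: eq_bigr => i _; rewrite mulr_sumr; apply: eq_bigr => j _.
  by rewrite mxE mulr1.
by rewrite x1 mulr1.
Qed.

Let J_sym : J^T = J. Proof. exact: trmx_const. Qed.
Let J_ge0 i j : 0 <= J i j. Proof. by rewrite mxE. Qed.
Let one_gt0 i : 0 < one i 0. Proof. by rewrite mxE. Qed.
Let quad_J_gt0 x : simplex_int x -> 0 < quad J x. Proof. by move/quad_J->. Qed.

Let half_int : simplex_int half.
Proof.
split=> [i|]; first by rewrite mxE invr_gt0.
by rewrite big_ord_recr big_ord1 /= !mxE; lra.
Qed.

Let E0_one : E0 K 1 *m const_mx 1 = \col_i (if i == ord_max then -1 else 1).
Proof.
apply/matrixP => i j; rewrite ord1 [RHS]mxE.
case: (unliftP ord_max i) => [k ->|->]; last by rewrite E0_max big_ord1 mxE eqxx.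
have -> : lift ord_max k = widen_ord (leqnSn 1) k.
  by apply/val_inj; rewrite /= /bump leqNgt ltn_ord.
by rewrite E0_widen mxE ord1.
Qed.

Let det_hess x : simplex_int x -> \det (hess_Phi J (@E0 K 1) 0 x) = (x 0 0)^-1 + (x 1 0)^-1.
Proof.
move=> [x0 _]; rewrite det_mx11.
have -> : hess_Phi J (@E0 K 1) 0 x 0 0 = quad (hess_Phi J (@E0 K 1) 0 x) (const_mx 1).
  by rewrite quadE !big_ord1 !mxE mul1r mulr1.
rewrite quad_hess // E0_one /ddPhi mulr0 mul0r mul0r addr0 big_ord_recr big_ord1 /= !mxE /=.
rewrite !expr2 mulrNN !mulr1 !div1r.
by congr ((x _ 0)^-1 + (x _ 0)^-1); apply/val_inj.
Qed.

Let LM_half : local_minima J one (@E0 K 1) 0 = [set half].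
Proof.
have sub x : local_minima J one (@E0 K 1) 0 x -> x = half.
  move=> [[x0 x1] /grad0P hcr _].
  have := hcr (E0 K 1 *m const_mx 1) (E0_sum _).
  rewrite E0_one /dPhi mulr0 mul0r mul0r subr0 big_ord_recr big_ord1 /= !mxE /= ln1 !subr0.
  rewrite mul1r mulN1r => /eqP; rewrite subr_eq0 => /eqP /ln_inj; rewrite !posrE !x0 => /(_ isT isT).
  move: x1; rewrite big_ord_recr big_ord1 /= => x1 e.
  apply/matrixP => i j; rewrite ord1 [RHS]mxE.
  have e1 : x ord_max 0 = 2^-1 by rewrite -e in x1 *; lra.
  case: (unliftP ord_max i) => [k ->|->//].
  by rewrite -e1 -e; congr (x _ 0); apply/val_inj; rewrite /= /bump leqNgt ltn_ord ord1.
apply/seteqP; split=> [x /sub //|_ ->].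
(* A global maximum of [Psi] exists and is a local minimum of [Phi]; by uniqueness of the critical
   point it is [half]. *)
have [x sx hx] := Psi_max one J_ge0 (lexx 0).
have hL := Psi_max_LM J_sym J_ge0 quad_J_gt0 (lexx 0) sx hx.
by rewrite -(sub _ hL).
Qed.

(* Both constants are [sqrt (2 pi)]; instead of computing them, compare the formula
   with [2 ^ n], the number of typings of [n] vertices with two types. *)
Lemma gauss_const_stirling (C g : K) : stirling_spec C -> gauss_const_spec g -> g = C.
Proof.
move=> hC hg; have [C0 _] := hC; have [g0 _] := hg.
have hdet (x : 'cV[K]_2) : simplex_int x -> \det (hess_Phi J (@E0 K 1) 0 x) != 0.
  move=> hx; rewrite det_hess //; have [x0 _] := hx.
  by rewrite gt_eqF // addr_gt0 // invr_gt0.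
have peaksE n : peaks J one n 0 = 2 ^+ n.
  rewrite /peaks LM_half fsbig_set1 /peak /gauss_norm (det_hess half_int) big_ord_recr big_ord1 /= !mxE.
  rewrite invrK (_ : (2 + 2) * (2^-1 * 2^-1) = 1) ?sqrtr1 ?divr1; last by field.
  congr (_ ^+ n); rewrite /Psi powRr0 mulr1 /ent big_ord_recr big_ord1 /= !mxE ln1 !subr0 -mulrDl.
  rewrite (_ : 2^-1 + 2^-1 = 1) ?mul1r; last by field.
  by rewrite lnV ?posrE // opprK lnK ?posrE.
have typesE n : types_sum J one n 0 = 2 ^+ n.
  by rewrite /types_sum (lattice_sum0 one J_sym) big_ord_recr big_ord1 /= !mxE.
have key k : 1 < k -> factor_close k 1 (g / C).
  move=> k1.
  have [e e0] := types_sum_close J_sym J_ge0 one_gt0 quad_J_gt0 hC hg (lexx 0) hdet k1.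
  (* With [m = 0] the ratio is exactly 0, and both sums are [2 ^+ n] for every [n]; one large [n]
     suffices. *)
  move=> [N _ /(_ N (leqnn _) 0)]; rewrite /= mul0r subrr normr0 => /(_ e0).
  rewrite peaksE typesE expr1 /factor_close.
  have e2 : 0 < 2 ^+ N :> K by rewrite exprn_gt0.
  move=> [h1 h2]; move: h2; rewrite ler_pM2r // mulr1 => h2; split=> //.
  by rewrite -(ler_pM2r e2) mul1r -mulrA.
have gC0 : 0 < g / C by rewrite divr_gt0.
suff : g / C = 1 by move=> e; rewrite -[g](divfK (lt0r_neq0 C0)) e mul1r.
apply/eqP; rewrite eq_le; apply/andP; split; apply/ler_addgt0Pr => e e0.
  have ke : 1 < 1 + e by rewrite ltrDl.
  by have [_] := key _ ke; rewrite mulr1.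
have ke : 1 < 1 + e / (g / C) by rewrite ltrDl divr_gt0.
have [h _] := key _ ke; apply: (le_trans h).
by rewrite mulrDl mul1r divfK // gt_eqF.
Qed.

End Constant.

(** * Change of parametrization and conclusion *)

Section Parametrization.
Variables (K : realType) (d : nat) (R : 'M[K]_d.+1) (r : 'cV[K]_d.+1).
Variable E : 'M[K]_(d.+1, d).
Hypothesis hE : @param_mx K d.+1 E.

(** The columns of [E] have coordinate sum 0, so each is [E0] times its top; the matrix of these
    tops is the one whose determinant [param_mx] normalises. *)
Lemma param_factor : exists2 P : 'M[K]_d, E = E0 K d *m P & `|\det P| = 1.
Proof.
have [_ /sub_kermxP h0 hdet] := hE.
exists (rowsub (widen_ord (leq_pred d.+1)) E) => //.
have hc j : E0 K d *m top (col j E) = col j E.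
  apply: E0_top; have /matrixP /(_ 0 j) := h0; rewrite !mxE => e; rewrite -[RHS]e.
  by apply: eq_bigr => i _; rewrite !mxE mul1r.
apply/matrixP => i j; have /matrixP /(_ i 0) := hc j; rewrite [in RHS]mxE => <-.
rewrite !mxE; apply: eq_bigr => k _; rewrite !mxE; congr (_ * E _ j); exact/val_inj.
Qed.

Lemma det_hess_param c x : \det (hess_Phi R E c x) = \det (hess_Phi R (E0 K d) c x).
Proof.
have [P -> dP] := param_factor.
have -> : @hess_Phi K d.+1 R (E0 K d *m P) c x = P^T *m hess_Phi R (E0 K d) c x *m P.
  by rewrite /hess_Phi trmx_mul !mulmxA.
rewrite !det_mulmx det_tr mulrC mulrA -expr2.
by rewrite -real_normK ?num_real // dP expr1n mul1r.
Qed.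

Lemma local_minima_param c : local_minima R r E c = local_minima R r (E0 K d) c.
Proof.
have [P EP dP] := param_factor.
have uP : P \in unitmx by rewrite unitmxE unitfE -normr_eq0 dP oner_eq0.
have gE x : grad_Phi R r E c x = grad_Phi R r (E0 K d) c x *m P.
  by rewrite /grad_Phi [in LHS]EP mulmxA.
apply/seteqP; split=> x [h1 h2 h3]; split=> //.
  by rewrite -[grad_Phi _ _ _ _ _](mulmxK uP) -gE h2 mul0mx.
by rewrite gE h2 mul0mx.
Qed.

Lemma peak_param n m phi : (0 < n)%N -> (forall i, 0 < r i 0) -> simplex_int phi -> 0 <= quad R phi ->
  (vpow r phi / vpow phi phi) ^+ n *
    (quad R phi ^+ m / Num.sqrt (\det (hess_Phi R E (m%:R / n%:R) phi) * \prod_i phi i 0)) =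
  peak R r n (m%:R / n%:R) phi.
Proof.
move=> n0 hr [p0 _] Q0; rewrite det_hess_param mulrA; congr (_ / _).
have nn : n%:R != 0 :> K by rewrite pnatr_eq0 -lt0n.
rewrite /Psi [RHS]exprMn; congr (_ ^+ n * _); last first.
  by rewrite -[RHS]powR_mulrn ?powR_ge0 // -powRrM divfK // powR_mulrn.
rewrite /vpow /ent -prodf_div -sumrN expR_sum; apply: eq_bigr => i _.
by rewrite /powR !gt_eqF // -expRN -expRD mulrBr opprB.
Qed.

End Parametrization.

(** With at least two types [{0}] is a proper subset, so irreducibility yields a nonzero entry of
    [R], and one such entry makes the form positive in the interior. *)
Lemma quad_gt0_irreducible (K : realType) d (R : 'M[K]_d.+2) x : irreducible_mx R ->
  (forall i j, 0 <= R i j) -> simplex_int x -> 0 < quad R x.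
Proof.
move=> hirr hR [x0 _].
have [||i [j [_ _ Rij]]] := hirr [set ord0]%SET.
- by apply/set0Pn; exists ord0; rewrite inE.
- by apply/eqP => /setP /(_ ord_max); rewrite !inE.
have t0 k l : 0 <= x k 0 * R k l * x l 0 by rewrite !mulr_ge0 // ltW.
rewrite quadE (bigD1 i) //= (bigD1 j) //= -addrA ltr_wpDr //.
  by rewrite addr_ge0 ?sumr_ge0 // => k _; apply: sumr_ge0.
by rewrite !mulr_gt0 // lt_neqAle eq_sym Rij hR.
Qed.

(** * The case of one type, where the formula is exact *)

Section OneType.
Variables (K : realType) (R : 'M[K]_1) (r : 'cV[K]_1).
Hypothesis hr : forall i, 0 < r i 0.

Lemma simplex1 (x : 'cV[K]_1) : simplex x -> x = const_mx 1.
Proof.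
by move=> [_]; rewrite big_ord1 => e; apply/matrixP => i j; rewrite !ord1 e mxE.
Qed.

Lemma local_minima1 (E : 'M[K]_(1, 0)) c : @local_minima K 1 R r E c = [set const_mx 1].
Proof.
apply/seteqP; split=> [x [[x0 x1] _ _]|_ ->].
  by apply: simplex1; split=> // i; exact: ltW.
split.
- by split=> [i|]; rewrite ?big_ord1 mxE.
- by apply/matrixP => i [].
- by near=> x => /simplex1 ->.
Unshelve. all: by end_near.
Qed.

Lemma types_sum1 n m : (0 < n)%N -> types_sum R r n m = r 0 0 ^+ n * quad R (const_mx 1) ^+ m.
Proof.
move=> n0; pose k0 : {ffun 'I_1 -> 'I_n.+1} := [ffun=> ord_max].
rewrite /types_sum (big_pred1 k0) => [|k]; last first.
  apply/eqP/eqP => [|->]; rewrite big_ord1 ?ffunE //= => e.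
  by apply/ffunP => i; rewrite ord1 ffunE; apply/val_inj.
rewrite /lattice_term !big_ord1 ffunE /= divff ?pnatr_eq0 -?lt0n ?fact_gt0 // mul1r.
congr (_ * quad R _ ^+ _); apply/matrixP => i j.
by rewrite !mxE /k0 ffunE /= divff // pnatr_eq0 -lt0n.
Qed.

Lemma peaks1 n c : peaks R r n c = (r 0 0) ^+ n * (quad R (const_mx 1) `^ c) ^+ n.
Proof.
rewrite /peaks local_minima1 fsbig_set1 /peak /gauss_norm det_mx00 big_ord1 mxE mulr1 sqrtr1 divr1.
rewrite /Psi exprMn; congr (_ ^+ n * _).
by rewrite /ent big_ord1 mxE ln1 sub0r mul1r opprK lnK // posrE.
Qed.

End OneType.

Lemma types_sum_close_uniform (K : realType) d (R : 'M[K]_d.+1) (r : 'cV[K]_d.+1) (a b kappa : K) :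
  R^T = R -> (forall i j, 0 <= R i j) -> (forall i, 0 < r i 0) ->
  (forall x, simplex_int x -> 0 < quad R x) -> 1 < kappa ->
  (forall c x, a <= c <= b -> simplex_int x -> \det (hess_Phi R (E0 K d) c x) != 0) ->
  \forall n \near \oo, forall m, a <= m%:R / n%:R <= b ->
    factor_close kappa (types_sum R r n m) (peaks R r n (m%:R / n%:R)).
Proof.
move=> hRsym hRge0 hr hQ k1 hdet.
have [C hC] := stirling_exists K; have [g hg] := gauss_const_exists K.
have gC := gauss_const_stirling hC hg; have [C0 _] := hC.
(* The local estimates concern [c >= 0]; as [m / n] is never negative, the interval may be cut at
   0. *)
have /compact_near_coveringP hcov := @segment_compact K (Num.max 0 a) b.
have : \forall n \near \oo, `[Num.max 0 a, b]%classic `<=` (fun c => forall m, c = m%:R / n%:R ->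
    factor_close kappa (types_sum R r n m) (peaks R r n c)).
  apply: hcov => c0 /=; rewrite in_itv /= ge_max => /andP[/andP[c00 ac] cb].
  have hd x : simplex_int x -> \det (hess_Phi R (E0 K d) c0 x) != 0.
    by apply: hdet; rewrite ac.
  have [e e0 he] := types_sum_close hRsym hRge0 hr hQ hC hg c00 hd k1.
  exists (ball c0 e, [set n | forall m, let c := m%:R / n%:R in `|c - c0| < e ->
     factor_close kappa (types_sum R r n m) ((g / C) ^+ d * peaks R r n c)]).
    by split=> //; exact: nbhsx_ballx.
  move=> [c n] [/= hb hn] m cE; have := hn m; rewrite -cE gC divff ?gt_eqF // expr1n mul1r.
  by apply; rewrite distrC.
apply: filterS => n hn m /andP[h1 h2]; apply: hn => //=.
by rewrite in_itv /= h2 ge_max h1 divr_ge0.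
Qed.

Lemma factor_close_dist (K : realType) (eps s t : K) : 0 < eps -> 0 <= s -> factor_close (1 + eps) s t ->
  `|s - t| <= eps * t.
Proof.
move=> e0 s0 [h1 h2]; rewrite ler_norml; apply/andP; split; nra.
Qed.

Lemma types_sum_dist (K : realType) d (R : 'M[K]_d.+1) (r : 'cV[K]_d.+1) (a b eps : K) :
  R^T = R -> irreducible_mx R -> (forall i j, 0 <= R i j) -> (forall i, 0 < r i 0) -> 0 < eps ->
  (forall c x, a <= c <= b -> simplex_int x -> \det (hess_Phi R (E0 K d) c x) != 0) ->
  \forall n \near \oo, forall m, a <= m%:R / n%:R <= b ->
    `|types_sum R r n m - peaks R r n (m%:R / n%:R)| <= eps * peaks R r n (m%:R / n%:R).
Proof.
case: d R r => [|d] R r hRsym hRirr hRge0 hr e0 hdet.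
  near=> n; move=> m _; have n0 : (0 < n)%N by near: n; exact: nbhs_infty_gt.
  have nn : n%:R != 0 :> K by rewrite pnatr_eq0 -lt0n.
  have Q0 : 0 <= quad R (const_mx 1).
    by apply: (quad_ge0 hRge0); split=> [i|]; rewrite ?big_ord1 mxE.
  rewrite types_sum1 // peaks1 // -[(_ `^ _) ^+ n]powR_mulrn ?powR_ge0 // -powRrM divfK // powR_mulrn //.
  rewrite subrr normr0 !mulr_ge0 ?exprn_ge0 // ?(ltW e0) //; exact: ltW.
have hQ x := @quad_gt0_irreducible _ _ _ x hRirr hRge0.
have k1 : 1 < 1 + eps by rewrite ltrDl.
have h := types_sum_close_uniform hRsym hRge0 hr hQ k1 hdet.
near=> n; move=> m hm; have n0 : (0 < n)%N by near: n; exact: nbhs_infty_gt.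
apply: factor_close_dist => //; last by move: m hm; near: n.
by apply: sumr_ge0 => k /eqP hk; exact: lattice_term_ge0.
Unshelve. all: by end_near.
Qed.

Theorem theorem5 (K : realType) (q : nat) (hq : (0 < q)%N)
    (R : 'M[K]_q) (r : 'cV[K]_q)
    (hRsym : R^T = R) (hRirr : irreducible_mx R)
    (hRge0 : forall i j, 0 <= R i j) (hr : forall i, 0 < r i 0)
    (E : 'M[K]_(q, q.-1)) (hE : param_mx E)
    (a b : K) (hab : a <= b)
    (hdet : forall (c : K) (x : 'cV[K]_q), a <= c <= b -> simplex_int x ->
       \det (hess_Phi R E c x) != 0) :
  let F (n m : nat) : K :=
    n%:R ^+ (2 * m) / (2 ^ m * m`!)%:R *
    \sum_(phi \in local_minima R r E (m%:R / n%:R))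
       ((vpow r phi / vpow phi phi) ^+ n *
        (quad R phi ^+ m /
         Num.sqrt (\det (hess_Phi R E (m%:R / n%:R) phi) *
                   \prod_i phi i 0))) in
  forall eps : K, 0 < eps -> exists N : nat, forall n m : nat,
    (N <= n)%N -> a <= m%:R / n%:R <= b ->
    `|graph_number R r n m - F n m| <= eps * `|F n m|.
Proof.
case: q hq R r hRsym hRirr hRge0 hr E hE hdet => [//|d] _ R r hRsym hRirr hRge0 hr E hE hdet F eps e0.
have hdet0 c x : a <= c <= b -> simplex_int x -> \det (hess_Phi R (E0 K d) c x) != 0.
  by move=> hc hx; rewrite -(det_hess_param R hE); exact: hdet.
have [N _ hN] := types_sum_dist hRsym hRirr hRge0 hr e0 hdet0.
(* For [n = 0] the ratio [m / n] does not recover [m], so [n] is kept positive. *)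
exists (maxn N 1) => n m; rewrite geq_max => /andP[Nn n0] hm.
have FE : F n m = n%:R ^+ (2 * m) / (2 ^ m * m`!)%:R * peaks R r n (m%:R / n%:R).
  rewrite /F (local_minima_param R r hE) /peaks; congr (_ * _).
  apply: eq_fsbigr => phi /set_mem [hphi _ _]; rewrite peak_param //.
  by apply: (quad_ge0 hRge0); exact: simplex_intW.
have pre0 : 0 <= n%:R ^+ (2 * m) / (2 ^ m * m`!)%:R :> K by rewrite divr_ge0 ?exprn_ge0.
rewrite FE graph_number_lattice // -mulrBr normrM [`|_ * peaks _ _ _ _|]normrM (ger0_norm pre0) mulrCA.
rewrite ler_wpM2l //; apply: le_trans (hN n Nn m hm) _.
by rewrite ler_wpM2l ?ler_norm // ltW.
Qed.
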